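(* Let $\Gamma$ be a nonelementary discrete subgroup of $\mathrm{Sp}(2,1)$ whose trace field is contained in $\mathbb R$. Then $\Gamma$ stabilizes a totally geodesic submanifold of $\mathbf H^2_{\mathbb H}$ which is isometric to either $\mathbf H^2_{\mathbb R}$ or $\mathbf H^1_{\mathbb C}$.
   Context: $\mathbb H$ denotes the quaternions. $\mathrm{Sp}(2,1)=\{A\in\mathrm{GL}(3,\mathbb H): A^*I_{2,1}A=I_{2,1}\}$, $I_{2,1}=\mathrm{diag}(1,1,-1)$, acting (on the left on column vectors) by isometries on quaternionic hyperbolic plane $\mathbf H^2_{\mathbb H}$, the set of quaternionic lines $v\mathbb H$ with $\langle v,v\rangle=v^*I_{2,1}v<0$, with its Bergman metric. Nonelementary means the limit set in $\partial\mathbf H^2_{\mathbb H}$ has more than two points. The trace of a matrix is the sum of its diagonal entries; the trace field of $\Gamma$ is the skew field generated over $\mathbb Q$ by the traces of its elements. *)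

(* Defs.v *)
From HB Require Import structures.
From mathcomp Require Import all_boot all_order all_algebra.
From mathcomp Require Import all_classical all_reals all_analysis.
Set Implicit Arguments. Unset Strict Implicit. Unset Printing Implicit Defensive.
Import Order.TTheory GRing.Theory Num.Theory.
Local Open Scope classical_set_scope.
Local Open Scope ring_scope.

Record quat (R : Type) := Quat { qre : R; qi : R; qj : R; qk : R }.

Section QuatHyp.
Variable R : realType.

Definition q0 : quat R := Quat 0 0 0 0.
Definition qone : quat R := Quat 1 0 0 0.
Definition qofR (r : R) : quat R := Quat r 0 0 0.
Definition qadd (p q : quat R) : quat R :=
  Quat (qre p + qre q) (qi p + qi q) (qj p + qj q) (qk p + qk q).
Definition qopp (p : quat R) : quat R := Quat (- qre p) (- qi p) (- qj p) (- qk p).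
Definition qsub (p q : quat R) : quat R := qadd p (qopp q).
Definition qmul (p q : quat R) : quat R :=
  Quat (qre p * qre q - qi p * qi q - qj p * qj q - qk p * qk q)
       (qre p * qi q + qi p * qre q + qj p * qk q - qk p * qj q)
       (qre p * qj q - qi p * qk q + qj p * qre q + qk p * qi q)
       (qre p * qk q + qi p * qj q - qj p * qi q + qk p * qre q).
Definition qconj (p : quat R) : quat R := Quat (qre p) (- qi p) (- qj p) (- qk p).
Definition qnorm2 (p : quat R) : R := qre p ^+ 2 + qi p ^+ 2 + qj p ^+ 2 + qk p ^+ 2.
Definition qscale (r : R) (p : quat R) : quat R :=
  Quat (r * qre p) (r * qi p) (r * qj p) (r * qk p).
Definition qinv (p : quat R) : quat R := qscale (qnorm2 p)^-1 (qconj p).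

Definition qreal (p : quat R) : Prop := qi p = 0 /\ qj p = 0 /\ qk p = 0.
Definition qcomplex (p : quat R) : Prop := qj p = 0 /\ qk p = 0.

Definition qvec := 'I_3 -> quat R.
Definition qmat := 'I_3 -> 'I_3 -> quat R.
Definition qsum (F : 'I_3 -> quat R) : quat R := \big[qadd/q0]_(i < 3) F i.

Definition i0 : 'I_3 := @Ordinal 3 0 isT.
Definition i1 : 'I_3 := @Ordinal 3 1 isT.
Definition i2 : 'I_3 := @Ordinal 3 2 isT.

Definition Jsgn (i : 'I_3) : R := if val i == 2%N then -1 else 1.
Definition Jmat : qmat := fun i j => if i == j then qofR (Jsgn i) else q0.
Definition Imat : qmat := fun i j => if i == j then qone else q0.
Definition mmul (A B : qmat) : qmat := fun i j => qsum (fun k => qmul (A i k) (B k j)).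
Definition madj (A : qmat) : qmat := fun i j => qconj (A j i).
Definition mvec (A : qmat) (v : qvec) : qvec := fun i => qsum (fun k => qmul (A i k) (v k)).
Definition qtrace (A : qmat) : quat R := qsum (fun i => A i i).

Definition herm (v w : qvec) : quat R :=
  qsum (fun i => qmul (qconj (v i)) (qmul (qofR (Jsgn i)) (w i))).

Definition Sp21 (A : qmat) : Prop := mmul (madj A) (mmul Jmat A) = Jmat.

Definition is_subgroup_Sp21 (G : set qmat) : Prop :=
  (forall A, G A -> Sp21 A) /\ G Imat /\
  (forall A B, G A -> G B -> G (mmul A B)) /\
  (forall A, G A -> exists B, G B /\ mmul A B = Imat /\ mmul B A = Imat).

Definition mdist2 (A B : qmat) : R :=
  \sum_(i < 3) \sum_(j < 3) qnorm2 (qsub (A i j) (B i j)).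
Definition discrete_subgroup (G : set qmat) : Prop :=
  forall A, G A -> exists e : R, 0 < e /\
    forall B, G B -> mdist2 A B < e -> B = A.

Definition is_subskewfield (S : set (quat R)) : Prop :=
  S q0 /\ S qone /\ (forall p q, S p -> S q -> S (qadd p q)) /\
  (forall p, S p -> S (qopp p)) /\ (forall p q, S p -> S q -> S (qmul p q)) /\
  (forall p, S p -> p <> q0 -> S (qinv p)).
Definition trace_field (G : set qmat) : set (quat R) :=
  fun q => forall S, is_subskewfield S -> (forall A, G A -> S (qtrace A)) -> S q.

(* ball model: the point [v] with v = (z1, z2, 1) *)
Definition pt := (quat R * quat R)%type.
Definition inball (z : pt) : Prop := qnorm2 z.1 + qnorm2 z.2 < 1.
Definition onsphere (z : pt) : Prop := qnorm2 z.1 + qnorm2 z.2 = 1.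
Definition lift (z : pt) : qvec :=
  fun i => match val i with 0%N => z.1 | 1%N => z.2 | _ => qone end.
Definition chart (v : qvec) : pt := (qmul (v i0) (qinv (v i2)), qmul (v i1) (qinv (v i2))).
Definition act (A : qmat) (z : pt) : pt := chart (mvec A (lift z)).
Definition origin : pt := (q0, q0).
Definition edist2 (z w : pt) : R := qnorm2 (qsub z.1 w.1) + qnorm2 (qsub z.2 w.2).

Definition limit_set (G : set qmat) : set pt :=
  fun xi => onsphere xi /\
    forall e : R, 0 < e -> exists A, G A /\ edist2 (act A origin) xi < e.
Definition nonelementary (G : set qmat) : Prop :=
  exists x y z, limit_set G x /\ limit_set G y /\ limit_set G z /\
    x <> y /\ y <> z /\ x <> z.

(* Bergman metric: cosh^2(d/2) = <v,w><w,v> / (<v,v><w,w>) *)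
Definition acoshR (x : R) : R := ln (x + Num.sqrt (x ^+ 2 - 1)).
Definition bcosh2 (z w : pt) : R :=
  qnorm2 (herm (lift z) (lift w)) /
  (qre (herm (lift z) (lift z)) * qre (herm (lift w) (lift w))).
Definition hdist (z w : pt) : R := 2 * acoshR (Num.sqrt (bcosh2 z w)).

Definition geodesic_line (g : R -> pt) : Prop :=
  (forall t, inball (g t)) /\ (forall s t, hdist (g s) (g t) = `|s - t|).

Definition totally_geodesic (S : set pt) : Prop :=
  (forall z, S z -> inball z) /\ (exists z, S z) /\
  forall x y, S x -> S y -> x <> y ->
    forall g, geodesic_line g -> (exists s, g s = x) -> (exists t, g t = y) ->
      forall u, S (g u).

Definition H2R_std : set pt := fun z => inball z /\ qreal z.1 /\ qreal z.2.
Definition H1C_std : set pt := fun z => inball z /\ qcomplex z.1 /\ z.2 = q0.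

Definition isometric (S T : set pt) : Prop :=
  exists f : pt -> pt, (forall x, S x -> T (f x)) /\
    (forall y, T y -> exists x, S x /\ f x = y) /\
    (forall x y, S x -> S y -> hdist (f x) (f y) = hdist x y).

Definition stabilizes (G : set qmat) (S : set pt) : Prop :=
  forall A, G A -> forall z, inball z -> (S z <-> S (act A z)).

End QuatHyp.

(* Main.v *)
Require Import Defs.
From HB Require Import structures.
From mathcomp Require Import all_boot all_order all_algebra.
From mathcomp Require Import all_classical all_reals all_analysis.
From mathcomp Require Import ring lra.
Set Implicit Arguments. Unset Strict Implicit. Unset Printing Implicit Defensive.
Import Order.TTheory GRing.Theory Num.Theory.
Import numFieldNormedType.Exports.
Local Open Scope classical_set_scope.
Local Open Scope ring_scope.

(** If elements [A_n] of the group move the origin towards a boundary point [x], the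
matrices [A_n], divided by the norm of their last entry, accumulate at a rank one matrix
[x y^* J].  Hence the real span [A] of the group, which is closed under products and
under [X |-> J X^* J] and on which the trace is real, contains such a matrix for every
limit point.  Discreteness excludes a common fixed point on the boundary, so for any
limit points [x], [x'] the real space [D(x, x') = {q | x q x'^* J in A}] is nonzero.

For two limit points scaled so that [<x, z> = -1], [D(x, z)] is a real subalgebra of the
quaternions.  If it contained a nonzero imaginary [u], then either [v u v^* J] would be
in [A] for the negative vector [v = x + z], whose trace is never real, or reality of the
traces of [D(x, x)] and [D(z, z)] would force [x] and [z] to be real and
[x u z^* J] to have trace [- u].  So [D(x, z) = R], and [D(x, x)] is either [R] or [R d]
with [d] imaginary.  In the first case the limit points span a real form of signature
(2, 1) preserved by the group; in the second one [x] and [z] span an invariant complex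
line over [R + R d]. *)

(** * Quaternions *)

(** The obstacle throughout is that a quaternionic trace is neither cyclic nor invariant under
    conjugation in Sp(2,1); only its real part is. Reality of the traces cannot be carried to a
    convenient frame at the outset: it is used in the given coordinates, on rank one elements whose
    trace is explicit. Conjugation to a standard frame comes only after the traces have done their
    work.

    Discreteness acts as follows. If the whole group fixed a boundary point [p] and [A] moved the
    origin near a limit point other than [p], then [A h A^-1] would stay bounded for each [h] in the
    group, hence be constant along the limit. This yields a second null line fixed by any two given
    elements. An element whose multiplier at [p] does not have norm 1 has only one such line, so the
    group fixes two boundary points, and these leave no room for a third limit point.

    Total geodesy is phrased with metric geodesics, so the equality case of the triangle inequality
    is needed to turn an isometric parametrization into a real linear relation between lifts. *)

HB.instance Definition _ (R : realType) := gen_eqMixin (quat R).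
HB.instance Definition _ (R : realType) := gen_choiceMixin (quat R).

Lemma quat_ext (R : Type) (p q : quat R) :
  qre p = qre q -> qi p = qi q -> qj p = qj q -> qk p = qk q -> p = q.
Proof. by case: p q => [a b c d] [a' b' c' d'] /= -> -> -> ->. Qed.

Section QuatRing.
Variable R : realType.
Implicit Types p q r : quat R.

Fact qaddA : associative (@qadd R).
Proof. by move=> p q r; apply: quat_ext; rewrite /= addrA. Qed.
Fact qaddC : commutative (@qadd R).
Proof. by move=> p q; apply: quat_ext; rewrite /= addrC. Qed.
Fact qadd0 : left_id (q0 R) (@qadd R).
Proof. by move=> p; apply: quat_ext; rewrite /= add0r. Qed.
Fact qaddN : left_inverse (q0 R) (@qopp R) (@qadd R).
Proof. by move=> p; apply: quat_ext; rewrite /= addNr. Qed.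
HB.instance Definition _ := GRing.isZmodule.Build (quat R) qaddA qaddC qadd0 qaddN.

Fact qmulA : associative (@qmul R).
Proof. by move=> p q r; apply: quat_ext => /=; ring. Qed.
Fact qmul1 : left_id (qone R) (@qmul R).
Proof. by move=> p; apply: quat_ext => /=; ring. Qed.
Fact qmul1r : right_id (qone R) (@qmul R).
Proof. by move=> p; apply: quat_ext => /=; ring. Qed.
Fact qmulDl : left_distributive (@qmul R) (@qadd R).
Proof. by move=> p q r; apply: quat_ext => /=; ring. Qed.
Fact qmulDr : right_distributive (@qmul R) (@qadd R).
Proof. by move=> p q r; apply: quat_ext => /=; ring. Qed.
Fact qone_neq0 : qone R != q0 R.
Proof. by apply/eqP => -[] /eqP; rewrite oner_eq0. Qed.
HB.instance Definition _ := GRing.Zmodule_isNzRing.Build (quat R)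
  qmulA qmul1 qmul1r qmulDl qmulDr qone_neq0.

Lemma qreD p q : qre (p + q) = qre p + qre q. Proof. by []. Qed.
Lemma qiD p q : qi (p + q) = qi p + qi q. Proof. by []. Qed.
Lemma qjD p q : qj (p + q) = qj p + qj q. Proof. by []. Qed.
Lemma qkD p q : qk (p + q) = qk p + qk q. Proof. by []. Qed.
Lemma qreN p : qre (- p) = - qre p. Proof. by []. Qed.
Lemma qiN p : qi (- p) = - qi p. Proof. by []. Qed.
Lemma qjN p : qj (- p) = - qj p. Proof. by []. Qed.
Lemma qkN p : qk (- p) = - qk p. Proof. by []. Qed.
Lemma qre0 : qre (0 : quat R) = 0. Proof. by []. Qed.
Lemma qi0 : qi (0 : quat R) = 0. Proof. by []. Qed.
Lemma qj0 : qj (0 : quat R) = 0. Proof. by []. Qed.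
Lemma qk0 : qk (0 : quat R) = 0. Proof. by []. Qed.
Lemma qre1 : qre (1 : quat R) = 1. Proof. by []. Qed.
Lemma qi1 : qi (1 : quat R) = 0. Proof. by []. Qed.
Lemma qj1 : qj (1 : quat R) = 0. Proof. by []. Qed.
Lemma qk1 : qk (1 : quat R) = 0. Proof. by []. Qed.
Lemma qreM p q : qre (p * q) = qre p * qre q - qi p * qi q - qj p * qj q - qk p * qk q.
Proof. by []. Qed.
Lemma qiM p q : qi (p * q) = qre p * qi q + qi p * qre q + qj p * qk q - qk p * qj q.
Proof. by []. Qed.
Lemma qjM p q : qj (p * q) = qre p * qj q - qi p * qk q + qj p * qre q + qk p * qi q.
Proof. by []. Qed.
Lemma qkM p q : qk (p * q) = qre p * qk q + qi p * qj q - qj p * qi q + qk p * qre q.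
Proof. by []. Qed.
Definition qE := (qreM, qiM, qjM, qkM, qreD, qiD, qjD, qkD, qreN, qiN, qjN, qkN,
  qre0, qi0, qj0, qk0, qre1, qi1, qj1, qk1).

Lemma qnorm2_ge0 p : 0 <= qnorm2 p.
Proof. by rewrite /qnorm2 !addr_ge0 // sqr_ge0. Qed.
Lemma qnorm2_eq0 p : (qnorm2 p == 0) = (p == 0).
Proof.
apply/idP/eqP => [|->]; last by rewrite /qnorm2 /= !expr0n /= !addr0.
rewrite /qnorm2 !paddr_eq0 ?addr_ge0 ?sqr_ge0 // !sqrf_eq0.
by move=> /andP[/andP[/andP[/eqP a /eqP b] /eqP c] /eqP d]; apply: quat_ext.
Qed.
Lemma qnorm2_gt0 p : (0 < qnorm2 p) = (p != 0).
Proof. by rewrite lt_def qnorm2_ge0 qnorm2_eq0 andbT. Qed.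
Lemma qnorm2M p q : qnorm2 (p * q) = qnorm2 p * qnorm2 q.
Proof. by rewrite /qnorm2 !qE; ring. Qed.
Lemma qnorm2N p : qnorm2 (- p) = qnorm2 p.
Proof. by rewrite /qnorm2 !qE; ring. Qed.
Lemma qnorm2_conj p : qnorm2 (qconj p) = qnorm2 p.
Proof. by rewrite /qnorm2 /=; ring. Qed.
Lemma qnorm2_ofR (a : R) : qnorm2 (qofR a) = a ^+ 2.
Proof. by rewrite /qnorm2 /=; ring. Qed.
Lemma qnorm2_0 : qnorm2 (0 : quat R) = 0.
Proof. by apply/eqP; rewrite qnorm2_eq0. Qed.
Lemma qnorm2_1 : qnorm2 (1 : quat R) = 1.
Proof. by rewrite /qnorm2 /=; ring. Qed.

Lemma qconjK : involutive (@qconj R).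
Proof. by move=> p; apply: quat_ext; rewrite /= ?opprK. Qed.
Lemma qconjM p q : qconj (p * q) = qconj q * qconj p.
Proof. by apply: quat_ext; rewrite !qE /=; ring. Qed.
Lemma qconjD p q : qconj (p + q) = qconj p + qconj q.
Proof. by apply: quat_ext; rewrite !qE /= ?opprD. Qed.
Lemma qconjN p : qconj (- p) = - qconj p.
Proof. by apply: quat_ext. Qed.
Lemma qconj0 : qconj (0 : quat R) = 0.
Proof. by apply: quat_ext; rewrite /= ?oppr0. Qed.
Lemma qconj1 : qconj (1 : quat R) = 1.
Proof. by apply: quat_ext; rewrite /= ?oppr0. Qed.
Lemma qconj_ofR (a : R) : qconj (qofR a) = qofR a.
Proof. by apply: quat_ext; rewrite /= ?oppr0. Qed.
Lemma qconj_eq0 p : (qconj p == 0) = (p == 0).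
Proof. by rewrite -!qnorm2_eq0 qnorm2_conj. Qed.

Lemma qofR0 : qofR 0 = 0 :> quat R. Proof. by []. Qed.
Lemma qofR1 : qofR 1 = 1 :> quat R. Proof. by []. Qed.
Lemma qofRD (a b : R) : qofR (a + b) = qofR a + qofR b.
Proof. by apply: quat_ext; rewrite /= ?addr0. Qed.
Lemma qofRN (a : R) : qofR (- a) = - qofR a.
Proof. by apply: quat_ext; rewrite /= ?oppr0. Qed.
Lemma qofRM (a b : R) : qofR (a * b) = qofR a * qofR b.
Proof. by apply: quat_ext; rewrite !qE /=; ring. Qed.
Lemma qofRC (a : R) p : qofR a * p = p * qofR a.
Proof. by apply: quat_ext; rewrite !qE /=; ring. Qed.
Lemma qmulVq p : qconj p * p = qofR (qnorm2 p).
Proof. by apply: quat_ext; rewrite !qE /qnorm2 /=; ring. Qed.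
Lemma qmulqV p : p * qconj p = qofR (qnorm2 p).
Proof. by apply: quat_ext; rewrite !qE /qnorm2 /=; ring. Qed.
Lemma qinvE p : qinv p = qofR (qnorm2 p)^-1 * qconj p.
Proof. by apply: quat_ext; rewrite !qE /=; ring. Qed.

Fact qmulVr : {in [pred p : quat R | p != 0], left_inverse 1 (@qinv R) *%R}.
Proof.
by move=> p; rewrite inE => p0; rewrite qinvE -mulrA qmulVq -qofRM mulVf ?qnorm2_eq0.
Qed.
Fact qmulrV : {in [pred p : quat R | p != 0], right_inverse 1 (@qinv R) *%R}.
Proof.
move=> p; rewrite inE => p0.
by rewrite qinvE mulrA -qofRC -mulrA qmulqV -qofRM mulVf ?qnorm2_eq0.
Qed.
Fact qunitP p q : q * p = 1 /\ p * q = 1 -> [pred p : quat R | p != 0] p.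
Proof.
by case=> qp _ /=; apply/eqP => p0; move/eqP: qp; rewrite p0 mulr0 eq_sym oner_eq0.
Qed.
Fact qinv_out : {in [predC [pred p : quat R | p != 0]], @qinv R =1 id}.
Proof.
by move=> p; rewrite !inE negbK => /eqP ->; rewrite qinvE qconj0 mulr0.
Qed.
HB.instance Definition _ := GRing.NzRing_hasMulInverse.Build (quat R)
  qmulVr qmulrV qunitP qinv_out.

Lemma qunitE p : (p \is a GRing.unit) = (p != 0). Proof. by []. Qed.
Lemma qmulf_eq0 p q : (p * q == 0) = (p == 0) || (q == 0).
Proof. by rewrite -!qnorm2_eq0 qnorm2M mulf_eq0. Qed.
Lemma qnorm2V p : qnorm2 p^-1 = (qnorm2 p)^-1.
Proof.
have [->|p0] := eqVneq p 0; first by rewrite invr0 qnorm2_0 invr0.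
have: qnorm2 (p * p^-1) = 1 by rewrite mulrV ?qnorm2_1 ?qunitE.
rewrite qnorm2M => h; apply: (mulfI (x := qnorm2 p)); first by rewrite qnorm2_eq0.
by rewrite h mulfV ?qnorm2_eq0.
Qed.

Lemma qconjE p : qconj p = qofR (2 * qre p) - p.
Proof. by apply: quat_ext; rewrite !qE /=; ring. Qed.
Lemma qreMC p q : qre (p * q) = qre (q * p).
Proof. by rewrite !qE; ring. Qed.
Lemma qre_conj p : qre (qconj p) = qre p. Proof. by []. Qed.
Lemma qre_ofR (a : R) : qre (qofR a) = a. Proof. by []. Qed.

Lemma qre_sqr_le p : qre p ^+ 2 <= qnorm2 p.
Proof. by rewrite /qnorm2 -!addrA lerDl !addr_ge0 // sqr_ge0. Qed.

Lemma qnorm2D p q : qnorm2 (p + q) = qnorm2 p + qnorm2 q + 2 * qre (qconj p * q).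
Proof. by rewrite /qnorm2 !qE /=; ring. Qed.
Lemma qnorm2D_le p q : qnorm2 (p + q) <= 2 * qnorm2 p + 2 * qnorm2 q.
Proof.
have := qnorm2_ge0 (p - q); rewrite !qnorm2D qnorm2N mulrN qreN mulrN.
by move=> h; lra.
Qed.

(** Cauchy-Schwarz in the quaternionic plane. The cross term [2 t] satisfies
    [t ^+ 2 <= (a * d) * (c * b)], and the arithmetic-geometric mean inequality bounds it by
    [a * d + c * b]. *)
Lemma qcauchy p q r s :
  qnorm2 (qconj p * q + qconj r * s) <= (qnorm2 p + qnorm2 r) * (qnorm2 q + qnorm2 s).
Proof.
rewrite qnorm2D !qnorm2M !qnorm2_conj.
have := qre_sqr_le (qconj (qconj p * q) * (qconj r * s)).
rewrite !qnorm2M !qnorm2_conj !qnorm2M !qnorm2_conj.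
move: (qre _) => t; have:= qnorm2_ge0 p; have := qnorm2_ge0 q.
have:= qnorm2_ge0 r; have := qnorm2_ge0 s.
move: (qnorm2 p) (qnorm2 q) (qnorm2 r) (qnorm2 s) => a b c d d0 c0 b0 a0 h.
suff : 2 * t <= a * d + c * b by nra.
have e0 : 0 <= a * d + c * b by rewrite addr_ge0 // mulr_ge0.
have [t0|t0] := ltP t 0; first by apply: le_trans e0; lra.
rewrite -(ler_pXn2r (ltn0Sn 1)) ?nnegrE ?mulr_ge0 //.
have := sqr_ge0 (a * d - c * b); nra.
Qed.

Lemma qimag_sqr p : qre p = 0 -> p * p = - qofR (qnorm2 p).
Proof. by move=> h; apply: quat_ext; rewrite !qE /qnorm2 h /=; ring. Qed.
End QuatRing.

(** * The Hermitian form *)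

Section HermitianForm.
Variable R : realType.
Notation Q := (quat R).
Notation M3 := 'M[quat R]_3.
Notation V3 := 'cV[quat R]_3.
Implicit Types (p q : Q) (x y z v w : V3) (A B C X Y : M3).

Definition star m n (X : 'M[quat R]_(m, n)) : 'M[quat R]_(n, m) := \matrix_(i, j) qconj (X j i).
Definition JJ : M3 := \matrix_(i, j) Jmat R i j.
(* The next four operations are sealed: the unifier must not compute matrices. *)
Fact hf_sealed : {f : V3 -> V3 -> Q | forall x y, f x y = (star x *m JJ *m y) 0 0}.
Proof. by exists (fun x y => (star x *m JJ *m y) 0 0). Qed.
Definition hf := sval hf_sealed.
Lemma hf_def x y : hf x y = (star x *m JJ *m y) 0 0.
Proof. exact: (svalP hf_sealed). Qed.

Fact rs_sealed : {f : V3 -> Q -> V3 | forall x q, f x q = x *m (q%:M : 'M[quat R]_1)}.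
Proof. by exists (fun x q => x *m (q%:M : 'M[quat R]_1)). Qed.
Definition rs := sval rs_sealed.
Lemma rs_def x q : rs x q = x *m (q%:M : 'M[quat R]_1).
Proof. exact: (svalP rs_sealed). Qed.

Fact outer_sealed : {f : V3 -> V3 -> M3 | forall x y, f x y = x *m (star y *m JJ)}.
Proof. by exists (fun x y => x *m (star y *m JJ)). Qed.
Definition outer := sval outer_sealed.
Lemma outer_def x y : outer x y = x *m (star y *m JJ).
Proof. exact: (svalP outer_sealed). Qed.

Fact dag_sealed : {f : M3 -> M3 | forall X, f X = JJ *m star X *m JJ}.
Proof. by exists (fun X => JJ *m star X *m JJ). Qed.
Definition dag := sval dag_sealed.
Lemma dag_def X : dag X = JJ *m star X *m JJ.
Proof. exact: (svalP dag_sealed). Qed.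

Lemma starE m n (X : 'M[quat R]_(m, n)) i j : star X i j = qconj (X j i).
Proof. by rewrite mxE. Qed.

Lemma qconj_sum (I : Type) (r : seq I) (P : pred I) (F : I -> Q) :
  qconj (\sum_(i <- r | P i) F i) = \sum_(i <- r | P i) qconj (F i).
Proof. by apply: (big_morph (@qconj R)); [exact: qconjD | exact: qconj0]. Qed.

Lemma qre_sum (I : Type) (r : seq I) (P : pred I) (F : I -> Q) :
  qre (\sum_(i <- r | P i) F i) = \sum_(i <- r | P i) qre (F i).
Proof. by apply: (big_morph (@qre R)). Qed.

Lemma starM m n k (X : 'M[quat R]_(m, n)) (Y : 'M[quat R]_(n, k)) :
  star (X *m Y) = star Y *m star X.
Proof.
apply/matrixP => i j; rewrite !mxE qconj_sum; apply: eq_bigr => l _.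
by rewrite qconjM !mxE.
Qed.
Lemma starK m n (X : 'M[quat R]_(m, n)) : star (star X) = X.
Proof. by apply/matrixP => i j; rewrite !mxE qconjK. Qed.
Lemma starD m n (X Y : 'M[quat R]_(m, n)) : star (X + Y) = star X + star Y.
Proof. by apply/matrixP => i j; rewrite !mxE qconjD. Qed.
Lemma starN m n (X : 'M[quat R]_(m, n)) : star (- X) = - star X.
Proof. by apply/matrixP => i j; rewrite !mxE qconjN. Qed.
Lemma star_scalar n (q : Q) : star (q%:M : 'M[quat R]_n) = (qconj q)%:M.
Proof.
by apply/matrixP => i j; rewrite !mxE eq_sym; case: (_ == _) => //=; rewrite qconj0.
Qed.

Lemma mulmx_realZ m n k (X : 'M[quat R]_(m, n)) (Y : 'M[quat R]_(n, k)) (a : R) :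
  X *m (qofR a *: Y) = qofR a *: (X *m Y).
Proof.
apply/matrixP => i j; rewrite !mxE big_distrr /=; apply: eq_bigr => l _.
by rewrite !mxE !mulrA qofRC.
Qed.

Lemma ord3P (P : 'I_3 -> Prop) : P i0 -> P i1 -> P i2 -> forall i, P i.
Proof.
move=> a b c [[|[|[|//]]] h].
- by rewrite (_ : Ordinal h = i0) //; apply: val_inj.
- by rewrite (_ : Ordinal h = i1) //; apply: val_inj.
- by rewrite (_ : Ordinal h = i2) //; apply: val_inj.
Qed.

Lemma JJE i j : JJ i j = if i == j then qofR (Jsgn R i) else 0.
Proof. by rewrite mxE. Qed.
Lemma starJ : star JJ = JJ.
Proof.
apply/matrixP => i j; rewrite starE !JJE eq_sym; case: eqP => [->|_].
  by rewrite qconj_ofR.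
exact: qconj0.
Qed.

Lemma sum3 (V : nmodType) (F : 'I_3 -> V) : \sum_(i < 3) F i = F i0 + F i1 + F i2.
Proof.
rewrite !big_ord_recl big_ord0 addr0 addrA.
by congr (F _ + F _ + F _); apply: val_inj.
Qed.

Lemma mulJE n (X : 'M[quat R]_(3, n)) i j : (JJ *m X) i j = qofR (Jsgn R i) * X i j.
Proof.
rewrite mxE (bigD1 i) //= big1 ?addr0 ?JJE ?eqxx // => k ki.
by rewrite JJE eq_sym (negPf ki) mul0r.
Qed.
Lemma mulEJ n (X : 'M[quat R]_(n, 3)) i j : (X *m JJ) i j = X i j * qofR (Jsgn R j).
Proof.
rewrite mxE (bigD1 j) //= big1 ?addr0 ?JJE ?eqxx // => k kj.
by rewrite JJE (negPf kj) mulr0.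
Qed.

Lemma Jsgn0 : Jsgn R i0 = 1. Proof. by []. Qed.
Lemma Jsgn1 : Jsgn R i1 = 1. Proof. by []. Qed.
Lemma Jsgn2 : Jsgn R i2 = -1. Proof. by []. Qed.
Lemma Jsgn_sqr i : Jsgn R i * Jsgn R i = 1.
Proof. by rewrite /Jsgn; case: ifP => _; rewrite ?mulrNN mulr1. Qed.

Lemma JJK : JJ *m JJ = 1%:M.
Proof.
apply/matrixP => i j; rewrite mulJE JJE mxE; case: eqP => [->|_] /=; last by rewrite mulr0.
by rewrite -qofRM Jsgn_sqr.
Qed.

Lemma hfE x y : hf x y =
  qconj (x i0 0) * y i0 0 + qconj (x i1 0) * y i1 0 - qconj (x i2 0) * y i2 0.
Proof.
rewrite !hf_def mxE sum3 !mulEJ !starE Jsgn0 Jsgn1 Jsgn2 qofRN qofR1.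
by rewrite !mulr1 mulrN1 mulNr.
Qed.

Lemma rsE x q i : rs x q i 0 = x i 0 * q.
Proof. by rewrite rs_def mxE big_ord1 mxE eqxx mulr1n. Qed.

Lemma vecP x y : (forall i, x i 0 = y i 0) -> x = y.
Proof. by move=> h; apply/matrixP => i j; rewrite ord1. Qed.

Lemma rsA x p q : rs (rs x p) q = rs x (p * q).
Proof. by apply: vecP => i; rewrite !rsE mulrA. Qed.
Lemma rs1 x : rs x 1 = x.
Proof. by apply: vecP => i; rewrite rsE mulr1. Qed.
Lemma rs0 x : rs x 0 = 0.
Proof. by apply: vecP => i; rewrite rsE mulr0 mxE. Qed.
Lemma rsK x q : q != 0 -> rs (rs x q) q^-1 = x.
Proof. by move=> q0; rewrite rsA mulrV ?qunitE // rs1. Qed.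
Lemma rs_mul A x q : A *m rs x q = rs (A *m x) q.
Proof. by rewrite !rs_def mulmxA. Qed.
Lemma rsDl x y q : rs (x + y) q = rs x q + rs y q.
Proof. by rewrite !rs_def mulmxDl. Qed.
Lemma rsDr x p q : rs x (p + q) = rs x p + rs x q.
Proof. by apply: vecP => i; rewrite !(rsE, mxE) mulrDr. Qed.
Lemma rsN x q : rs x (- q) = - rs x q.
Proof. by apply: vecP => i; rewrite !(rsE, mxE) mulrN. Qed.

Lemma hf_mx x y : star x *m JJ *m y = (hf x y)%:M.
Proof. by rewrite hf_def; exact: mx11_scalar. Qed.
Lemma hfDr x y z : hf x (y + z) = hf x y + hf x z.
Proof. by rewrite !hf_def mulmxDr mxE. Qed.
Lemma hfDl x y z : hf (x + y) z = hf x z + hf y z.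
Proof. by rewrite !hf_def starD !mulmxDl mxE. Qed.
Lemma hfNr x y : hf x (- y) = - hf x y.
Proof. by rewrite !hf_def mulmxN mxE. Qed.
Lemma hfNl x y : hf (- x) y = - hf x y.
Proof. by rewrite !hf_def starN !mulNmx mxE. Qed.
Lemma hf0r x : hf x 0 = 0.
Proof. by rewrite !hf_def mulmx0 mxE. Qed.
Lemma hfC x y : hf y x = qconj (hf x y).
Proof. by rewrite !hfE !qconjD qconjN !qconjM !qconjK. Qed.
Lemma hf_rsr x y q : hf x (rs y q) = hf x y * q.
Proof. by rewrite !hfE !rsE !mulrA -!mulrDl -mulrBl. Qed.
Lemma hf_rsl x y q : hf (rs x q) y = qconj q * hf x y.
Proof. by rewrite hfC hf_rsr qconjM -hfC. Qed.
Lemma hfxx x : hf x x = qofR (qre (hf x x)).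
Proof.
have := hfC x x; case: (hf x x) => a b c d [hb hc hd]; apply: quat_ext => //=; lra.
Qed.
Lemma qre_hfxx x :
  qre (hf x x) = qnorm2 (x i0 0) + qnorm2 (x i1 0) - qnorm2 (x i2 0).
Proof. by rewrite hfE !qmulVq !qE. Qed.
(** [dag] is the adjoint for the Hermitian form, hence the inverse on Sp(2,1). *)
Lemma hf_dag X x y : hf (dag X *m x) y = hf x (X *m y).
Proof. by rewrite !hf_def !dag_def !starM starJ starK !mulmxA -(mulmxA _ JJ JJ) JJK mulmx1. Qed.

Lemma dagK X : dag (dag X) = X.
Proof.
by rewrite !dag_def !starM starK starJ !mulmxA JJK mul1mx -mulmxA JJK mulmx1.
Qed.
Lemma outer_mul x y z w : outer x y *m outer z w = outer (rs x (hf y z)) w.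
Proof. by rewrite !outer_def !rs_def -hf_mx !mulmxA. Qed.
Lemma outer_vec x y z : outer x y *m z = rs x (hf y z).
Proof. by rewrite !outer_def !rs_def -hf_mx !mulmxA. Qed.
Lemma mul_outer X x y : X *m outer x y = outer (X *m x) y.
Proof. by rewrite !outer_def !mulmxA. Qed.
Lemma outer_mulr X x y : outer x y *m X = outer x (dag X *m y).
Proof. by rewrite !outer_def !dag_def !starM starJ starK !mulmxA -(mulmxA _ JJ JJ) JJK mulmx1. Qed.
Lemma dag_outer x y : dag (outer x y) = outer y x.
Proof. by rewrite !dag_def !outer_def !starM starK starJ !mulmxA JJK mul1mx. Qed.
Lemma outer_rs x y q : outer (rs x q) y = outer x (rs y (qconj q)).
Proof. by rewrite !outer_def !rs_def starM star_scalar qconjK !mulmxA. Qed.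
Lemma outerDl x y z : outer (x + y) z = outer x z + outer y z.
Proof. by rewrite !outer_def mulmxDl. Qed.
Lemma outerDr x y z : outer z (x + y) = outer z x + outer z y.
Proof. by rewrite !outer_def starD mulmxDl mulmxDr. Qed.

Definition mpair C X : R := qre (\tr (C *m X)).
(** Cyclicity is restored by the real part, since [p * q] and [q * p] have the same one. *)
Lemma mpairC C X : mpair C X = mpair X C.
Proof.
rewrite /mpair /mxtrace !qre_sum.
under eq_bigr => i _ do rewrite mxE qre_sum.
rewrite exchange_big /=; apply: eq_bigr => i _.
by rewrite mxE qre_sum; apply: eq_bigr => j _; rewrite qreMC.
Qed.
Lemma qre_tr_star X : qre (\tr (star X)) = qre (\tr X).
Proof. by rewrite /mxtrace !qre_sum; apply: eq_bigr => i _; rewrite starE. Qed.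

Definition Sp A := star A *m JJ *m A = JJ.

Lemma Sp_hf A x y : Sp A -> hf (A *m x) (A *m y) = hf x y.
Proof. 
move=> h; rewrite !hf_def; congr (_ 0 0).
transitivity (star x *m (star A *m JJ *m A) *m y); last by rewrite h.
by rewrite starM !mulmxA.
Qed.
Lemma Sp_dag A : Sp A -> dag A *m A = 1%:M.
Proof. 
move=> h; transitivity (JJ *m (star A *m JJ *m A)); first by rewrite !dag_def !mulmxA.
by rewrite h JJK.
Qed.

(** Without cyclicity this does not collapse to [q] times a value of the form: each [q] stays
    between its two coordinates. *)
Lemma tr_outer x q y : \tr (outer (rs x q) y) =
  x i0 0 * q * qconj (y i0 0) + x i1 0 * q * qconj (y i1 0) - x i2 0 * q * qconj (y i2 0).
Proof.
rewrite /mxtrace sum3 !outer_def mxE big_ord1 [X in _ + X + _]mxE [X in _ + X]mxE !big_ord1.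
by rewrite !rsE !mulEJ !starE Jsgn0 Jsgn1 Jsgn2 qofRN qofR1 !mulr1 mulrN1 mulrN.
Qed.

Lemma qmulf_neq0 p q : p != 0 -> q != 0 -> p * q != 0.
Proof. by move=> p0 q0; rewrite qmulf_eq0 negb_or p0. Qed.

Definition null x := hf x x = 0.
Definition neg x := qre (hf x x) < 0.

Lemma hf_eq0C x y : hf x y = 0 -> hf y x = 0.
Proof. by move=> h; rewrite hfC h qconj0. Qed.

Lemma neg_neq0 x : neg x -> x i2 0 != 0.
Proof.
rewrite /neg qre_hfxx => h; apply/eqP => h0; move: h; rewrite h0 qnorm2_0.
by have := qnorm2_ge0 (x i0 0); have := qnorm2_ge0 (x i1 0); lra.
Qed.

(** Signature (2,1): orthogonality expresses the last entry of [w] through the first two, and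
    Cauchy-Schwarz together with negativity of [x] makes it strictly smaller than them unless they
    vanish. *)
Lemma neg_perp x w : neg x -> hf x w = 0 -> 0 <= qre (hf w w) /\ (qre (hf w w) = 0 -> w = 0).
Proof.
rewrite /neg !qre_hfxx hfE => nx /eqP; rewrite subr_eq0 => /eqP e.
have := qcauchy (x i0 0) (w i0 0) (x i1 0) (w i1 0).
rewrite e qnorm2M qnorm2_conj; clear e.
have a0 := qnorm2_ge0 (x i0 0); have a1 := qnorm2_ge0 (x i1 0); have a2 := qnorm2_ge0 (x i2 0).
have b0 := qnorm2_ge0 (w i0 0); have b1 := qnorm2_ge0 (w i1 0); have b2 := qnorm2_ge0 (w i2 0).
set t := qnorm2 (w i0 0) + qnorm2 (w i1 0).
set s := qnorm2 (x i0 0) + qnorm2 (x i1 0) in nx *.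
have t0 : 0 <= t by rewrite /t addr_ge0.
have s0 : 0 <= s by rewrite /s addr_ge0.
move=> le.
have x2 : 0 < qnorm2 (x i2 0) by lra.
have lt : t != 0 -> qnorm2 (w i2 0) < t.
  move=> tn0; rewrite -(ltr_pM2l x2); apply: le_lt_trans le _.
  by rewrite ltr_pM2r ?lt_def ?tn0 //; lra.
have eq0 : t = 0 -> qnorm2 (w i2 0) = 0.
  by move=> t00; move: le; rewrite t00 mulr0 => le; apply/eqP; rewrite eq_le b2 andbT -(pmulr_rle0 _ x2).
have [tz|tn] := eqVneq t 0; last first.
  by have h := lt tn; split=> [|h0]; [lra|exfalso; lra].
rewrite (eq0 tz) tz subrr; split=> // _; apply: vecP.
by apply: ord3P; rewrite mxE; apply/eqP; rewrite -qnorm2_eq0; apply/eqP;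
  [move: tz; rewrite /t; lra | move: tz; rewrite /t; lra | exact: eq0].
Qed.

Lemma null_eq0 x : qre (hf x x) = 0 -> x i2 0 = 0 -> x = 0.
Proof.
rewrite qre_hfxx => h x2; move: h; rewrite x2 qnorm2_0 => h.
have a0 := qnorm2_ge0 (x i0 0); have a1 := qnorm2_ge0 (x i1 0).
apply: vecP; apply: ord3P; rewrite mxE //; apply/eqP; rewrite -qnorm2_eq0; apply/eqP; lra.
Qed.

(** Subtracting from [y] the multiple of [x] with the same last entry leaves a null vector with last
    entry zero, which is zero. There are no isotropic planes. *)
Lemma null_perp x y : null x -> null y -> hf x y = 0 -> x i2 0 != 0 ->
  y = rs x ((x i2 0)^-1 * y i2 0).
Proof.
move=> nx ny xy x2; set q := _ * _; apply/eqP; rewrite -subr_eq0; apply/eqP.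
apply: null_eq0; last first.
  by rewrite [LHS]mxE [X in _ + X]mxE rsE /q mulrA mulrV ?qunitE // mul1r subrr.
rewrite hfDr !hfDl !hfNr !hfNl !hf_rsr !hf_rsl ny nx (hf_eq0C xy) xy.
by rewrite !(mul0r, mulr0, oppr0, addr0).
Qed.

Lemma null_hf_neq0 x y : null x -> null y -> x i2 0 = 1 -> y i2 0 = 1 -> x <> y -> hf x y != 0.
Proof.
move=> nx ny x2 y2 xy; apply/eqP => h; apply: xy; apply/esym.
by rewrite (null_perp nx ny h) ?x2 ?oner_neq0 // y2 invr1 mulr1 rs1.
Qed.

(** Elimination over a skew field, with coefficients on the left of the unknowns. It supplies the
    dimension counts: orthogonal vectors in [exists_perp] and linear dependence in
    [dag_linv_rinv]. *)
Lemma dep3 (u v : 'I_3 -> Q) : exists w : V3, w != 0 /\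
  \sum_i u i * w i 0 = 0 /\ \sum_i v i * w i 0 = 0.
Proof.
have dep2 (a b : Q) : exists s t : Q, (s != 0) || (t != 0) /\ a * s + b * t = 0.
  have [->|a0] := eqVneq a 0.
    by exists 1, 0; rewrite oner_neq0 mul0r mulr0 addr0.
  exists (- (a^-1 * b)), 1; rewrite oner_neq0 orbT; split=> //.
  by rewrite mulrN mulrA mulrV ?qunitE // mul1r mulr1 addNr.
pose W (a b c : Q) : V3 := \col_i (if val i == 0%N then a else if val i == 1%N then b else c).
have W0 a b c : W a b c i0 0 = a by rewrite mxE.
have W1 a b c : W a b c i1 0 = b by rewrite mxE.
have W2 a b c : W a b c i2 0 = c by rewrite mxE.
have Wn a b c : [|| a != 0, b != 0 | c != 0] -> W a b c != 0.
  apply: contraTN => /eqP h; rewrite -(W0 a b c) -{2}(W1 a b c) -{3}(W2 a b c) h !mxE.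
  by rewrite eqxx.
have [u2|u2] := eqVneq (u i2) 0; last first.
  pose a := v i0 - v i2 * (u i2)^-1 * u i0.
  pose b := v i1 - v i2 * (u i2)^-1 * u i1.
  have [s [t [st h]]] := dep2 a b.
  exists (W s t (- ((u i2)^-1 * (u i0 * s + u i1 * t)))).
  split; first by apply: Wn; rewrite orbA st.
  rewrite !sum3 !W0 !W1 !W2; split.
    by rewrite mulrN mulrA mulrV ?qunitE // mul1r subrr.
  rewrite -h /a /b mulrN mulrDr mulrDr !mulrBl !mulrA opprD.
  by rewrite -!addrA; congr (_ + _); rewrite addrCA; congr (_ + _).
have [u1|u1] := eqVneq (u i1) 0; last first.
  pose a := v i0 - v i1 * (u i1)^-1 * u i0.
  have [s [t [st h]]] := dep2 a (v i2).
  exists (W s (- ((u i1)^-1 * (u i0 * s))) t).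
  split; first by apply: Wn; rewrite orbCA st orbT.
  rewrite !sum3 !W0 !W1 !W2 u2; split.
    by rewrite mulrN mulrA mulrV ?qunitE // mul1r subrr mul0r addr0.
  by rewrite -h /a mulrN mulrBl !mulrA.
have [s [t [st h]]] := dep2 (v i1) (v i2).
exists (W 0 s t); split; first by apply: Wn; rewrite st orbT.
by rewrite !sum3 !W0 !W1 !W2 u1 u2 !mul0r !mulr0 !addr0 !add0r.
Qed.
End HermitianForm.

(** * Limits along an ultrafilter *)

Section UltraLimits.
Variables (R : realType) (T : Type) (U : set_system T).
Context {UU : UltraFilter U}.
Notation Q := (quat R).

(** An ultrafilter replaces the extraction of subsequences: compactness of the segment gives a
    cluster point, and an ultrafilter converges to each of its cluster points. *)
Lemma ultra_bounded_cvg (f : T -> R) (c : R) :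
  (\forall t \near U, `|f t| <= c) -> exists l : R, f @ U --> l.
Proof.
move=> fc.
have : (f @ U) `[- c, c]%classic.
  by apply: filterS fc => t; rewrite /= in_itv /= ler_norml.
move=> /(segment_compact (F := f @ U)) [l [_ cl]]; exists l => N lN.
have [//|UN] := in_ultra_setVsetC (f @^-1` N) UU.
by have [t [nNt Nt]] := cl (~` N) N UN lN.
Qed.

(** The four real coordinates are followed separately, so that no topology on the quaternions has to
    be introduced. *)
Definition qcvg (f : T -> Q) (l : Q) : Prop :=
  [/\ (fun t => qre (f t)) @ U --> qre l, (fun t => qi (f t)) @ U --> qi l,
      (fun t => qj (f t)) @ U --> qj l & (fun t => qk (f t)) @ U --> qk l].

Lemma qcvg_bounded (f : T -> Q) (c : R) :
  (\forall t \near U, qnorm2 (f t) <= c) -> exists l, qcvg f l.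
Proof.
move=> fc.
have sq (a : R) : a ^+ 2 <= c -> `|a| <= 1 + c.
  move=> h; have := normr_ge0 a; rewrite -(real_normK (num_real a)) in h.
  by move: h; move: `|a| => b; nra.
have [a ha] : exists l : R, (fun t => qre (f t)) @ U --> l.
  apply: (@ultra_bounded_cvg _ (1 + c)); apply: filterS fc => t h.
  by apply: sq; apply: le_trans h; rewrite /qnorm2 -!addrA lerDl !addr_ge0 // sqr_ge0.
have [b hb] : exists l : R, (fun t => qi (f t)) @ U --> l.
  apply: (@ultra_bounded_cvg _ (1 + c)); apply: filterS fc => t h.
  apply: sq; apply: le_trans h; rewrite /qnorm2.
  have := sqr_ge0 (qre (f t)); have := sqr_ge0 (qj (f t)); have := sqr_ge0 (qk (f t)).
  by move=> *; lra.
have [d hd] : exists l : R, (fun t => qj (f t)) @ U --> l.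
  apply: (@ultra_bounded_cvg _ (1 + c)); apply: filterS fc => t h.
  apply: sq; apply: le_trans h; rewrite /qnorm2.
  have := sqr_ge0 (qre (f t)); have := sqr_ge0 (qi (f t)); have := sqr_ge0 (qk (f t)).
  by move=> *; lra.
have [e he] : exists l : R, (fun t => qk (f t)) @ U --> l.
  apply: (@ultra_bounded_cvg _ (1 + c)); apply: filterS fc => t h.
  apply: sq; apply: le_trans h; rewrite /qnorm2.
  have := sqr_ge0 (qre (f t)); have := sqr_ge0 (qj (f t)); have := sqr_ge0 (qi (f t)).
  by move=> *; lra.
by exists (Quat a b d e).
Qed.

Lemma qcvg_cst (q : Q) : qcvg (fun=> q) q.
Proof. by split; exact: cvg_cst. Qed.

Lemma qcvgD f g a b : qcvg f a -> qcvg g b -> qcvg (fun t => f t + g t) (a + b).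
Proof. by move=> [? ? ? ?] [? ? ? ?]; split; exact: cvgD. Qed.

Lemma qcvgN f a : qcvg f a -> qcvg (fun t => - f t) (- a).
Proof. by move=> [? ? ? ?]; split; exact: cvgN. Qed.

Lemma qcvgM f g a b : qcvg f a -> qcvg g b -> qcvg (fun t => f t * g t) (a * b).
Proof.
move=> [a1 a2 a3 a4] [b1 b2 b3 b4]; split.
- exact: (cvgB (cvgB (cvgB (cvgM a1 b1) (cvgM a2 b2)) (cvgM a3 b3)) (cvgM a4 b4)).
- exact: (cvgB (cvgD (cvgD (cvgM a1 b2) (cvgM a2 b1)) (cvgM a3 b4)) (cvgM a4 b3)).
- exact: (cvgD (cvgD (cvgB (cvgM a1 b3) (cvgM a2 b4)) (cvgM a3 b1)) (cvgM a4 b2)).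
- exact: (cvgD (cvgB (cvgD (cvgM a1 b4) (cvgM a2 b3)) (cvgM a3 b2)) (cvgM a4 b1)).
Qed.

Lemma qcvg_conj f a : qcvg f a -> qcvg (fun t => qconj (f t)) (qconj a).
Proof. by move=> [? ? ? ?]; split => //; exact: cvgN. Qed.

Lemma qcvg_ofR (f : T -> R) (a : R) : f @ U --> a -> qcvg (fun t => qofR (f t)) (qofR a).
Proof. by move=> ?; split => //; exact: cvg_cst. Qed.

Lemma qcvg_norm2 f a : qcvg f a -> (fun t => qnorm2 (f t)) @ U --> qnorm2 a.
Proof.
move=> [? ? ? ?]; rewrite /qnorm2.
by repeat first [apply: cvgD]; under eq_fun do rewrite expr2; rewrite expr2; apply: cvgM.
Qed.

Lemma qcvg_unique f a b : qcvg f a -> qcvg f b -> a = b.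
Proof.
by move=> [? ? ? ?] [? ? ? ?]; apply: quat_ext;
  apply: (cvg_unique (F := _ @ U) (@Rhausdorff R)); eassumption.
Qed.

Lemma qcvg_near f g a : (\forall t \near U, f t = g t) -> qcvg f a -> qcvg g a.
Proof.
move=> fg [h1 h2 h3 h4]; split.
- by apply: cvg_trans h1; apply: near_eq_cvg; apply: filterS fg => t ->.
- by apply: cvg_trans h2; apply: near_eq_cvg; apply: filterS fg => t ->.
- by apply: cvg_trans h3; apply: near_eq_cvg; apply: filterS fg => t ->.
- by apply: cvg_trans h4; apply: near_eq_cvg; apply: filterS fg => t ->.
Qed.

Lemma qcvg_eq f g a : f =1 g -> qcvg f a -> qcvg g a.
Proof. by move=> fg; apply: qcvg_near; apply: nearW. Qed.

Definition mcvg m n (F : T -> 'M[Q]_(m, n)) (L : 'M[Q]_(m, n)) : Prop :=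
  forall i j, qcvg (fun t => F t i j) (L i j).

Lemma mcvg_cst m n (L : 'M[Q]_(m, n)) : mcvg (fun=> L) L.
Proof. by move=> i j; exact: qcvg_cst. Qed.

Lemma qcvg_sum n (F : 'I_n -> T -> Q) (L : 'I_n -> Q) : (forall i, qcvg (F i) (L i)) ->
  qcvg (fun t => \sum_(i < n) F i t) (\sum_(i < n) L i).
Proof.
elim: n F L => [|n IH] F L h.
  by rewrite big_ord0; apply: (qcvg_eq _ (qcvg_cst 0)) => t; rewrite big_ord0.
rewrite big_ord_recl; apply: (qcvg_eq (f := fun t => F ord0 t + \sum_(i < n) F (fintype.lift ord0 i) t)).
  by move=> t; rewrite big_ord_recl.
by apply: qcvgD => //; apply: IH => i; exact: h.
Qed.

Lemma mcvgM m n k (F : T -> 'M[Q]_(m, n)) (H : T -> 'M[Q]_(n, k)) A B :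
  mcvg F A -> mcvg H B -> mcvg (fun t => F t *m H t) (A *m B).
Proof.
move=> hF hH i j; rewrite mxE.
apply: (qcvg_eq (f := fun t => \sum_l F t i l * H t l j)); first by move=> t; rewrite mxE.
by apply: qcvg_sum => l; exact: qcvgM.
Qed.

Lemma mcvg_star m n (F : T -> 'M[Q]_(m, n)) A : mcvg F A -> mcvg (fun t => star (F t)) (star A).
Proof.
move=> h i j; rewrite starE.
by apply: (qcvg_eq (f := fun t => qconj (F t j i))) => [t|]; [rewrite starE|exact: qcvg_conj].
Qed.

Lemma mcvg_unique m n (F : T -> 'M[Q]_(m, n)) A B : mcvg F A -> mcvg F B -> A = B.
Proof. by move=> a b; apply/matrixP => i j; exact: qcvg_unique (a i j) (b i j). Qed.

Lemma mcvg_near m n (F H : T -> 'M[Q]_(m, n)) A :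
  (\forall t \near U, F t = H t) -> mcvg F A -> mcvg H A.
Proof. by move=> e h i j; apply: qcvg_near (h i j); apply: filterS e => t ->. Qed.

Lemma mcvg_mpair (F : T -> 'M[Q]_3) A (C : 'M[Q]_3) : mcvg F A ->
  (fun t => mpair C (F t)) @ U --> mpair C A.
Proof.
move=> h; have hM := mcvgM (mcvg_cst C) h.
by have [] := qcvg_sum (fun i => hM i i).
Qed.

Lemma cvg_near_eq (f : T -> R) (a b : R) : (\forall t \near U, f t = b) -> f @ U --> a -> a = b.
Proof.
move=> fb fa; apply: (cvg_unique (F := f @ U) (@Rhausdorff R)) => //.
have : (fun=> b) @ U --> b by exact: cvg_cst.
by move=> h; apply: cvg_trans h; apply: near_eq_cvg; apply: filterS fb => t ->.
Qed.
Lemma qcvgP (f : T -> Q) (a : Q) :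
  qcvg f a <-> forall e : R, 0 < e -> \forall t \near U, qnorm2 (f t - a) < e.
Proof.
split=> [fa e e0|h].
  have := qcvg_norm2 (qcvgD fa (qcvgN (qcvg_cst a))).
  by rewrite subrr qnorm2_0 => /cvgr_lt; apply.
have key (g : Q -> R) : (forall p q, g (p - q) = g p - g q) ->
    (forall p, g p ^+ 2 <= qnorm2 p) -> (fun t => g (f t)) @ U --> g a.
  move=> gB gn; apply/cvgrPdist_lt => e e0; apply: filterS (h (e ^+ 2) _) => [t lt|]; last exact: exprn_gt0.
  rewrite distrC -gB -(ltr_pXn2r (ltn0Sn 1)) ?nnegrE ?(ltW e0) //.
  by rewrite real_normK ?num_real //; apply: le_lt_trans lt; exact: gn.
split; apply: key => // p; rewrite /qnorm2; move: (sqr_ge0 (qre p)) (sqr_ge0 (qi p))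
  (sqr_ge0 (qj p)) (sqr_ge0 (qk p)) => *; lra.
Qed.
End UltraLimits.

(** * Limit points and rank one matrices *)

Section LimitPoints.
Variable R : realType.
Notation Q := (quat R).
Notation M3 := 'M[quat R]_3.
Notation V3 := 'cV[quat R]_3.
Implicit Types (p q : Q) (x y z v w : V3) (A B C X Y : M3).

Definition Sp_group (G : set M3) : Prop :=
  [/\ forall A, G A -> Sp A, G 1%:M, forall A B, G A -> G B -> G (A *m B) &
      forall A, G A -> G (dag A) /\ A *m dag A = 1%:M].

(** Column [i2] of [A] is the image of the lift (0, 0, 1) of the origin, so the two quotients are
    the ball coordinates of the moved origin. *)
Definition limit_vec (G : set M3) x : Prop :=
  [/\ x i2 0 = 1, null x & forall e : R, 0 < e -> exists2 A, G A &
    qnorm2 (A i0 i2 * (A i2 i2)^-1 - x i0 0) + qnorm2 (A i1 i2 * (A i2 i2)^-1 - x i1 0) < e].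

(* The real span of [G], as the double annihilator for the pairing [Re tr(C X)]. *)
Definition spanA (G : set M3) X : Prop :=
  forall C, (forall A, G A -> mpair C A = 0) -> mpair C X = 0.

Definition rnorm A : R := Num.sqrt (qnorm2 (A i2 i2))^-1.

Lemma hf_col A i j : hf (col i A) (col j A) = (star A *m JJ R *m A) i j.
Proof.
rewrite !hf_def [RHS]mxE [LHS]mxE; apply: eq_bigr => k _; rewrite [col j A _ _]mxE; congr (_ * _).
by rewrite !mxE; apply: eq_bigr => l _; rewrite !mxE.
Qed.

Lemma Sp_colnorm A j : Sp A ->
  qnorm2 (A i0 j) + qnorm2 (A i1 j) - qnorm2 (A i2 j) = Jsgn R j.
Proof.
move=> h; have := hf_col A j j; rewrite h JJE eqxx => e.
by have := qre_hfxx (col j A); rewrite e /= !mxE.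
Qed.

Lemma dagE X i j : dag X i j = qofR (Jsgn R i) * qconj (X j i) * qofR (Jsgn R j).
Proof. by rewrite !dag_def mulEJ mulJE starE. Qed.

Lemma qnorm2_dag X i j : qnorm2 (dag X i j) = qnorm2 (X j i).
Proof.
rewrite dagE !qnorm2M !qnorm2_ofR qnorm2_conj.
by rewrite !expr2 !Jsgn_sqr mulr1 mul1r.
Qed.

Lemma Sp_group_sp G A : Sp_group G -> G A -> Sp A /\ Sp (dag A).
Proof. by move=> [s _ _ d] GA; split; apply: s => //; have [] := d _ GA. Qed.

Lemma Sp_entry22 A : Sp A -> 1 <= qnorm2 (A i2 i2).
Proof.
move=> h; have := Sp_colnorm i2 h; rewrite Jsgn2.
by have := qnorm2_ge0 (A i0 i2); have := qnorm2_ge0 (A i1 i2); lra.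
Qed.

Lemma Sp_norm22_neq0 A : Sp A -> qnorm2 (A i2 i2) != 0.
Proof. by move=> h; rewrite gt_eqF // (lt_le_trans ltr01 (Sp_entry22 h)). Qed.

(** The last row and the last column are dominated by the corner because they have form value -1;
    the first two columns have form value 1 and are then dominated through their last entries.
    Division by the corner thus keeps all entries bounded. *)
Lemma Sp_entry A i j : Sp A -> Sp (dag A) -> qnorm2 (A i j) <= qnorm2 (A i2 i2).
Proof.
move=> h h'; have c j' := Sp_colnorm j' h; have r j' := Sp_colnorm j' h'.
have := c i0; have := c i1; have := c i2; have := r i2.
have ge k l := qnorm2_ge0 (A k l).
have := ge i0 i0; have := ge i0 i1; have := ge i0 i2.
have := ge i1 i0; have := ge i1 i1; have := ge i1 i2.
have := ge i2 i0; have := ge i2 i1; have := ge i2 i2.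
rewrite !qnorm2_dag Jsgn0 Jsgn1 Jsgn2.
by move=> *; move: i j; apply: ord3P; apply: ord3P; lra.
Qed.

(** A double annihilator is an intersection of kernels of continuous functionals, hence closed. *)
Lemma spanA_limit G (U : set_system M3) (UU : UltraFilter U) (F : M3 -> M3) L :
  (\forall A \near U, spanA G (F A)) -> mcvg U F L -> spanA G L.
Proof.
move=> hF hL C hC.
apply: (@cvg_near_eq _ _ U UU (fun A => mpair C (F A)) _ 0); last exact: mcvg_mpair.
by apply: filterS hF => A; apply.
Qed.

Lemma mpairZ C X (a : R) : mpair C (qofR a *: X) = a * mpair C X.
Proof.
rewrite /mpair /mxtrace !qre_sum mulr_sumr; apply: eq_bigr => i _.
rewrite !mxE !qre_sum mulr_sumr; apply: eq_bigr => j _.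
by rewrite !mxE !qE /=; ring.
Qed.

(** Rescaling the relations of Sp(2,1) for [A] and for its adjoint sends their right-hand sides to
    0, so the limit matrix has isotropic column and row spaces. These are lines, and the last column
    lies in the line of [x]. *)
Lemma limit_rank1 G x : Sp_group G -> limit_vec G x ->
  exists (U : set_system M3) y, [/\ UltraFilter U, U G, null y, y i2 0 != 0 &
   (fun A => (qnorm2 (A i2 i2))^-1) @ U --> (0 : R) /\
   mcvg U (fun A => qofR (rnorm A) *: A) (outer x y)].
Proof.
move=> GG [x2 nx hx].
pose d A := qnorm2 (A i0 i2 * (A i2 i2)^-1 - x i0 0) + qnorm2 (A i1 i2 * (A i2 i2)^-1 - x i1 0).
(* The filter of elements of [G] that move the origin close to [x], refined to an ultrafilter. *)
have [U [UU FU]] : exists U : set_system M3, UltraFilter U /\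
    filter_from [set e : R | 0 < e] (fun e => [set A | G A /\ d A < e]) `<=` U.
  apply: ultraFilterLemma; apply: filter_from_proper.
    apply: filter_from_filter; first by exists 1; exact: ltr01.
    move=> e f e0 f0; exists (Num.min e f); first by rewrite /= lt_min e0 f0.
    by move=> A [GA]; rewrite lt_min => /andP[h1 h2].
  by move=> e e0; have [A GA dA] := hx e e0; exists A.
have PU : ProperFilter U by exact: ultra_proper.
have UG : U G.
  by apply: FU; exists 1; [exact: ltr01|move=> A []].
have Ud e : 0 < e -> \forall A \near U, d A < e.
  by move=> e0; apply: FU; exists e => // A [].
have c0 : qcvg U (fun A => A i0 i2 * (A i2 i2)^-1) (x i0 0).
  apply/qcvgP => e e0; apply: filterS (Ud e e0) => A; apply: le_lt_trans.
  by rewrite /d lerDl qnorm2_ge0.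
have c1 : qcvg U (fun A => A i1 i2 * (A i2 i2)^-1) (x i1 0).
  apply/qcvgP => e e0; apply: filterS (Ud e e0) => A; apply: le_lt_trans.
  by rewrite /d lerDr qnorm2_ge0.
(* By the relation for the last column, this inverse is 1 minus the squared Euclidean norm of the
   moved origin, which tends to the sphere. *)
have nu0 : (fun A => (qnorm2 (A i2 i2))^-1) @ U --> (0 : R).
  have -> : 0 = 1 - qnorm2 (x i0 0) - qnorm2 (x i1 0).
    by move: (qre_hfxx x); rewrite nx x2 qnorm2_1 qre0; lra.
  have h : (fun A => 1 - qnorm2 (A i0 i2 * (A i2 i2)^-1) - qnorm2 (A i1 i2 * (A i2 i2)^-1)) @ U
      --> 1 - qnorm2 (x i0 0) - qnorm2 (x i1 0).
    by apply: cvgB (qcvg_norm2 c1); apply: cvgB (qcvg_norm2 c0); exact: cvg_cst.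
  apply: cvg_trans h; apply: near_eq_cvg; apply: filterS UG => A GA /=.
  have [sA _] := Sp_group_sp GG GA.
  rewrite !qnorm2M qnorm2V; have := Sp_colnorm i2 sA; rewrite Jsgn2 => e.
  have n0 : qnorm2 (A i2 i2) != 0 by exact: Sp_norm22_neq0.
  by apply: (mulIf n0); rewrite !mulrBl mul1r !divfK // mulVf //; lra.
have rr A : G A -> rnorm A * rnorm A = (qnorm2 (A i2 i2))^-1.
  by move=> GA; rewrite -expr2 sqr_sqrtr // invr_ge0 qnorm2_ge0.
have n22 A : G A -> qnorm2 (A i2 i2) != 0.
  move=> GA; have [sA _] := Sp_group_sp GG GA.
  exact: Sp_norm22_neq0.
have bd i j : exists l, qcvg U (fun A => (qofR (rnorm A) *: A) i j) l.
  apply: (@qcvg_bounded _ _ _ _ _ 1); apply: filterS UG => A GA.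
  have [sA sA'] := Sp_group_sp GG GA.
  rewrite mxE qnorm2M qnorm2_ofR expr2 rr // mulrC -[leRHS](mulfV (n22 _ GA)).
  by rewrite ler_wpM2r ?invr_ge0 ?qnorm2_ge0 // Sp_entry.
pose L : M3 := \matrix_(i, j) sval (cid (bd i j)).
have cL : mcvg U (fun A => qofR (rnorm A) *: A) L.
  move=> i j; have -> : L i j = sval (cid (bd i j)) by rewrite mxE.
  exact: (svalP (cid (bd i j))).
have nuJ : mcvg U (fun A => qofR (qnorm2 (A i2 i2))^-1 *: JJ R) 0.
  move=> i j; rewrite mxE; apply: (qcvg_eq (f := fun A => qofR (qnorm2 (A i2 i2))^-1 * JJ R i j)).
    by move=> A; rewrite [RHS]mxE.
  have -> : 0 = qofR 0 * JJ R i j by rewrite mul0r.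
  apply: qcvgM; [exact: qcvg_ofR | exact: qcvg_cst].
have starZ A (a : R) : star (qofR a *: A) = qofR a *: star A.
  by apply/matrixP => i j; rewrite !mxE qconjM qconj_ofR qofRC.
have hL : star L *m JJ R *m L = 0.
  apply: (mcvg_unique (U := U)) nuJ.
  apply: mcvg_near (mcvgM (mcvgM (mcvg_star cL) (mcvg_cst (JJ R))) cL).
  apply: filterS UG => A GA; rewrite starZ mulmx_realZ -!scalemxAl.
  by have [-> _] := Sp_group_sp GG GA; rewrite scalerA -qofRM rr.
have hL' : L *m JJ R *m star L = 0.
  apply: (mcvg_unique (U := U)) nuJ.
  apply: mcvg_near (mcvgM (mcvgM cL (mcvg_cst (JJ R))) (mcvg_star cL)).
  apply: filterS UG => A GA; rewrite starZ mulmx_realZ -!scalemxAl scalerA -qofRM rr //.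
  have [_ _ _ /(_ A GA) [_]] := GG; rewrite dag_def => e; congr (_ *: _).
  by rewrite -[LHS]mulmx1 -(JJK R) [LHS]mulmxA -(mulmxA A) -(mulmxA A) e mul1mx.
have L22 : qnorm2 (L i2 i2) = 1.
  apply: (cvg_near_eq _ (qcvg_norm2 (cL i2 i2))); apply: filterS UG => A GA.
  by rewrite mxE qnorm2M qnorm2_ofR expr2 rr // mulVf // n22.
have L22n : L i2 i2 != 0 by rewrite -qnorm2_eq0 L22 oner_neq0.
have A22n A : G A -> A i2 i2 != 0 by move=> GA; rewrite -qnorm2_eq0 n22.
have Li2 i : L i i2 = x i 0 * L i2 i2.
  move: i; apply: ord3P.
  - apply: (qcvg_unique (cL i0 i2)).
    apply: qcvg_near (qcvgM c0 (cL i2 i2)); apply: filterS UG => A GA.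
    by rewrite !mxE !mulrA -(qofRC (rnorm A)) -!mulrA mulVr ?mulr1 ?qunitE ?A22n.
  - apply: (qcvg_unique (cL i1 i2)).
    apply: qcvg_near (qcvgM c1 (cL i2 i2)); apply: filterS UG => A GA.
    by rewrite !mxE !mulrA -(qofRC (rnorm A)) -!mulrA mulVr ?mulr1 ?qunitE ?A22n.
  - by rewrite x2 mul1r.
have colL : col i2 L = rs x (L i2 i2) by apply: vecP => i; rewrite rsE mxE.
(* Every column of the limit is null and orthogonal to the last one, a nonzero multiple of [x], so
   [null_perp] applies. *)
have Lij i j : L i j = x i 0 * L i2 j.
  have nj : null (col j L) by rewrite /null hf_col hL mxE.
  have : hf (col i2 L) (col j L) = 0 by rewrite hf_col hL mxE.
  rewrite colL hf_rsl => /eqP; rewrite qmulf_eq0 qconj_eq0 (negPf L22n) => /eqP xj.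
  have := null_perp nx nj xj; rewrite x2 oner_neq0 invr1 mul1r => /(_ isT).
  by move=> /(congr1 (fun v : V3 => v i 0)); rewrite rsE !mxE.
pose y : V3 := JJ R *m star (row i2 L).
have ry : star y *m JJ R = row i2 L.
  by rewrite /y starM starK starJ -mulmxA JJK mulmx1.
exists U, y; split => //.
- have e : star (row i2 L) = col i2 (star L) by apply/matrixP => i j; rewrite !mxE.
  rewrite /null !hf_def ry /y e mulmxA.
  transitivity ((L *m JJ R *m star L) i2 i2); last by rewrite hL' mxE.
  rewrite [LHS]mxE [RHS]mxE; apply: eq_bigr => k _; rewrite [col _ _ _ _]mxE; congr (_ * _).
  by rewrite !mxE; apply: eq_bigr => l _; rewrite !mxE.
- by rewrite /y mulJE starE mxE Jsgn2 qofRN qofR1 mulN1r oppr_eq0 qconj_eq0.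
- split => //; have -> // : outer x y = L.
  by apply/matrixP => i j; rewrite !outer_def ry mxE big_ord1 mxE -Lij.
Qed.
End LimitPoints.

(** * Absence of a global fixed point *)

Section NoFixedPoint.
Variable R : realType.
Notation Q := (quat R).
Notation M3 := 'M[quat R]_3.
Notation V3 := 'cV[quat R]_3.
Implicit Types (p q x y z v w : V3) (A B C X Y h : M3) (a b m : Q).

Definition E3 : V3 := delta_mx i2 0.

Lemma mul_E3 A : A *m E3 = col i2 A.
Proof. exact/esym/colE. Qed.

Lemma E3E i : E3 i 0 = if i == i2 then 1 else 0.
Proof. by rewrite mxE eqxx andbT; case: eqP. Qed.

Lemma hfE3r x : hf x E3 = - qconj (x i2 0).
Proof. by rewrite hfE !E3E /= !mulr0 mulr1 add0r sub0r. Qed.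
Lemma hfE3l x : hf E3 x = - x i2 0.
Proof. by rewrite hfC hfE3r qconjN qconjK. Qed.

Definition fixes A p := exists a, A *m p = rs p a.

Lemma Sp_fixed A p a v : Sp A -> A *m p = rs p a -> qconj a * hf p (A *m v) = hf p v.
Proof. by move=> sA e; rewrite -hf_rsl -e Sp_hf. Qed.

Lemma Sp_fixed_neq0 A p a : Sp A -> A *m p = rs p a -> p i2 0 != 0 -> a != 0.
Proof.
move=> sA e p2; apply/eqP => a0; have := Sp_fixed E3 sA e.
rewrite a0 qconj0 mul0r hfE3r => /eqP; rewrite eq_sym oppr_eq0 qconj_eq0.
by rewrite (negPf p2).
Qed.

(** Invariance of the form on [p] and the lift of the origin. The multiplier at [p] is thereby read
    off the last column of [A], whose rescaled limit is known. *)
Lemma mu_norm A p a : Sp A -> A *m p = rs p a -> p i2 0 = 1 ->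
  qnorm2 a * qnorm2 (hf p (col i2 A)) = 1.
Proof.
move=> sA e p2; have := Sp_fixed E3 sA e; rewrite mul_E3 hfE3r p2 qconj1.
by move=> /(congr1 (@qnorm2 R)); rewrite qnorm2M qnorm2_conj qnorm2N qnorm2_1.
Qed.

Lemma mu_pair A p q a b : Sp A -> A *m p = rs p a -> A *m q = rs q b -> hf p q != 0 ->
  qnorm2 a * qnorm2 b = 1.
Proof.
move=> sA ep eq pq; have := Sp_hf p q sA; rewrite ep eq hf_rsl hf_rsr.
move=> /(congr1 (@qnorm2 R)); rewrite !qnorm2M qnorm2_conj => e.
apply: (mulIf (x := qnorm2 (hf p q))); first by rewrite qnorm2_eq0.
by rewrite mul1r -[RHS]e; ring.
Qed.

(* Write [A^-1 E3 = p al + w'] with last entry of [w'] zero.  Since [p] is null and fixed,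
   [|w'|^2] is controlled by [al <p, A^-1 E3>], and so is every term of the expansion of
   [<A^-1 E3, h A^-1 E3>], which is the last entry of [A h A^-1] up to sign. *)
Lemma conj_bound A h p a b : Sp A -> Sp (dag A) -> Sp h -> Sp (dag h) ->
  null p -> p i2 0 = 1 -> A *m p = rs p a -> h *m p = rs p b ->
  qnorm2 ((A *m h *m dag A) i2 i2) <=
  qnorm2 (A i2 i2) * qnorm2 a * (4 * (qnorm2 b)^-1 + 4 * qnorm2 b + 32 * qnorm2 (h i2 i2)).
Proof.
move=> sA sA' sh sh' np p2 eA eh.
set t := qnorm2 (A i2 i2) * qnorm2 a.
have t0 : 0 <= t by rewrite mulr_ge0 ?qnorm2_ge0.
have b0 : b != 0 by apply: Sp_fixed_neq0 sh eh _; rewrite p2 oner_neq0.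
pose w := dag A *m E3; pose al := w i2 0; pose w' := w - rs p al.
have nal : qnorm2 al = qnorm2 (A i2 i2) by rewrite /al /w mul_E3 mxE qnorm2_dag.
have pw : qnorm2 (hf p w) = qnorm2 a.
  rewrite /w -hf_dag dagK eA hf_rsl hfE3r p2 qconj1 qnorm2M qnorm2_conj.
  by rewrite qnorm2N qnorm2_1 mulr1.
have w'2 : w' i2 0 = 0 by rewrite /w' [LHS]mxE [X in _ + X]mxE rsE p2 mul1r subrr.
have pw' : hf p w' = hf p w by rewrite /w' hfDr hfNr hf_rsr np mul0r oppr0 addr0.
have wE : w = rs p al + w' by rewrite /w' addrC subrK.
clearbody w' al.
pose s := qnorm2 (w' i0 0) + qnorm2 (w' i1 0).
have s0 : 0 <= s by rewrite addr_ge0 ?qnorm2_ge0.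
have sE : qre (hf w' w') = s by rewrite qre_hfxx w'2 qnorm2_0 subr0.
(* Expanding the form value -1 of [w = p al + w'] gives [s + 1 = -2 Re (conj al * <p, w>)], and the
   modulus of that product squares to [t]. *)
have st : s ^+ 2 <= 4 * t.
  have e1 : qre (hf w w) = -1.
    by rewrite /w Sp_hf // hfE3r E3E eqxx qconj1 qreN qre1.
  have e2 : s + 1 = - (2 * qre (qconj al * hf p w)).
    rewrite -pw'; move: e1; rewrite wE hfDr !hfDl !hf_rsr !hf_rsl np mulr0 mul0r add0r !qreD sE.
    have -> : qre (hf w' p * al) = qre (qconj al * hf p w').
      by rewrite -[LHS]qre_conj qconjM -hfC.
    by move: (qre _) => u e; lra.
  have := qre_sqr_le (qconj al * hf p w); rewrite qnorm2M qnorm2_conj nal pw -/t.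
  by move: e2; move: (qre _) => u e2 hu; nra.
have BE : qnorm2 ((A *m h *m dag A) i2 i2) = qnorm2 (hf w (h *m w)).
  rewrite /w hf_dag hfE3l qnorm2N !mulmxA mul_E3.
  by congr qnorm2; rewrite [RHS]mxE.
have e3 : hf w (h *m w) = qconj al * hf p (h *m w') + hf w' p * b * al + hf w' (h *m w').
  rewrite wE mulmxDr rs_mul eh rsA !hfDr !hfDl !hf_rsl !hf_rsr np mul0r mulr0 add0r.
  by rewrite -addrA addrCA !mulrA addrA.
have n1 : qnorm2 (qconj al * hf p (h *m w')) = t * (qnorm2 b)^-1.
  rewrite qnorm2M qnorm2_conj nal /t -pw -pw' -(Sp_fixed w' sh eh) qnorm2M qnorm2_conj.
  by rewrite -!mulrA (mulrC (qnorm2 b)) -!mulrA mulVf ?mulr1 // qnorm2_eq0.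
have n2 : qnorm2 (hf w' p * b * al) = t * qnorm2 b.
  by rewrite !qnorm2M nal hfC qnorm2_conj pw' pw /t; ring.
have n3 : qnorm2 (hf w' (h *m w')) <= s * (4 * qnorm2 (h i2 i2) * s).
  rewrite hfE w'2 qconj0 mul0r subr0; apply: le_trans (qcauchy _ _ _ _) _.
  rewrite -/s; apply: ler_wpM2l => //.
  have key i : qnorm2 ((h *m w') i 0) <= 2 * qnorm2 (h i2 i2) * s.
    rewrite mxE sum3 w'2 mulr0 addr0; apply: le_trans (qnorm2D_le _ _) _.
    rewrite !qnorm2M /s.
    have := Sp_entry i i0 sh sh'; have := Sp_entry i i1 sh sh'.
    have := qnorm2_ge0 (w' i0 0); have := qnorm2_ge0 (w' i1 0) => u0 v0 hu hv.
    by have := ler_wpM2r u0 hu; have := ler_wpM2r v0 hv; lra.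
  by have := key i0; have := key i1; lra.
(* Two uses of [qnorm2D_le] give the factor 4 on the first two terms and 2 on the third; the latter
   is at most [16 * t * qnorm2 (h i2 i2)], whence 32. *)
rewrite BE e3; apply: le_trans (qnorm2D_le _ _) _.
have := qnorm2D_le (qconj al * hf p (h *m w')) (hf w' p * b * al).
rewrite n1 n2 => n12.
have : s * (4 * qnorm2 (h i2 i2) * s) <= 16 * t * qnorm2 (h i2 i2).
  have -> : s * (4 * qnorm2 (h i2 i2) * s) = 4 * qnorm2 (h i2 i2) * s ^+ 2 by ring.
  by have := ler_wpM2l (qnorm2_ge0 (h i2 i2)) st; lra.
lra.
Qed.
End NoFixedPoint.

(** * Consequences of discreteness *)

Section DiscreteGroup.
Variables (R : realType) (G : set 'M[quat R]_3).
Notation Q := (quat R).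
Notation M3 := 'M[quat R]_3.
Notation V3 := 'cV[quat R]_3.
Implicit Types (p q x y z v w : V3) (A B C X Y h : M3) (a b m : Q).
Hypothesis GG : Sp_group G.
Hypothesis Gdisc : exists2 e : R, 0 < e &
  forall B, G B -> (forall i j, qnorm2 (B i j - (1%:M : M3) i j) < e) -> B = 1%:M.

Lemma G_sp A : G A -> Sp A. Proof. by case: GG => + _ _ _; apply. Qed.
Lemma G_dag A : G A -> G (dag A). Proof. by case: GG => _ _ _ h /h []. Qed.
Lemma G_mul A B : G A -> G B -> G (A *m B). Proof. by case: GG => _ _ h _; apply: h. Qed.
Lemma G_1 : G 1%:M. Proof. by case: GG. Qed.
Lemma G_dagr A : G A -> A *m dag A = 1%:M. Proof. by case: GG => _ _ _ h /h []. Qed.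
Lemma G_dagl A : G A -> dag A *m A = 1%:M. Proof. by move=> /G_sp /Sp_dag. Qed.

Lemma mcvg_dag (T : Type) (U : set_system T) (UU : UltraFilter U) (F : T -> M3) L :
  mcvg U F L -> mcvg U (fun t => dag (F t)) (dag L).
Proof.
move=> h; rewrite dag_def; apply: mcvg_near (mcvgM (mcvgM (mcvg_cst (JJ R)) (mcvg_star h)) (mcvg_cst (JJ R))).
by apply: nearW => t; rewrite dag_def.
Qed.

(** The limit [L] need not lie in [G], so two members are compared: for [t0] with [dag (F t0) *m L]
    close to 1, the group element [dag (F t0) *m F t] is close to 1 for nearby [t], hence equal to
    1. *)
Lemma discrete_near_cst (T : Type) (U : set_system T) (UU : UltraFilter U) (F : T -> M3) :
  (\forall t \near U, G (F t)) -> (forall i j, exists l, qcvg U (fun t => F t i j) l) ->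
  exists K, \forall t \near U, F t = K.
Proof.
move=> GF cF; have [e e0 He] := Gdisc.
have PU : ProperFilter U by exact: ultra_proper.
pose L : M3 := \matrix_(i, j) sval (cid (cF i j)).
have cL : mcvg U F L.
  by move=> i j; have -> : L i j = sval (cid (cF i j)); [rewrite mxE|exact: (svalP (cid (cF i j)))].
have LL : dag L *m L = 1%:M.
  apply: (mcvg_unique (U := U)) (mcvg_cst _).
  apply: mcvg_near (mcvgM (mcvg_dag UU cL) cL).
  by apply: filterS GF => t /G_dagl.
have close (H : T -> M3) K : mcvg U H K -> (forall i j, qnorm2 (K i j - (1%:M : M3) i j) < e) ->
    \forall t \near U, forall i j, qnorm2 (H t i j - (1%:M : M3) i j) < e.
  move=> hH hK; have key (ij : 'I_3 * 'I_3) :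
      \forall t \near U, qnorm2 (H t ij.1 ij.2 - (1%:M : M3) ij.1 ij.2) < e.
    have hh : (fun t => qnorm2 (H t ij.1 ij.2 - (1%:M : M3) ij.1 ij.2)) @ U -->
        qnorm2 (K ij.1 ij.2 - (1%:M : M3) ij.1 ij.2).
      by apply: qcvg_norm2; apply: qcvgD; [exact: hH | exact: qcvg_cst].
    exact: (cvgr_lt _ hh).
  have k2 : \forall t \near U, forall ij : 'I_3 * 'I_3,
      qnorm2 (H t ij.1 ij.2 - (1%:M : M3) ij.1 ij.2) < e by exact: filter_forall.
  by apply: filterS k2 => t ht i j; exact: (ht (i, j)).
have : \forall t \near U, forall i j, qnorm2 ((dag (F t) *m L) i j - (1%:M : M3) i j) < e.
  apply: (close _ (dag L *m L)); first by apply: mcvgM (mcvg_cst L); exact: mcvg_dag.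
  by move=> i j; rewrite LL subrr qnorm2_0.
move=> /(filterI GF) /filter_ex [t0 [Gt0 ht0]].
exists (F t0).
have c2 : mcvg U (fun t => dag (F t0) *m F t) (dag (F t0) *m L).
  by apply: mcvgM cL; exact: mcvg_cst.
apply: filterS (filterI GF (close _ _ c2 ht0)) => t [Gt ht].
have := He _ (G_mul (G_dag Gt0) Gt) ht.
by move=> /(congr1 (fun X => F t0 *m X)); rewrite mulmx1 mulmxA G_dagr // mul1mx.
Qed.

Lemma null_norm z : null z -> z != 0 -> z i2 0 != 0.
Proof. by move=> nz; apply: contraNN => /eqP z2; rewrite (null_eq0 _ z2) // nz. Qed.

Section Fixed.
Variable p : V3.
Hypotheses (np : null p) (p2 : p i2 0 = 1) (fp : forall A, G A -> fixes A p).

Lemma p2n : p i2 0 != 0. Proof. by rewrite p2 oner_neq0. Qed.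

Lemma cvg_mu x (U : set_system M3) y (UU : UltraFilter U) (k : V3) :
  mcvg U (fun A => qofR (rnorm A) *: A) (outer x y) ->
  (fun A => (qnorm2 (A i2 i2))^-1 * qnorm2 (hf k (col i2 A))) @ U -->
  qnorm2 (hf k x) * qnorm2 (y i2 0).
Proof.
move=> cL.
have : mcvg U (fun A => star k *m JJ R *m (qofR (rnorm A) *: A *m E3 R))
    (star k *m JJ R *m (outer x y *m E3 R)).
  by apply: mcvgM; [exact: mcvg_cst | apply: mcvgM cL _; exact: mcvg_cst].
move=> /(_ 0 0) /qcvg_norm2.
have -> : (star k *m JJ R *m (outer x y *m E3 R)) 0 0 = hf k x * hf y (E3 R).
  by rewrite outer_vec -hf_def hf_rsr.
rewrite qnorm2M hfE3r qnorm2N qnorm2_conj => h; apply: cvg_trans h; apply: near_eq_cvg.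
apply: nearW => A; have e : qofR (rnorm A) *: A *m E3 R = rs (col i2 A) (qofR (rnorm A)).
  by rewrite -scalemxAl mul_E3; apply: vecP => i; rewrite rsE !mxE qofRC.
have -> : (star k *m JJ R *m (qofR (rnorm A) *: A *m E3 R)) 0 0 =
    hf k (col i2 A) * qofR (rnorm A) by rewrite e -hf_def hf_rsr.
by rewrite qnorm2M qnorm2_ofR sqr_sqrtr ?invr_ge0 ?qnorm2_ge0 // mulrC.
Qed.

(* By the bound and discreteness [A h A^-1] is constant along the ultrafilter, so
   [A0^-1 A] commutes with [h], and so does its rescaled limit [(A0^-1 x) y^* J]. *)
Lemma common_fixed x h1 h2 : limit_vec G x -> x <> p -> G h1 -> G h2 ->
  exists z, [/\ null z, hf p z != 0, fixes h1 z & fixes h2 z].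
Proof.
move=> lx xp G1 G2; have [x2 nx _] := lx.
have [U [y [UU UG ny y2 [nu0 cL]]]] := limit_rank1 GG lx.
have PU : ProperFilter U by exact: ultra_proper.
have px : hf p x != 0 by apply: null_hf_neq0 => // e; apply: xp.
pose c := qnorm2 (hf p x) * qnorm2 (y i2 0).
have c0 : 0 < c by rewrite mulr_gt0 // qnorm2_gt0.
(* With [mu_norm] this lower bound becomes [qnorm2 (A i2 i2) * qnorm2 a <= 2 / c], which controls
   the prefactor in [conj_bound]. *)
have cm : \forall A \near U, c / 2 < (qnorm2 ((A : M3) i2 i2))^-1 * qnorm2 (hf p (col i2 A)).
  by have /cvgr_gt := cvg_mu UU cL (k := p); apply; rewrite -/c; lra.
have cst h : G h -> exists K, \forall A \near U, A *m h *m dag A = K.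
  move=> Gh; have [b hb] := fp Gh.
  apply: (@discrete_near_cst _ U UU (fun A => A *m h *m dag A)).
    by apply: filterS UG => A GA; apply: G_mul; [apply: G_mul|apply: G_dag].
  move=> i j; apply: (qcvg_bounded (c := 2 / c * (4 * (qnorm2 b)^-1 + 4 * qnorm2 b + 32 * qnorm2 (h i2 i2)))).
  apply: filterS (filterI UG cm) => A [GA lt].
  have [a ha] := fp GA.
  have GB : G (A *m h *m dag A) by apply: G_mul; [apply: G_mul|apply: G_dag].
  apply: le_trans (Sp_entry _ _ (G_sp GB) (G_sp (G_dag GB))) _.
  apply: le_trans (conj_bound (G_sp GA) (G_sp (G_dag GA)) (G_sp Gh) (G_sp (G_dag Gh)) np p2 ha hb) _.
  apply: ler_wpM2r; first by rewrite !addr_ge0 ?mulr_ge0 ?invr_ge0 ?qnorm2_ge0.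
  have n22 := Sp_norm22_neq0 (G_sp GA).
  have m1 := mu_norm (G_sp GA) ha p2.
  move: lt m1 n22 (qnorm2_ge0 a) (qnorm2_ge0 (A i2 i2)).
  move: (qnorm2 (A i2 i2)) (qnorm2 (hf p _)) (qnorm2 a) => n m al lt m1 n0 al0 n0'.
  rewrite ler_pdivlMr //.
  have npos : 0 < n by rewrite lt_def n0.
  have : c / 2 * (n * al) <= 1.
    have e1 : n^-1 * m * (n * al) = 1 by rewrite mulrACA mulVf // mul1r mulrC m1.
    rewrite -[leRHS]e1.
    by apply: ler_wpM2r (ltW lt); rewrite mulr_ge0.
  lra.
have [K1 hK1] := cst h1 G1; have [K2 hK2] := cst h2 G2.
have [A0 [[GA0 e1] e2]] := filter_ex (filterI (filterI UG hK1) hK2).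
pose z := dag A0 *m x.
have fix_z h K : G h -> A0 *m h *m dag A0 = K ->
    (\forall A \near U, A *m h *m dag A = K) -> fixes h z.
  move=> Gh eK hK.
  have comm : (dag A0 *m outer x y) *m h = h *m (dag A0 *m outer x y).
    apply: (mcvg_unique (U := U)
      (F := fun A => dag A0 *m (qofR (rnorm A) *: A) *m h)).
      by apply: mcvgM (mcvg_cst h); apply: mcvgM cL; exact: mcvg_cst.
    have : mcvg U (fun A => h *m (dag A0 *m (qofR (rnorm A) *: A))) (h *m (dag A0 *m outer x y)).
      by apply: mcvgM (mcvg_cst h) _; apply: mcvgM cL; exact: mcvg_cst.
    apply: mcvg_near; apply: filterS (filterI UG hK) => A [GA eA].
    rewrite !mulmx_realZ -scalemxAl; congr (_ *: _).
    have : A *m h *m dag A = A0 *m h *m dag A0 by rewrite eA eK.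
    move: (G_dagl GA) (G_dagl GA0); move: (dag A) (dag A0) => B B0 BA BA0.
    move=> /(congr1 (fun X => B0 *m X *m A)).
    by rewrite -!mulmxA BA mulmx1 !mulmxA BA0 mul1mx.
  move: comm; rewrite mul_outer -/z outer_mulr mul_outer => /(congr1 (fun X => X *m E3 R)).
  rewrite !outer_vec => e.
  have yn : hf y (E3 R) != 0 by rewrite hfE3r oppr_eq0 qconj_eq0.
  exists (hf (dag h *m y) (E3 R) * (hf y (E3 R))^-1).
  transitivity (rs (rs (h *m z) (hf y (E3 R))) (hf y (E3 R))^-1).
    exact/esym/rsK.
  by rewrite -e; exact: rsA.
exists z; split.
- by rewrite /null /z Sp_hf //; apply: G_sp; exact: G_dag.
- rewrite /z -hf_dag dagK; have [a ha] := fp GA0.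
  rewrite ha hf_rsl qmulf_eq0 qconj_eq0 negb_or px andbT.
  exact: Sp_fixed_neq0 (G_sp GA0) ha p2n.
- exact: fix_z e1 hK1.
- exact: fix_z e2 hK2.
Qed.

(** If all multipliers at [p] had norm 1, then by [mu_norm] the quantity of [cvg_mu] would be the
    inverse of [qnorm2 (A i2 i2)] and tend to 0, whereas its limit is nonzero as [x] differs from
    [p]. *)
Lemma expanding_element x : limit_vec G x -> x <> p ->
  exists h a, [/\ G h, h *m p = rs p a & qnorm2 a != 1].
Proof.
move=> lx xp; have [x2 nx _] := lx.
have [U [y [UU UG ny y2 [nu0 cL]]]] := limit_rank1 GG lx.
have PU : ProperFilter U by exact: ultra_proper.
apply: contrapT => nex.
have : qnorm2 (hf p x) * qnorm2 (y i2 0) = 0.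
  apply: (cvg_unique (@Rhausdorff R) (cvg_mu UU cL (k := p))).
  apply: cvg_trans nu0; apply: near_eq_cvg; apply: filterS UG => A GA.
  have [a ha] := fp GA.
  have a1 : qnorm2 a = 1 by apply/eqP; apply: contrapT => /negP a1; apply: nex; exists A, a.
  by have := mu_norm (G_sp GA) ha p2; rewrite a1 mul1r => ->; rewrite mulr1.
move=> /eqP; rewrite mulf_eq0 !qnorm2_eq0 (negPf y2) orbF; apply/negP.
by apply: null_hf_neq0 => // e; apply: xp.
Qed.

(** The multipliers at [p] and [q] have reciprocal norms, so the product of the two rescaled
    pairings is the square of the inverse of [qnorm2 (A i2 i2)] and tends to 0. Hence [x] would be
    orthogonal to [p] or to [q]. *)
Lemma fixed_pair_limit q x : null q -> q i2 0 = 1 -> (forall A, G A -> fixes A q) ->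
  p <> q -> limit_vec G x -> x <> p -> x <> q -> False.
Proof.
move=> nq q2 fq pq lx xp xq; have [x2 nx _] := lx.
have [U [y [UU UG ny y2 [nu0 cL]]]] := limit_rank1 GG lx.
have PU : ProperFilter U by exact: ultra_proper.
have npq := null_hf_neq0 np nq p2 q2 pq.
have h : (fun A => (qnorm2 (A i2 i2))^-1 * qnorm2 (hf p (col i2 A)) *
      ((qnorm2 (A i2 i2))^-1 * qnorm2 (hf q (col i2 A)))) @ U -->
    qnorm2 (hf p x) * qnorm2 (y i2 0) * (qnorm2 (hf q x) * qnorm2 (y i2 0)).
  by apply: cvgM; exact: cvg_mu.
have h0 : (fun A => (qnorm2 (A i2 i2))^-1 * (qnorm2 (A i2 i2))^-1) @ U --> (0 * 0 : R).
  exact: cvgM.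
have : qnorm2 (hf p x) * qnorm2 (y i2 0) * (qnorm2 (hf q x) * qnorm2 (y i2 0)) = 0 * 0.
  apply: (cvg_unique (@Rhausdorff R) h).
  apply: cvg_trans h0; apply: near_eq_cvg; apply: filterS UG => A GA.
  have [a ha] := fp GA; have [b hb] := fq _ GA.
  have sA := G_sp GA.
  have ab := mu_pair sA ha hb npq.
  have ea := mu_norm sA ha p2; have eb := mu_norm sA hb q2.
  have e1 : qnorm2 (hf p (col i2 A)) * qnorm2 (hf q (col i2 A)) = 1.
    by rewrite -[LHS]mul1r -ab mulrACA ea eb mulr1.
  by rewrite /= mulrACA e1 mulr1.
have c0 k : null k -> k i2 0 = 1 -> x <> k -> qnorm2 (hf k x) * qnorm2 (y i2 0) != 0.
  move=> nk k2 xk; rewrite mulf_neq0 ?qnorm2_eq0 //.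
  by apply: null_hf_neq0 => // e; exact: xk.
by move=> e; have := mulf_neq0 (c0 p np p2 xp) (c0 q nq q2 xq); rewrite e mulr0 eqxx.
Qed.

(** An expanding element [h1] has exactly one null fixed line besides [p]. Each [A] in [G] shares
    with [h1] such a line, so all of [G] fixes it, and [fixed_pair_limit] excludes a third limit
    point. *)
Lemma no_fixed_null x1 x2 x3 : limit_vec G x1 -> limit_vec G x2 -> limit_vec G x3 ->
  x1 <> x2 -> x2 <> x3 -> x1 <> x3 -> False.
Proof.
move=> l1 l2 l3 x12 x23 x13.
have [x [lx xp]] : exists x, limit_vec G x /\ x <> p.
  have [e|] := pselect (x1 = p); last by exists x1.
  by exists x2; split => // e2; apply: x12; rewrite e e2.
have [h1 [a [G1 h1p a1]]] := expanding_element lx xp.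
have [q [nq pq [b h1q] _]] := common_fixed lx xp G1 G1.
have qn0 : q != 0 by apply: contraNneq pq => ->; rewrite hf0r.
have q2 := null_norm nq qn0.
have ab := mu_pair (G_sp G1) h1p h1q pq.
pose q' := rs q (q i2 0)^-1.
have q'2 : q' i2 0 = 1 by rewrite rsE mulrV ?qunitE.
have nq' : null q' by rewrite /null hf_rsr hf_rsl nq mulr0 mul0r.
have fq' A : G A -> fixes A q'.
  move=> GA; have [z [nz pz [b' h1z] [c hz]]] := common_fixed lx xp G1 GA.
  have ab' := mu_pair (G_sp G1) h1p h1z pz.
  (* Both [b] and [b'] have norm reciprocal to that of [a]. If [q] and [z] were not orthogonal, they
     would also be reciprocal to each other, forcing norm 1 for [a]. *)
  have [qz|qz] := eqVneq (hf q z) 0; last first.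
    exfalso; have bb := mu_pair (G_sp G1) h1q h1z qz.
    have a0 := qnorm2_ge0 a.
    have a00 : qnorm2 a != 0.
      by apply/eqP => e; move: ab; rewrite e mul0r => /eqP; rewrite eq_sym oner_eq0.
    have e : qnorm2 b = qnorm2 b' by apply: (mulfI a00); rewrite ab ab'.
    have b1 : qnorm2 b = 1.
      by apply/eqP; rewrite -sqrp_eq1 ?qnorm2_ge0 // expr2 {2}e bb.
    by move: ab a1; rewrite b1 mulr1 => ->; rewrite eqxx.
  have zn0 : z != 0 by apply: contraNneq pz => ->; rewrite hf0r.
  have z2 := null_norm nz zn0.
  have -> : q' = rs z (z i2 0)^-1.
    rewrite (null_perp nq nz qz q2) rsA rsE; congr rs.
    by rewrite mulrA mulrV ?qunitE // mul1r -mulrA mulrV ?qunitE // mulr1.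
  exists (z i2 0 * c * (z i2 0)^-1).
  by rewrite rs_mul hz !rsA !mulrA mulVr ?qunitE // mul1r.
have pq' : p <> q' by move=> e; move: pq; rewrite {1}e hf_rsl nq mulr0 eqxx.
(* Of three distinct limit points, one differs from both [p] and [q']. *)
have [xp1|xp1] := pselect (x1 = p); last first.
  have [xq1|xq1] := pselect (x1 = q'); last exact: (fixed_pair_limit nq' q'2 fq' pq' l1 xp1 xq1).
  have [xp2|xp2] := pselect (x2 = p); last first.
    by apply: (fixed_pair_limit nq' q'2 fq' pq' l2 xp2) => e; apply: x12; rewrite xq1 e.
  by apply: (fixed_pair_limit nq' q'2 fq' pq' l3) => e; [apply: x23; rewrite xp2 e|apply: x13; rewrite xq1 e].
have xp2 : x2 <> p by move=> e; apply: x12; rewrite xp1 e.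
have xp3 : x3 <> p by move=> e; apply: x13; rewrite xp1 e.
have [xq2|xq2] := pselect (x2 = q'); last exact: (fixed_pair_limit nq' q'2 fq' pq' l2 xp2 xq2).
by apply: (fixed_pair_limit nq' q'2 fq' pq' l3 xp3) => e; apply: x23; rewrite xq2 e.
Qed.
End Fixed.
End DiscreteGroup.

(** * The real algebra spanned by the group *)

Section RealTraces.
Variables (R : realType) (G : set 'M[quat R]_3).
Notation Q := (quat R).
Notation M3 := 'M[quat R]_3.
Notation V3 := 'cV[quat R]_3.
Implicit Types (p q : Q) (x y z v w : V3) (A B C X Y g : M3).
Hypothesis GG : Sp_group G.
Hypothesis Gtr : forall A, G A -> qreal (\tr A).

Lemma spanA_G A : G A -> spanA G A.
Proof. by move=> GA C; apply. Qed.

Lemma mpairD C X Y : mpair C (X + Y) = mpair C X + mpair C Y.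
Proof. by rewrite /mpair mulmxDr raddfD. Qed.

Lemma spanA_add X Y : spanA G X -> spanA G Y -> spanA G (X + Y).
Proof. by move=> hX hY C hC; rewrite mpairD hX // hY // addr0. Qed.

Lemma spanA_scale X (a : R) : spanA G X -> spanA G (qofR a *: X).
Proof. by move=> hX C hC; rewrite mpairZ hX // mulr0. Qed.

Lemma mpair_mull C X Y : mpair C (X *m Y) = mpair (C *m X) Y.
Proof. by rewrite /mpair mulmxA. Qed.
Lemma mpair_mulr C X Y : mpair C (X *m Y) = mpair (Y *m C) X.
Proof. by rewrite mpair_mull mpairC mpair_mull. Qed.

(** The pairing is real linear in each factor: cyclicity exposes [X], which is replaced by an
    element of [G], and then the same is done with [Y]. *)
Lemma spanA_mul X Y : spanA G X -> spanA G Y -> spanA G (X *m Y).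
Proof.
move=> hX hY C hC; rewrite mpair_mulr; apply: hX => A GA.
rewrite -mpair_mulr mpair_mull; apply: hY => B GB.
by rewrite -mpair_mull; apply: hC; exact: G_mul GG _ _ GA GB.
Qed.

Lemma mpair_dag C X : mpair C (dag X) = mpair (dag C) X.
Proof.
transitivity (mpair (JJ R) (X *m JJ R *m star C)).
  by rewrite /mpair -qre_tr_star !dag_def !starM starJ starK !mulmxA.
by rewrite mpairC -mulmxA -mpair_mull -dag_def mpairC.
Qed.

Lemma spanA_dag X : spanA G X -> spanA G (dag X).
Proof.
move=> hX C hC; rewrite mpair_dag; apply: hX => A GA.
by rewrite -mpair_dag; apply: hC; exact: G_dag GG _ GA.
Qed.

Lemma mpair_scalar q X : mpair (q%:M) X = qre (q * \tr X).
Proof.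
rewrite /mpair /mxtrace big_distrr /=; congr qre; apply: eq_bigr => i _.
by rewrite mul_scalar_mx mxE.
Qed.

(** Scalar matrices with imaginary entry annihilate [G], because its traces are real. The three
    imaginary units recover the three imaginary coordinates of the trace. *)
Lemma spanA_tr X : spanA G X -> qreal (\tr X).
Proof.
move=> hX.
have key q : qre q = 0 -> qre (q * \tr X) = 0.
  move=> q0; rewrite -mpair_scalar; apply: hX => A GA; rewrite mpair_scalar.
  by have [a [b c]] := Gtr GA; rewrite qreM q0 a b c !mulr0 mul0r !subr0.
have := key (Quat 0 1 0 0) erefl; have := key (Quat 0 0 1 0) erefl.
have := key (Quat 0 0 0 1) erefl; rewrite !qreM /= => a b c.
by split; [lra | split; lra].
Qed.

(* [q] is in the space called D(x, y) above; a Variant rather than a Definition, to keep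
   the unifier from unfolding matrices. *)
Variant coef x y q : Prop := coef_intro of spanA G (outer (rs x q) y).

Lemma coef_span x y q : coef x y q <-> spanA G (outer (rs x q) y).
Proof. by split=> [[]|h]; [|split]. Qed.

Lemma coef_add x y p q : coef x y p -> coef x y q -> coef x y (p + q).
Proof. by move=> [h1] [h2]; split; rewrite rsDr outerDl; exact: spanA_add. Qed.

Lemma coef_scale x y q (a : R) : coef x y q -> coef x y (qofR a * q).
Proof.
move=> [h]; split; rewrite (_ : outer _ _ = qofR a *: outer (rs x q) y); first exact: spanA_scale.
rewrite !outer_def scalemxAl; congr (_ *m _); apply: vecP => i.
by rewrite rsE [RHS]mxE rsE !mulrA qofRC.
Qed.

Lemma coef_opp x y q : coef x y q -> coef x y (- q).
Proof. by move=> /(coef_scale (- 1)); rewrite qofRN mulN1r. Qed.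

(** Composition of rank one operators with [g] in between; this is how knowledge of the spaces D
    constrains the entries [hf y (g *m z)] of group elements. *)
Lemma coef_mulG x y z w p q g : coef x y p -> G g -> coef z w q -> coef x w (p * hf y (g *m z) * q).
Proof.
move=> [h1] Gg [h2]; split; have := spanA_mul (spanA_mul h1 (spanA_G Gg)) h2.
by rewrite -mulmxA mul_outer outer_mul rs_mul hf_rsr rsA mulrA.
Qed.

Lemma coef_mul x y z w p q : coef x y p -> coef z w q -> coef x w (p * hf y z * q).
Proof. by move=> h1 h2; have := coef_mulG h1 (G_1 GG) h2; rewrite mul1mx. Qed.

Lemma coef_rsl x y s q : coef (rs x s) y q <-> coef x y (s * q).
Proof. by rewrite !coef_span rsA. Qed.
Lemma coef_rsr x y s q : coef x (rs y s) q <-> coef x y (q * qconj s).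
Proof. by rewrite !coef_span -[s in rs y s]qconjK -outer_rs rsA. Qed.

Lemma coef_conj x y q : coef x y q -> coef y x (qconj q).
Proof.
by move=> [/spanA_dag h]; split; move: h; rewrite dag_outer -[q in rs x q]qconjK -outer_rs.
Qed.

(** D(x, x) is stable under conjugation, and [q + qconj q] is real. So D(x, x) either contains 1 or
    is purely imaginary. *)
Lemma coef_re x q : coef x x q -> qre q != 0 -> coef x x 1.
Proof.
move=> h q0; have := coef_scale (2 * qre q)^-1 (coef_add h (coef_conj h)).
rewrite qconjE addrC subrK -qofRM mulVf ?qofR1 //.
by rewrite mulf_neq0 // pnatr_eq0.
Qed.

(** The trace is imaginary, so if real it vanishes. Its three terms have norms [|q| |v_i|^2], and by
    negativity of [v] the last one exceeds the sum of the other two. *)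
Lemma neg_not_D v q : neg v -> qre q = 0 -> q != 0 -> ~ coef v v q.
Proof.
move=> nv q0 qn [h]; have [ti [tj tk]] := spanA_tr h; move: ti tj tk.
rewrite tr_outer => ti tj tk.
have rei a : qre (a * q * qconj a) = 0.
  by rewrite qreMC mulrA qmulVq qreM q0 /=; ring.
have e : v i2 0 * q * qconj (v i2 0) = qconj (qconj (v i0 0)) * (q * qconj (v i0 0)) +
    qconj (qconj (v i1 0)) * (q * qconj (v i1 0)).
  apply/esym/eqP; rewrite -subr_eq0 !qconjK !mulrA; apply/eqP; apply: quat_ext => //.
  by rewrite !qreD qreN !rei /=; ring.
have := qcauchy (qconj (v i0 0)) (q * qconj (v i0 0)) (qconj (v i1 0)) (q * qconj (v i1 0)).
rewrite -e !qnorm2M !qnorm2_conj; move: nv; rewrite /neg qre_hfxx; clear e.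
have := qnorm2_gt0 q; rewrite qn.
move: (qnorm2_ge0 (v i0 0)) (qnorm2_ge0 (v i1 0)) (qnorm2_ge0 (v i2 0)).
move: (qnorm2 (v i0 0)) (qnorm2 (v i1 0)) (qnorm2 (v i2 0)) (qnorm2 q) => a b c n a0 b0 c0 n0 lt.
have -> : (a + b) * (n * a + n * b) = n * (a + b) ^+ 2 by ring.
have -> : c * n * c = n * c ^+ 2 by ring.
rewrite ler_pM2l // => le; have : (a + b) ^+ 2 < c ^+ 2 by nra.
by rewrite ltNge le.
Qed.

(** Equality case of the preceding estimate: vanishing of the trace writes [q] as a convex
    combination of rotated copies of [q]. By strict convexity the copies with nonzero weight equal
    [q]; here this is a vanishing sum of squared commutators. *)
Lemma null_commute x q : null x -> x i2 0 = 1 -> qre q = 0 -> coef x x q ->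
  forall i, x i 0 * q = q * x i 0.
Proof.
move=> nx x2 q0 [h]; have [ti [tj tk]] := spanA_tr h; move: ti tj tk.
rewrite tr_outer x2 qconj1 mulr1 mul1r => ti tj tk.
have rei a : qre (a * q * qconj a) = 0.
  by rewrite qreMC mulrA qmulVq qreM q0 /=; ring.
have e : q = x i0 0 * q * qconj (x i0 0) + x i1 0 * q * qconj (x i1 0).
  apply/esym/eqP; rewrite -subr_eq0; apply/eqP; apply: quat_ext => //.
  by rewrite !qreD qreN !rei q0 /=; ring.
have e1 : qnorm2 (x i0 0) + qnorm2 (x i1 0) = 1.
  by move: (qre_hfxx x); rewrite nx x2 qnorm2_1 qre0; lra.
have d a : qnorm2 (a * q - q * a) =
    2 * qnorm2 a * qnorm2 q - 2 * qre (qconj q * (a * q * qconj a)).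
  by rewrite /qnorm2 !qE /=; ring.
have s : qnorm2 (x i0 0 * q - q * x i0 0) + qnorm2 (x i1 0 * q - q * x i1 0) = 0.
  have -> : qnorm2 (x i0 0 * q - q * x i0 0) + qnorm2 (x i1 0 * q - q * x i1 0) =
    2 * (qnorm2 (x i0 0) + qnorm2 (x i1 0)) * qnorm2 q -
    2 * qre (qconj q * (x i0 0 * q * qconj (x i0 0) + x i1 0 * q * qconj (x i1 0))).
    by rewrite !d (mulrDr (qconj q)) [in RHS]qreD; ring.
  by rewrite e1 -e qmulVq qre_ofR; ring.
have n0 := qnorm2_ge0 (x i0 0 * q - q * x i0 0).
have n1 := qnorm2_ge0 (x i1 0 * q - q * x i1 0).
apply: ord3P; last by rewrite x2 mulr1 mul1r.
- by apply/eqP; rewrite -subr_eq0 -qnorm2_eq0; apply/eqP; clear e; lra.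
- by apply/eqP; rewrite -subr_eq0 -qnorm2_eq0; apply/eqP; clear e; lra.
Qed.

(** The imaginary part [v] of [y] commutes with the orthogonal imaginary [u] and [d], so [v * u] and
    [v * d] are real. Their product is [v * v * (u * d)], whose real part is 0; hence [v = 0]. *)
Lemma qcommute_real (y d u : Q) : qre d = 0 -> qre u = 0 -> d != 0 -> u != 0 -> qre (u * d) = 0 ->
  y * d = d * y -> y * (u * d) = u * d * y -> y = qofR (qre y).
Proof.
move=> rd ru d0 u0 rud cd cud.
have cu : y * u = u * y.
  have : y * u * d = u * y * d by rewrite -mulrA cud -mulrA -cd mulrA.
  by move=> /(congr1 (fun t => t * d^-1)); rewrite -!mulrA mulrV ?qunitE // !mulr1.
pose v := y - qofR (qre y).
have rv : qre v = 0 by rewrite qreD qreN /= subrr.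
have comm (t : Q) : y * t = t * y -> v * t = t * v.
  by move=> e; rewrite /v mulrBl mulrBr e qofRC.
have real (a b : Q) : qre a = 0 -> qre b = 0 -> a * b = b * a -> a * b = qofR (qre (a * b)).
  move=> ra rb e; have : qconj (a * b) = a * b.
    by rewrite qconjM !qconjE ra rb mulr0 qofR0 !sub0r mulrNN -e.
  by case: (a * b) => a1 a2 a3 a4 [h2 h3 h4]; apply: quat_ext => //=; lra.
have eu := real _ _ rv ru (comm _ cu); have ed := real _ _ rv rd (comm _ cd).
have e : qofR (- qnorm2 v) * (u * d) = qofR (qre (v * u) * qre (v * d)).
  rewrite qofRM -eu -ed qofRN -(qimag_sqr rv) -!mulrA; congr (_ * _).
  by rewrite !mulrA (comm _ cu).
suff v0 : v = 0 by rewrite -[LHS](subrK (qofR (qre y))) -/v v0 add0r.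
apply/eqP; rewrite -qnorm2_eq0 -oppr_eq0; apply/eqP.
have z : qre (v * u) * qre (v * d) = 0.
  by move/(congr1 (@qre R)): e; rewrite qreM rud /= => <-; ring.
move: e; rewrite z qofR0 => /eqP; rewrite qmulf_eq0 qmulf_eq0 (negPf u0) (negPf d0) !orbF.
by rewrite -qnorm2_eq0 qnorm2_ofR sqrf_eq0 => /eqP.
Qed.
End RealTraces.

(** * The spaces D of a normalized pair of null vectors *)

Section Pair.
Variables (R : realType) (G : set 'M[quat R]_3).
Notation Q := (quat R).
Notation M3 := 'M[quat R]_3.
Notation V3 := 'cV[quat R]_3.
Implicit Types (p q : Q) (y w : V3) (A B C X Y g : M3).
Hypothesis GG : Sp_group G.
Hypothesis Gtr : forall A, G A -> qreal (\tr A).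
Notation coef := (coef G).

Lemma coef_cancel x y s q : qnorm2 s != 0 -> coef x y (qofR (qnorm2 s) * q) -> coef x y q.
Proof.
by move=> s0 /(coef_scale (qnorm2 s)^-1); rewrite mulrA -qofRM mulVf // qofR1 mul1r.
Qed.

Section Normalized.
Variables x z : V3.
Hypotheses (nx : null x) (nz : null z) (xz : hf x z = -1).
Hypotheses (Dxz : exists2 q, q != 0 & coef x z q) (Dxx : exists2 q, q != 0 & coef x x q)
  (Dzz : exists2 q, q != 0 & coef z z q).

Lemma zx : hf z x = -1. Proof. by rewrite hfC xz qconjN qconj1. Qed.

Lemma K_mul p q : coef x z p -> coef x z q -> coef x z (p * q).
Proof. by move=> h1 h2; have := coef_opp (coef_mul GG h1 h2); rewrite zx mulrN1 mulNr opprK. Qed.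

Lemma K_inv q : q != 0 -> coef x z q -> coef x z 1 -> coef x z q^-1.
Proof.
move=> q0 hq h1; apply: (@coef_cancel _ _ q); first by rewrite qnorm2_eq0.
rewrite -qmulVq -mulrA mulrV ?qunitE // mulr1 qconjE.
by apply: coef_add; [rewrite -[qofR _]mulr1; exact: coef_scale | exact: coef_opp].
Qed.

(** By the quadratic equation of [q], the nonzero real [qconj q * q] equals [2 Re q * q - q * q],
    which lies in D(x, z). *)
Lemma K1 : coef x z 1.
Proof.
have [q q0 hq] := Dxz; apply: (@coef_cancel _ _ q); first by rewrite qnorm2_eq0.
rewrite mulr1 -qmulVq qconjE mulrBl.
by apply: coef_add; [exact: coef_scale | apply: coef_opp; exact: K_mul].
Qed.

Lemma K_zx q : coef z x q <-> coef x z q.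
Proof.
have conj p : coef x z p -> coef x z (qconj p).
  move=> h; rewrite qconjE; apply: coef_add; last exact: coef_opp.
  by rewrite -[qofR _]mulr1; apply: coef_scale; exact: K1.
split=> [/(coef_conj GG) /conj|/conj /(coef_conj GG)]; by rewrite qconjK.
Qed.

Lemma Dxx_K p q : coef x z p -> coef x x q -> coef x x (p * q).
Proof. by move=> h1 h2; have := coef_opp (coef_mul GG h1 h2); rewrite zx mulrN1 mulNr opprK. Qed.
Lemma Dzz_K p q : coef x z p -> coef z z q -> coef z z (p * q).
Proof.
by move=> /K_zx h1 h2; have := coef_opp (coef_mul GG h1 h2); rewrite xz mulrN1 mulNr opprK.
Qed.
Lemma K_xxzz p q : coef x x p -> coef z z q -> coef x z (p * q).
Proof. by move=> h1 h2; have := coef_opp (coef_mul GG h1 h2); rewrite xz mulrN1 mulNr opprK. Qed.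

(** If 1 is in D(x, x), a nonzero [f] of D(z, z) lies in D(x, z), hence so does its inverse, which
    acts on D(z, z) and sends [f] to 1. The converse is symmetric. *)
Lemma Dxx1_zz1 : coef x x 1 <-> coef z z 1.
Proof.
split=> h.
  have [f f0 hf0] := Dzz; have := K_xxzz h hf0; rewrite mul1r => Kf.
  by have := Dzz_K (K_inv f0 Kf K1) hf0; rewrite mulVr.
have [d d0 hd0] := Dxx; have := K_xxzz hd0 h; rewrite mulr1 => Kd.
by have := Dxx_K (K_inv d0 Kd K1) hd0; rewrite mulVr.
Qed.

Lemma neg_xz : neg (x + z).
Proof. by rewrite /neg hfDr !hfDl nx nz xz zx !qE; lra. Qed.

(** Under these hypotheses [u] lies in all four spaces D of the pair, and the sum of the four
    operators belongs to the negative vector [x + z]. *)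
Lemma K_no_imag u : qre u = 0 -> u != 0 -> coef x z u -> coef x x 1 -> False.
Proof.
move=> ru u0 Ku h; have h' := Dxx1_zz1.1 h.
apply: (neg_not_D Gtr neg_xz ru u0).
apply/coef_span; rewrite rsDl outerDl !outerDr.
apply: spanA_add; apply: spanA_add; apply/coef_span.
- by have := Dxx_K Ku h; rewrite mulr1.
- exact: Ku.
- exact/K_zx.
- by have := Dzz_K Ku h'; rewrite mulr1.
Qed.

(** An imaginary [u] in D(x, z) acts by left multiplication on D(x, x) and D(z, z), both purely
    imaginary by [K_no_imag]. So [d] and [u * d] lie in the same space, and coordinates commuting
    with both are real. *)
Lemma K_real x2 s : z = rs x2 s -> s != 0 -> null x2 -> x2 i2 0 = 1 -> x i2 0 = 1 ->
  forall q, coef x z q -> q = qofR (qre q).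
Proof.
move=> zE s0 nx2 x22 x12 q Kq; apply/eqP; rewrite -subr_eq0; apply/negP => /negP u0.
set u := q - _ in u0.
have ru : qre u = 0 by rewrite qreD qreN /= subrr.
have Ku : coef x z u.
  apply: coef_add => //; apply: coef_opp; rewrite -[qofR _]mulr1; apply: coef_scale; exact: K1.
have nD1 : ~ coef x x 1 by exact: K_no_imag Ku.
have imx d : coef x x d -> qre d = 0.
  by move=> hd; apply/eqP; apply: contrapT => /negP; move=> /(coef_re GG hd).
have imz d : coef z z d -> qre d = 0.
  by move=> hd; apply/eqP; apply: contrapT => /negP; move=> /(coef_re GG hd) /Dxx1_zz1.
have [d d0 hd] := Dxx; have [f f0 hf0] := Dzz.
have xr i : x i 0 = qofR (qre (x i 0)).
  have hud := Dxx_K Ku hd.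
  apply: (qcommute_real (imx _ hd) ru d0 u0 (imx _ hud)).
    by apply: (null_commute Gtr nx x12 _ hd); exact: imx.
  by apply: (null_commute Gtr nx x12 _ hud); exact: imx.
have conj_im p t : qre p = 0 -> qre (t * p * qconj t) = 0.
  by move=> p0; rewrite qreMC mulrA qmulVq qreM p0 /=; ring.
(* [null_commute] needs last entry 1, which [z] lacks; D(z, z) is therefore carried to D(x2, x2) by
   [s * p * qconj s]. *)
have x2r i : x2 i 0 = qofR (qre (x2 i 0)).
  have huf := Dzz_K Ku hf0.
  have D2 p : coef z z p -> coef x2 x2 (s * p * qconj s).
    by rewrite zE => /coef_rsr /coef_rsl; rewrite mulrA.
  have e : s * (u * f) * qconj s = (s * u * s^-1) * (s * f * qconj s).
    by rewrite !mulrA mulrVK ?qunitE.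
  have fi : qre (s * f * qconj s) = 0 by apply: conj_im; exact: imz.
  have ufi : qre (s * (u * f) * qconj s) = 0 by apply: conj_im; exact: imz.
  apply: (@qcommute_real _ _ (s * f * qconj s) (s * u * s^-1)) => //.
  - by rewrite qreMC mulrA mulVr ?qunitE // mul1r.
  - by rewrite !qmulf_eq0 qconj_eq0 (negPf s0) (negPf f0).
  - by rewrite -qnorm2_eq0 !qnorm2M qnorm2V !mulf_eq0 invr_eq0 !qnorm2_eq0 (negPf s0) (negPf u0).
  - by rewrite -e.
  - exact: (null_commute Gtr nx2 x22 fi (D2 _ hf0)).
  - by rewrite -e; exact: (null_commute Gtr nx2 x22 ufi (D2 _ huf)).
have [a xa] : exists a : 'I_3 -> R, forall i, x i 0 = qofR (a i).
  by exists (fun i => qre (x i 0)).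
have [b x2b] : exists b : 'I_3 -> R, forall i, x2 i 0 = qofR (b i).
  by exists (fun i => qre (x2 i 0)).
have [r sr] : exists r, s = qofR r.
  have e : hf x x2 * s = -1 by rewrite -hf_rsr -zE.
  have [r0 hr0] : exists r, hf x x2 = qofR r.
    rewrite hfE !xa !x2b !qconj_ofR -!qofRM -qofRD -qofRN -qofRD.
    by eexists.
  have r00 : r0 != 0.
    apply/eqP => r0e; move: e; rewrite hr0 r0e qofR0 mul0r => /eqP.
    by rewrite eq_sym oppr_eq0 oner_eq0.
  exists (- r0^-1); apply: (mulrI (x := qofR r0)); first by rewrite qunitE -qnorm2_eq0 qnorm2_ofR sqrf_eq0.
  by rewrite -hr0 e hr0 -qofRM mulrN mulfV // qofRN.
have zr i : z i 0 = qofR (b i * r).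
  by rewrite zE rsE x2b sr -qofRM.
have [ti [tj tk]] := spanA_tr Gtr ((coef_span _ _ _ _).1 Ku).
(* With real coordinates [u] can be pulled out of the trace, leaving [u * hf x z]. *)
have tE : \tr (outer (rs x u) z) = - u.
  have -> : - u = u * hf x z by rewrite xz mulrN1.
  rewrite tr_outer hfE !xa !zr !qconj_ofR .
  have c (k : R) : u * qofR k = qofR k * u by rewrite qofRC.
  by rewrite !(mulrDr u) mulrN !mulrA !c -!mulrA.
move: u0; rewrite -oppr_eq0 -tE; apply/negP; rewrite negbK; apply/eqP.
by apply: quat_ext => //; rewrite tE qreN ru oppr0.
Qed.

Hypothesis Kr : forall q, coef x z q -> q = qofR (qre q).

(** D(x, x) times D(z, z) lies in D(x, z), which is real. When both are imaginary this makes them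
    the same real line, and [d] is a generator of norm 1. *)
Lemma pair_class :
  [/\ coef x x 1, coef z z 1 & forall q, coef x x q -> q = qofR (qre q)] \/
  exists d, [/\ qre d = 0, d * d = -1, coef x x d, coef z z d &
    (forall q, coef x x q -> exists r, q = qofR r * d)].
Proof.
have [h|nD1] := pselect (coef x x 1).
  left; split => //; first exact/Dxx1_zz1.
  by move=> q hq; apply: Kr; have := K_xxzz hq (Dxx1_zz1.1 h); rewrite mulr1.
right.
have imx d : coef x x d -> qre d = 0.
  by move=> hd; apply/eqP; apply: contrapT => /negP; move=> /(coef_re GG hd).
have [d0 d0n hd0] := Dxx; have [f f0 hf0] := Dzz.
pose a := (Num.sqrt (qnorm2 d0))^-1.
pose d := qofR a * d0.
have hd : coef x x d by exact: coef_scale.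
have rd : qre d = 0 by exact: imx.
have dd : d * d = -1.
  rewrite (qimag_sqr rd) qnorm2M qnorm2_ofR /a exprVn sqr_sqrtr ?qnorm2_ge0 //.
  by rewrite mulVf ?qnorm2_eq0.
have hz : coef z z d.
  have e : f = qofR (- qre (d * f)) * d.
    have : d * (d * f) = - f by rewrite mulrA dd mulN1r.
    by rewrite {1}(Kr (K_xxzz hd hf0)) -qofRC qofRN mulNr => ->; rewrite opprK.
  have r0 : - qre (d * f) != 0.
    by apply: contra_neq f0 => r0; rewrite e r0 qofR0 mul0r.
  by have := coef_scale (- qre (d * f))^-1 hf0; rewrite {2}e mulrA -qofRM mulVf // qofR1 mul1r.
exists d; split => // q hq.
exists (- qre (q * d)); rewrite qofRN -(Kr (K_xxzz hq hz)).
by rewrite mulNr -mulrA dd mulrN mulr1 opprK.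
Qed.
End Normalized.
End Pair.

(** * Invariant frames *)

Section Frames.
Variable R : realType.
Notation Q := (quat R).
Notation M3 := 'M[quat R]_3.
Notation V3 := 'cV[quat R]_3.
Implicit Types (p q : Q) (x y v w : V3) (A B C X Y g : M3).

Lemma dag_inv_Sp X : dag X *m X = 1%:M -> Sp X.
Proof.
by move=> h; rewrite /Sp -[RHS]mulmx1 -h !dag_def !mulmxA JJK mul1mx.
Qed.

Lemma dag_mulE n X (Y : 'M[quat R]_(3, n)) i j : (dag X *m Y) i j = qofR (Jsgn R i) * hf (col i X) (col j Y).
Proof.
rewrite !dag_def -mulmxA -mulmxA mulJE; congr (_ * _).
rewrite !hf_def -mulmxA !mxE; apply: eq_bigr => k _; rewrite !mxE; congr (_ * _).
by apply: eq_bigr => l _; rewrite !mxE.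
Qed.

Lemma dag_colE X v i : (dag X *m v) i 0 = qofR (Jsgn R i) * hf (col i X) v.
Proof. by rewrite dag_mulE; congr (_ * hf _ _); apply: vecP => k; rewrite mxE. Qed.

(** The residue [w = v - X (dag X v)] is orthogonal to all columns. Were it nonzero, it and the two
    positive columns would be three independent vectors in the two-dimensional complement of the
    negative column. *)
Lemma dag_linv_rinv X : dag X *m X = 1%:M -> X *m dag X = 1%:M.
Proof.
move=> h.
have hfX i j : hf (col i X) (col j X) = if i == j then qofR (Jsgn R i) else 0.
  have := dag_mulE X X i j; rewrite h mxE => e.
  have -> : hf (col i X) (col j X) = qofR (Jsgn R i) * (qofR (Jsgn R i) * hf (col i X) (col j X)).
    by rewrite mulrA -qofRM Jsgn_sqr qofR1 mul1r.
  by rewrite -e; case: eqP => _; rewrite ?mulr1 ?mulr0.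
suff key v : X *m (dag X *m v) = v.
  apply/matrixP => i j; have := key (delta_mx j 0); rewrite mulmxA -colE.
  by move=> /(congr1 (fun u : V3 => u i 0)); rewrite [LHS]mxE !mxE eqxx andbT.
apply/esym/eqP; rewrite -subr_eq0; apply/eqP; set w := v - _.
have hw i : hf (col i X) w = 0.
  have e : dag X *m w = 0 by rewrite mulmxBr !mulmxA h mul1mx subrr.
  have := dag_colE X w i; rewrite e mxE => /esym /eqP.
  rewrite qmulf_eq0 -qnorm2_eq0 qnorm2_ofR expr2 Jsgn_sqr oner_eq0 /=.
  by move=> /eqP.
clearbody w; apply/eqP; apply: contrapT => /negP wn.
have n2 : neg (col i2 X) by rewrite /neg hfX eqxx Jsgn2 /=; lra.
pose F (k : 'I_3) : V3 := if k == i0 then w else if k == i1 then col i0 X else col i1 X.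
have F2 k : hf (col i2 X) (F k) = 0.
  by move: k; apply: ord3P; rewrite /F /= ?hw ?hfX.
(* The combination kills the first two coordinates, and orthogonality to the negative column kills
   the third. *)
have [c [c0 [e0 e1]]] := dep3 (fun k => F k i0 0) (fun k => F k i1 0).
pose y : V3 := rs (F i0) (c i0 0) + rs (F i1) (c i1 0) + rs (F i2) (c i2 0).
have yE i : y i 0 = \sum_k F k i 0 * c k 0.
  by rewrite sum3 /y [LHS]mxE [X in X + _]mxE !rsE.
have y0 : y = 0.
  apply: vecP; apply: ord3P; rewrite [RHS]mxE yE //.
  have : hf (col i2 X) y = 0 by rewrite !hfDr !hf_rsr !F2 !mul0r !addr0.
  rewrite hfE !yE e0 e1 !mulr0 add0r sub0r => /eqP.
  by rewrite oppr_eq0 qmulf_eq0 qconj_eq0 (negPf (neg_neq0 n2)) => /eqP.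
have hFF i : hf (F i) y = 0 by rewrite y0 hf0r.
have wc i : hf w (col i X) = 0 by rewrite hfC hw qconj0.
have ww : hf w w != 0.
  apply/eqP => ww; have [_ h0] := neg_perp n2 (hw i2).
  by move/eqP: wn; apply; apply: h0; rewrite ww.
move/eqP: c0; apply; apply: vecP; apply: ord3P; rewrite [RHS]mxE.
- have := hFF i0; rewrite /y !hfDr !hf_rsr /F /= !wc !mul0r !addr0 => /eqP.
  by rewrite qmulf_eq0 (negPf ww) => /eqP.
- have := hFF i1; rewrite /y !hfDr !hf_rsr /F /= hw !hfX /= Jsgn0 qofR1 !mul0r mul1r add0r addr0.
  by [].
- have := hFF i2; rewrite /y !hfDr !hf_rsr /F /= hw !hfX /= Jsgn1 qofR1 !mul0r mul1r !add0r.
  by [].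
Qed.

Definition frame (e0 e1 e2 : V3) : M3 :=
  \matrix_(i, j) (if j == i0 then e0 else if j == i1 then e1 else e2) i 0.

Lemma frame_col e0 e1 e2 : [/\ col i0 (frame e0 e1 e2) = e0,
  col i1 (frame e0 e1 e2) = e1 & col i2 (frame e0 e1 e2) = e2].
Proof. by split; apply: vecP => i; rewrite !mxE. Qed.

Lemma frame_orthonormal e0 e1 e2 : hf e0 e0 = 1 -> hf e1 e1 = 1 -> hf e2 e2 = -1 ->
  hf e0 e1 = 0 -> hf e0 e2 = 0 -> hf e1 e2 = 0 ->
  let M := frame e0 e1 e2 in dag M *m M = 1%:M /\ M *m dag M = 1%:M.
Proof.
move=> h00 h11 h22 h01 h02 h12 M.
suff h : dag M *m M = 1%:M by split => //; exact: dag_linv_rinv.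
have [c0 c1 c2] := frame_col e0 e1 e2.
apply/matrixP => i j; rewrite dag_mulE [RHS]mxE.
move: i j; apply: ord3P; apply: ord3P; rewrite ?c0 ?c1 ?c2 ?Jsgn0 ?Jsgn1 ?Jsgn2 /=;
  rewrite ?h00 ?h11 ?h22 ?h01 ?h02 ?h12 ?(hf_eq0C h01) ?(hf_eq0C h02) ?(hf_eq0C h12);
  rewrite ?mulr0 ?mulr1 ?qofRN ?mulrN1 ?opprK ?qofR1 //.
Qed.

Lemma exists_perp x y : exists2 w : V3, w != 0 & hf x w = 0 /\ hf y w = 0.
Proof.
have [w [w0 [h1 h2]]] := dep3 (fun i => (star x *m JJ R) 0 i) (fun i => (star y *m JJ R) 0 i).
by exists w => //; split; rewrite !hf_def mxE.
Qed.
End Frames.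

Section InvariantFrame.
Variables (R : realType) (G : set 'M[quat R]_3).
Notation Q := (quat R).
Notation M3 := 'M[quat R]_3.
Notation V3 := 'cV[quat R]_3.
Implicit Types (p q d s : Q) (v w e f : V3) (A B C X Y g M : M3).
Hypothesis GG : Sp_group G.
Hypothesis Gtr : forall A, G A -> qreal (\tr A).
Notation coef := (coef G).

Lemma limit_span x : limit_vec G x ->
  exists2 y, null y /\ y i2 0 != 0 & spanA G (outer x y).
Proof.
move=> lx; have [U [y [UU UG ny y2 [_ cL]]]] := limit_rank1 GG lx.
exists y => //; apply: (spanA_limit UU _ cL).
by apply: filterS UG => A GA; apply: spanA_scale; exact: spanA_G.
Qed.

(** The product of [outer x y], [g] and [outer y' x'] has coefficient [hf y (g *m y')]. If this
    vanished for every [g], all images of the null vector [y'] would lie on the line of [y], which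
    would then be fixed by [G]. *)
Lemma coef_nonzero x x' :
  (forall p : V3, null p -> p i2 0 = 1 -> (forall A, G A -> fixes A p) -> False) ->
  limit_vec G x -> limit_vec G x' -> exists2 q, q != 0 & coef x x' q.
Proof.
move=> nofix lx lx'.
have [y [ny y2] hy] := limit_span lx; have [y' [ny' y2'] hy'] := limit_span lx'.
have [[g [Gg h]]|nex] := pselect (exists g, G g /\ hf y (g *m y') != 0).
  exists (hf y (g *m y')) => //; split.
  have := spanA_mul GG (spanA_mul GG hy (spanA_G Gg)) (spanA_dag GG hy').
  by rewrite dag_outer -mulmxA mul_outer outer_mul.
exfalso; have gy g : G g -> exists c, g *m y' = rs y c.
  move=> Gg; eexists; apply: (null_perp ny _ _ y2).
    by rewrite /null Sp_hf //; exact: (G_sp GG).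
  by apply/eqP; apply: contrapT => /negP h; apply: nex; exists g.
have [c0 hc0] := gy _ (G_1 GG); rewrite mul1mx in hc0.
have c00 : c0 != 0 by apply: contraNneq y2' => e; rewrite hc0 e rs0 mxE.
have yE : y = rs y' c0^-1 by rewrite hc0 rsK.
apply: (nofix (rs y' (y' i2 0)^-1)).
- by rewrite /null hf_rsr hf_rsl ny' mulr0 mul0r.
- by rewrite rsE mulrV ?qunitE.
- move=> A GA; have [c hc] := gy _ GA.
  exists (y' i2 0 * c0^-1 * c * (y' i2 0)^-1).
  by rewrite rs_mul hc yE !rsA !mulrA mulVr ?qunitE // mul1r.
Qed.

Lemma frame_conj M g i j :
  (dag M *m g *m M) i j = qofR (Jsgn R i) * hf (col i M) (g *m col j M).
Proof.
rewrite -mulmxA dag_mulE; congr (_ * hf _ _).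
by rewrite !colE mulmxA.
Qed.

Lemma hf_rsR v w (a b : R) : hf (rs v (qofR a)) (rs w (qofR b)) = qofR (a * b) * hf v w.
Proof. by rewrite hf_rsl hf_rsr qconj_ofR qofRM -mulrA -qofRC. Qed.

Section Pair.
Variables x z : V3.
Hypotheses (nx : null x) (nz : null z) (xz : hf x z = -1).
Let zx' : hf z x = -1 := zx xz.
(** The vectors [x - z] and [x + z] have form values 2 and -2; [c] normalizes them. *)
Let c : R := (Num.sqrt 2)^-1.
Let cc : c * c = 2^-1.
Proof. by rewrite -invfM -expr2 sqr_sqrtr. Qed.
Let u0 := rs (x - z) (qofR c).
Let u2 := rs (x + z) (qofR c).

Lemma u00 : hf u0 u0 = 1.
Proof.
rewrite /u0 hf_rsR cc hfDr !hfDl !hfNr !hfNl nx nz xz zx'.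
by apply: quat_ext; rewrite !qE /=; lra.
Qed.
Lemma u22 : hf u2 u2 = -1.
Proof.
rewrite /u2 hf_rsR cc hfDr !hfDl nx nz xz zx'.
by apply: quat_ext; rewrite !qE /=; lra.
Qed.
Lemma u02 : hf u0 u2 = 0.
Proof.
rewrite /u0 /u2 hf_rsR cc hfDr !hfDl !hfNl nx nz xz zx'.
by apply: quat_ext; rewrite !qE /=; lra.
Qed.

Lemma perp_u v : hf x v = 0 -> hf z v = 0 -> hf u0 v = 0 /\ hf u2 v = 0.
Proof. by move=> h h'; rewrite /u0 /u2 !hf_rsl !hfDl hfNl h h' oppr0 addr0 mulr0. Qed.

Lemma perp_pos v : hf x v = 0 -> hf z v = 0 ->
  0 <= qre (hf v v) /\ (qre (hf v v) = 0 -> v = 0).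
Proof.
move=> h h'; apply: (neg_perp (x := x + z)); first exact: neg_xz nx nz xz.
by rewrite hfDl h h' addr0.
Qed.

Lemma proj_perp v : let w := v + rs x (hf z v) + rs z (hf x v) in hf x w = 0 /\ hf z w = 0.
Proof.
by split; rewrite !hfDr !hf_rsr ?nx ?nz ?xz ?zx' ?mul0r ?mulN1r ?addr0 subrr.
Qed.

Lemma normalize v : 0 < qre (hf v v) ->
  exists a : R, hf (rs v (qofR a)) (rs v (qofR a)) = 1.
Proof.
move=> h; exists (Num.sqrt (qre (hf v v)))^-1.
rewrite hf_rsR hfxx -qofRM -invfM -expr2 sqr_sqrtr ?ltW //.
by rewrite mulVf ?qofR1 // gt_eqF.
Qed.

(** The vectors [e] with 1 in D(x, e) form a real space on which every [hf e (g *m f)] lies in D(x,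
    x), hence is real. An orthonormal frame is built inside it. *)
Lemma real_frame x3 : coef x x 1 -> coef z z 1 -> (forall q, coef x x q -> q = qofR (qre q)) ->
  coef x z 1 -> null x3 -> hf x x3 != 0 -> hf z x3 != 0 -> coef x x3 1 ->
  exists M, [/\ dag M *m M = 1%:M, M *m dag M = 1%:M &
    forall g, G g -> forall i j, qreal ((dag M *m g *m M) i j)].
Proof.
move=> D11 D22 Dr D12 n3 x13 x23 D13.
have Wreal e f g : coef x e 1 -> coef x f 1 -> G g -> hf e (g *m f) = qofR (qre (hf e (g *m f))).
  move=> he hf' Gg; apply: Dr; have := coef_mulG GG he Gg (coef_conj GG hf').
  by rewrite qconj1 mul1r mulr1.
have Wreal1 e f : coef x e 1 -> coef x f 1 -> hf e f = qofR (qre (hf e f)).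
  by move=> he hf'; have := Wreal _ _ _ he hf' (G_1 GG); rewrite mul1mx.
have Wadd e f : coef x e 1 -> coef x f 1 -> coef x (e + f) 1.
  by move=> [h1] [h2]; split; rewrite outerDr; exact: spanA_add.
have Wscale e (a : R) : coef x e 1 -> coef x (rs e (qofR a)) 1.
  by move=> h; apply/coef_rsr; rewrite qconj_ofR mul1r -[qofR a]mulr1; exact: coef_scale.
have Wopp e : coef x e 1 -> coef x (- e) 1.
  by move=> /(Wscale _ (-1)); rewrite qofRN qofR1 rsN rs1.
pose w := x3 + rs x (hf z x3) + rs z (hf x x3).
have [xw zw] := proj_perp x3; rewrite -/w in xw zw.
have Dw : coef x w 1.
  rewrite /w (Wreal1 z x3) // (Wreal1 x x3) //.
  exact: (Wadd _ _ (Wadd _ _ D13 (Wscale _ _ D11)) (Wscale _ _ D12)).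
(* If the projection vanished, [x3] would be a real combination of [x] and [z] with form value
   [-2 <z, x3> <x, x3>], which is nonzero although [x3] is null. *)
have wpos : 0 < qre (hf w w).
  have [w0 w00] := perp_pos xw zw; rewrite lt_def w0 andbT; apply/eqP => /w00 we.
  have e3 : x3 = - rs x (hf z x3) - rs z (hf x x3).
    by apply/eqP; rewrite -subr_eq0 !opprD !opprK addrA -/w we.
  have : hf x3 x3 = - (qofR 2 * (hf z x3 * hf x x3)).
    rewrite {1 2}e3 hfDr !hfDl !hfNr !hfNl !hf_rsl !hf_rsr nx nz xz zx' (Wreal1 z x3) // (Wreal1 x x3) //.
    by rewrite !qconj_ofR; apply: quat_ext; rewrite !qE /=; ring.
  rewrite n3 => /eqP; rewrite eq_sym oppr_eq0 !qmulf_eq0 (negPf x13) (negPf x23) !orbF.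
  by rewrite -qnorm2_eq0 qnorm2_ofR sqrf_eq0 pnatr_eq0.
have [a ha] := normalize wpos.
have D0 : coef x u0 1 by apply: Wscale; apply: Wadd => //; exact: Wopp.
have D2 : coef x u2 1 by apply: Wscale; exact: Wadd.
have D1 : coef x (rs w (qofR a)) 1 by exact: Wscale.
have [p0 p2] := perp_u xw zw.
have [| | |h1 h2] := frame_orthonormal u00 ha u22.
- by rewrite hf_rsr p0 mul0r.
- exact: u02.
- by rewrite hf_rsl (hf_eq0C p2) mulr0.
set M := frame _ _ _ in h1 h2.
exists M; split => // g Gg i j; rewrite frame_conj.
have DM k : coef x (col k M) 1.
  by have [c0 c1 c2] := frame_col u0 (rs w (qofR a)) u2; move: k; apply: ord3P; rewrite ?c0 ?c1 ?c2.
by rewrite (Wreal _ _ _ (DM i) (DM j) Gg) -qofRM.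
Qed.

Lemma conj_to_i d : qre d = 0 -> d * d = -1 ->
  exists s, qconj s * s = 1 /\ d * s = s * Quat 0 1 0 0.
Proof.
move=> rd dd; set I := Quat 0 1 0 0.
have II : I * I = -1 by apply: quat_ext; rewrite !qE /=; ring.
have [s s0 hs] : exists2 s, s != 0 & d * s = s * I.
  (* [1 - d * I] intertwines [d] and [I] as both square to -1. It vanishes only for [d = - I], where
     the unit j does the job. *)
  have [e|n] := eqVneq (1 - d * I) 0; last first.
    exists (1 - d * I) => //; rewrite mulrBr mulrBl mulr1 mul1r mulrA dd mulN1r opprK.
    by rewrite -mulrA II mulrN1 opprK addrC.
  exists (Quat 0 0 1 0); first by apply/eqP => -[] /eqP; rewrite oner_eq0.
  have -> : d = - I.
    have : d * (d * I) = d by move/eqP: e; rewrite subr_eq0 => /eqP <-; rewrite mulr1.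
    by rewrite mulrA dd mulN1r.
  by apply: quat_ext; rewrite !qE /=; ring.
exists (qofR (Num.sqrt (qnorm2 s))^-1 * s); split.
  rewrite qmulVq qnorm2M qnorm2_ofR exprVn sqr_sqrtr ?qnorm2_ge0 //.
  by rewrite mulVf ?qnorm2_eq0.
by rewrite mulrA -qofRC -mulrA hs mulrA.
Qed.

(** Multiplying the entries of [g] at [x] and [z] by elements of the spaces D places each of them in
    the real line of 1 or of [d]. Right multiplication of the frame by [s] turns [d] into the unit
    i. *)
Lemma complex_frame d : qre d = 0 -> d * d = -1 -> coef x x d -> coef z z d -> coef x z 1 ->
  (forall q, coef x x q -> exists r, q = qofR r * d) ->
  (forall q, coef x z q -> q = qofR (qre q)) ->
  exists M, [/\ dag M *m M = 1%:M, M *m dag M = 1%:M &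
    forall g, G g -> let B := dag M *m g *m M in
      [/\ B i1 i0 = 0 /\ B i1 i2 = 0, qcomplex (B i0 i0), qcomplex (B i0 i2),
        qcomplex (B i2 i0) & qcomplex (B i2 i2)]].
Proof.
move=> rd dd Dxx Dzz Dxz Dxr Dr.
have inv q q' : q * d = q' -> q = - (q' * d).
  by move=> <-; rewrite -mulrA dd mulrN1 opprK.
have invl q q' : d * q = q' -> q = - (d * q').
  by move=> <-; rewrite mulrA dd mulN1r opprK.
have hxx g : G g -> exists r, hf x (g *m x) = qofR r * d.
  move=> Gg; have [r hr] := Dxr _ (coef_mulG GG Dxx Gg Dxx).
  exists (- r); move/inv: hr => /invl ->.
  by rewrite mulrN opprK -mulrA dd mulrN1 mulrN -qofRC qofRN mulNr.
have hzx g : G g -> exists r, hf z (g *m x) = qofR r.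
  move=> Gg; have [r] := Dxr _ (coef_mulG GG Dxz Gg Dxx).
  by rewrite mul1r => /inv ->; exists r; rewrite -mulrA dd mulrN1 opprK.
have hxz g : G g -> exists r, hf x (g *m z) = qofR r.
  move=> Gg; have := Dr _ (coef_mulG GG Dxx Gg Dzz) => /inv /invl ->.
  set r := qre _; exists (- r).
  have -> : d * - (qofR r * d) = qofR r by rewrite mulrN qofRC mulrA dd mulN1r opprK.
  by rewrite qofRN.
have hzz g : G g -> exists r, hf z (g *m z) = qofR r * d.
  move=> Gg; have := Dr _ (coef_mulG GG Dxz Gg Dzz); rewrite mul1r => /inv ->.
  by eexists; rewrite -mulNr -qofRN.
(* For null [v] the projection [w] has form value [2 Re (conj <z, v> * <x, v>)], so by positivity it
   vanishes here. This is what makes the plane of [x] and [z] invariant. *)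
have span v : null v -> qre (qconj (hf z v) * hf x v) = 0 ->
    v = - rs x (hf z v) - rs z (hf x v).
  move=> nv h; have [xw zw] := proj_perp v; set w := _ + _ + _ in xw zw.
  have [_ w0] := perp_pos xw zw.
  suff we : w = 0 by apply/eqP; rewrite -subr_eq0 !opprD !opprK addrA -/w we.
  apply: w0; have -> : hf w w = hf w v.
    by rewrite {2}/w !hfDr !hf_rsr (hf_eq0C xw) (hf_eq0C zw) !mul0r !addr0.
  rewrite /w !hfDl !hf_rsl nv add0r qreD h add0r.
  by rewrite -[LHS]qre_conj qconjM qconjK h.
have gx g : G g -> g *m x = - rs x (hf z (g *m x)) - rs z (hf x (g *m x)).
  move=> Gg; apply: span; first by rewrite /null Sp_hf //; exact: (G_sp GG).
  have [r ->] := hzx g Gg; have [r' ->] := hxx g Gg.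
  by rewrite qconj_ofR mulrA -qofRM qreM rd /=; ring.
have gz g : G g -> g *m z = - rs x (hf z (g *m z)) - rs z (hf x (g *m z)).
  move=> Gg; apply: span; first by rewrite /null Sp_hf //; exact: (G_sp GG).
  have [r ->] := hzz g Gg; have [r' ->] := hxz g Gg.
  by rewrite qconjM qconj_ofR -mulrA -qofRM -qofRC qconjE rd !qE rd /=; ring.
pose Cd q := exists a b : R, q = qofR a + qofR b * d.
have CdD p q : Cd p -> Cd q -> Cd (p + q).
  move=> [a [b ->]] [a' [b' ->]]; exists (a + a'), (b + b').
  by rewrite !qofRD mulrDl addrACA.
have CdN p : Cd p -> Cd (- p).
  by move=> [a [b ->]]; exists (- a), (- b); rewrite !qofRN mulNr opprD.
have CdZ p (a : R) : Cd p -> Cd (qofR a * p).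
  by move=> [b [b' ->]]; exists (a * b), (a * b'); rewrite !qofRM mulrDr mulrA.
have Cdg g : G g -> [/\ Cd (hf x (g *m x)), Cd (hf x (g *m z)), Cd (hf z (g *m x)) &
    Cd (hf z (g *m z))].
  move=> Gg; split.
  - by have [r ->] := hxx g Gg; exists 0, r; rewrite qofR0 add0r.
  - by have [r ->] := hxz g Gg; exists r, 0; rewrite qofR0 mul0r addr0.
  - by have [r ->] := hzx g Gg; exists r, 0; rewrite qofR0 mul0r addr0.
  - by have [r ->] := hzz g Gg; exists 0, r; rewrite qofR0 add0r.
have [s [ss ds]] := conj_to_i rd dd.
have sCd q : Cd q -> qcomplex (qconj s * q * s).
  move=> [a [b ->]].
  have -> : qconj s * (qofR a + qofR b * d) * s = qofR a + qofR b * Quat 0 1 0 0.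
    rewrite mulrDr mulrDl -!qofRC -!mulrA ss mulr1; congr (_ + _).
    by rewrite (mulrA (qconj s)) -(qofRC b) -mulrA ds (mulrA (qconj s)) ss mul1r.
  by split; rewrite !qE /=; ring.
have [w w0 [xw zw]] := exists_perp x z.
have wpos : 0 < qre (hf w w).
  have [h h0] := perp_pos xw zw; rewrite lt_def h andbT.
  by apply: contra_neqN w0 => /eqP.
have [a ha] := normalize wpos.
have [p0 p2] := perp_u xw zw.
have [| | | | |h1 h2] := frame_orthonormal (e0 := rs u0 s) (e2 := rs u2 s) _ ha.
- by rewrite hf_rsr hf_rsl u00 mulr1.
- by rewrite hf_rsr hf_rsl u22 mulrN1 mulNr ss.
- by rewrite hf_rsr hf_rsl p0 mulr0 mul0r.
- by rewrite hf_rsr hf_rsl u02 mulr0 mul0r.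
- by rewrite hf_rsr hf_rsl (hf_eq0C p2) mulr0 mul0r.
set M := frame _ _ _ in h1 h2.
exists M; split => // g Gg B.
have [c0 c1 c2] := frame_col (rs u0 s) (rs w (qofR a)) (rs u2 s); rewrite -/M in c0 c1 c2.
have [Cxx Cxz Czx Czz] := Cdg g Gg.
have wgx : hf w (g *m x) = 0.
  by rewrite gx // !(hfDr, hfNr, hf_rsr) (hf_eq0C xw) (hf_eq0C zw) !mul0r oppr0 addr0.
have wgz : hf w (g *m z) = 0.
  by rewrite gz // !(hfDr, hfNr, hf_rsr) (hf_eq0C xw) (hf_eq0C zw) !mul0r oppr0 addr0.
have eB i j : B i j = qofR (Jsgn R i) * hf (col i M) (g *m col j M) by exact: frame_conj.
have sgn i q : qcomplex q -> qcomplex (qofR (Jsgn R i) * q).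
  by move=> [h h']; split; rewrite !qE h h' /=; ring.
have es u v : hf (rs u s) (g *m rs v s) = qconj s * hf u (g *m v) * s.
  by rewrite rs_mul hf_rsr hf_rsl.
have Cu (v v' : V3) : Cd (hf v (g *m v')) -> Cd (hf (rs v (qofR c)) (g *m rs v' (qofR c))).
  by move=> h; rewrite rs_mul hf_rsR; exact: CdZ.
split.
- by rewrite !eB c0 c1 c2 !rs_mul !hf_rsl !hf_rsr !(mulmxDr, mulmxN, hfDr, hfNr) wgx wgz
    oppr0 addr0 !(mul0r, mulr0).
- rewrite eB c0; apply: sgn; rewrite es; apply: sCd; apply: Cu.
  rewrite !(mulmxDr, mulmxN, hfDr, hfNr, hfDl, hfNl).
  by repeat first [exact: Cxx | exact: Cxz | exact: Czx | exact: Czz | apply: (CdD _ _) | apply: (CdN _)].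
- rewrite eB c0 c2; apply: sgn; rewrite es; apply: sCd; apply: Cu.
  rewrite !(mulmxDr, mulmxN, hfDr, hfNr, hfDl, hfNl).
  by repeat first [exact: Cxx | exact: Cxz | exact: Czx | exact: Czz | apply: (CdD _ _) | apply: (CdN _)].
- rewrite eB c0 c2; apply: sgn; rewrite es; apply: sCd; apply: Cu.
  rewrite !(mulmxDr, mulmxN, hfDr, hfNr, hfDl, hfNl).
  by repeat first [exact: Cxx | exact: Cxz | exact: Czx | exact: Czz | apply: (CdD _ _) | apply: (CdN _)].
- rewrite eB c2; apply: sgn; rewrite es; apply: sCd; apply: Cu.
  rewrite !(mulmxDr, mulmxN, hfDr, hfNr, hfDl, hfNl).
  by repeat first [exact: Cxx | exact: Cxz | exact: Czx | exact: Czz | apply: (CdD _ _) | apply: (CdN _)].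
Qed.
End Pair.
End InvariantFrame.

(** * Hyperbolic geometry *)

Section Geometry.
Variable R : realType.
Notation Q := (quat R).
Notation M3 := 'M[quat R]_3.
Notation V3 := 'cV[quat R]_3.
Implicit Types (p q : Q) (a b c u v w x y : V3) (X Y : M3) (z : pt R).

Lemma qre_ofRM (k : R) p : qre (qofR k * p) = k * qre p.
Proof. by rewrite qreM /= !mul0r !subr0. Qed.

Definition lv z : V3 := \col_i Defs.lift z i.
Definition cv v : pt R := (v i0 0 * (v i2 0)^-1, v i1 0 * (v i2 0)^-1).
Definition actM X z : pt R := cv (X *m lv z).

Lemma lvE0 z : lv z i0 0 = z.1. Proof. by rewrite mxE. Qed.
Lemma lvE1 z : lv z i1 0 = z.2. Proof. by rewrite mxE. Qed.
Lemma lvE2 z : lv z i2 0 = 1. Proof. by rewrite mxE. Qed.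

Lemma lv_cv v : v i2 0 != 0 -> lv (cv v) = rs v (v i2 0)^-1.
Proof.
by move=> v2; apply: vecP; apply: ord3P; rewrite rsE ?lvE0 ?lvE1 ?lvE2 // mulrV ?qunitE.
Qed.

Lemma cv_rs v q : q != 0 -> v i2 0 != 0 -> cv (rs v q) = cv v.
Proof.
move=> q0 v2; rewrite /cv !rsE.
have e i : v i 0 * q * (v i2 0 * q)^-1 = v i 0 * (v i2 0)^-1.
  by rewrite invrM ?qunitE // mulrA mulrK ?qunitE.
by rewrite !e.
Qed.

Lemma cv_lv z : cv (lv z) = z.
Proof. by case: z => z1 z2; rewrite /cv lvE0 lvE1 lvE2 invr1 !mulr1. Qed.

Lemma inball_neg z : inball z <-> neg (lv z).
Proof. by rewrite /inball /neg qre_hfxx lvE0 lvE1 lvE2 qnorm2_1 subr_lt0. Qed.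

Lemma herm_hf z z' : herm (Defs.lift z) (Defs.lift z') = hf (lv z) (lv z').
Proof.
rewrite hfE !lvE0 !lvE1 !lvE2 /herm; transitivity (\sum_(i < 3)
   qconj (Defs.lift z i) * (qofR (Jsgn R i) * Defs.lift z' i)) => //.
by rewrite sum3 Jsgn0 Jsgn1 Jsgn2 qofRN qofR1 mulN1r !mul1r mulrN.
Qed.

Definition bc v w : R := qnorm2 (hf v w) / (qre (hf v v) * qre (hf w w)).

Lemma bcosh2E z z' : bcosh2 z z' = bc (lv z) (lv z').
Proof. by rewrite /bcosh2 !herm_hf. Qed.

Lemma qre_hf_rs v q : qre (hf (rs v q) (rs v q)) = qnorm2 q * qre (hf v v).
Proof. by rewrite hf_rsl hf_rsr hfxx mulrA -qofRC -mulrA qmulVq -qofRM mulrC. Qed.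

Lemma neg_rs v q : q != 0 -> neg v -> neg (rs v q).
Proof. by move=> q0 nv; rewrite /neg qre_hf_rs pmulr_rlt0 // qnorm2_gt0. Qed.

Lemma bc_rs v w p q : p != 0 -> q != 0 -> bc (rs v p) (rs w q) = bc v w.
Proof.
move=> p0 q0; rewrite /bc !qre_hf_rs hf_rsl hf_rsr !qnorm2M qnorm2_conj.
have pq : qnorm2 p * qnorm2 q != 0 by rewrite mulf_neq0 // qnorm2_eq0.
rewrite mulrACA (mulrCA (qnorm2 p)) (mulrC (qnorm2 (hf v w))).
by rewrite -mulf_div divff ?mul1r.
Qed.

Lemma actM_neg X z : Sp X -> inball z -> neg (X *m lv z).
Proof. by move=> sX /inball_neg nz; rewrite /neg Sp_hf. Qed.

Lemma lv_actM X z : Sp X -> inball z -> exists2 q, q != 0 & lv (actM X z) = rs (X *m lv z) q.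
Proof.
move=> sX bz; have n2 := neg_neq0 (actM_neg sX bz).
by exists ((X *m lv z) i2 0)^-1; [rewrite invr_eq0|exact: lv_cv].
Qed.

Lemma actM_inball X z : Sp X -> inball z -> inball (actM X z).
Proof.
move=> sX bz; apply/inball_neg; have [q q0 ->] := lv_actM sX bz.
by apply: neg_rs => //; exact: actM_neg.
Qed.

Lemma actM_bcosh2 X z z' : Sp X -> inball z -> inball z' ->
  bcosh2 (actM X z) (actM X z') = bcosh2 z z'.
Proof.
move=> sX bz bz'; rewrite !bcosh2E.
have [q q0 ->] := lv_actM sX bz; have [q' q0' ->] := lv_actM sX bz'.
by rewrite bc_rs // /bc !Sp_hf.
Qed.

Lemma actM_hdist X z z' : Sp X -> inball z -> inball z' ->
  hdist (actM X z) (actM X z') = hdist z z'.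
Proof. by move=> sX bz bz'; rewrite /hdist actM_bcosh2. Qed.

Lemma actMM X Y z : Sp X -> Sp Y -> inball z -> actM X (actM Y z) = actM (X *m Y) z.
Proof.
move=> sX sY bz; rewrite {1}/actM; have [q q0 ->] := lv_actM sY bz.
rewrite rs_mul cv_rs //; first by rewrite /actM mulmxA.
by apply: neg_neq0; rewrite /neg !Sp_hf //; apply/inball_neg.
Qed.

Lemma actM1 z : actM 1%:M z = z.
Proof. by rewrite /actM mul1mx cv_lv. Qed.

Lemma reverse_cauchy a b : hf a a = -1 -> hf b b = -1 -> 1 <= qnorm2 (hf a b).
Proof.
move=> ha hb; have na : neg a by rewrite /neg ha !qE; lra.
pose w := b + rs a (hf a b).
have aw : hf a w = 0 by rewrite hfDr hf_rsr ha mulN1r subrr.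
have [] := neg_perp na aw.
have -> : hf w w = hf b w by rewrite {1}/w hfDl hf_rsl aw mulr0 addr0.
by rewrite hfDr hf_rsr hb (hfC a b) qmulVq !qE /=; lra.
Qed.

(* The hypothesis is the addition formula of cosh.  In it the Cauchy-Schwarz inequality
   for the components of [a] and [c] orthogonal to [b] must be an equality, and the two
   summands of [<a, c>] must be aligned. *)
Lemma triangle_equality a b c : hf a a = -1 -> hf b b = -1 -> hf c c = -1 ->
  a + rs b (hf b a) != 0 ->
  (let X1 := Num.sqrt (qnorm2 (hf a b)) in let X2 := Num.sqrt (qnorm2 (hf b c)) in
   Num.sqrt (qnorm2 (hf a c)) =
     X1 * X2 + Num.sqrt (X1 ^+ 2 - 1) * Num.sqrt (X2 ^+ 2 - 1)) ->
  exists (t : R) q, [/\ 0 <= t, q != 0 &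
    c = rs b (qofR (1 + t * qnorm2 (hf a b)) * q) + rs a (hf a b * qofR t * q)].
Proof.
move=> ha hb hc a'n0 /=.
have nb : neg b by rewrite /neg hb !qE; lra.
have ab1 := reverse_cauchy ha hb; have bc1 := reverse_cauchy hb hc.
set n1 := qnorm2 (hf a b) in ab1 *; set n2 := qnorm2 (hf b c) in bc1 *.
rewrite !sqr_sqrtr ?(le_trans ler01) //.
set X1 := Num.sqrt n1; set X2 := Num.sqrt n2; set Y1 := Num.sqrt (n1 - 1); set Y2 := Num.sqrt (n2 - 1).
have X10 : 0 <= X1 by exact: sqrtr_ge0.
have X20 : 0 <= X2 by exact: sqrtr_ge0.
have Y10 : 0 <= Y1 by exact: sqrtr_ge0.
have Y20 : 0 <= Y2 by exact: sqrtr_ge0.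
have X1s : X1 ^+ 2 = n1 by rewrite sqr_sqrtr ?(le_trans ler01).
have X2s : X2 ^+ 2 = n2 by rewrite sqr_sqrtr ?(le_trans ler01).
have Y1s : Y1 ^+ 2 = n1 - 1 by rewrite sqr_sqrtr // subr_ge0.
have Y2s : Y2 ^+ 2 = n2 - 1 by rewrite sqr_sqrtr // subr_ge0.
move=> /(congr1 (fun t => t ^+ 2)); rewrite sqr_sqrtr ?qnorm2_ge0 // => main.
pose a' := a + rs b (hf b a); pose c' := c + rs b (hf b c).
have ba' : hf b a' = 0 by rewrite hfDr hf_rsr hb mulN1r subrr.
have bc' : hf b c' = 0 by rewrite hfDr hf_rsr hb mulN1r subrr.
have ea' : hf a' a' = qofR (n1 - 1).
  have -> : hf a' a' = hf a a' by rewrite {1}/a' hfDl hf_rsl ba' mulr0 addr0.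
  by rewrite hfDr hf_rsr ha (hfC a b) qmulqV qofRD qofRN addrC.
have ec' : hf c' c' = qofR (n2 - 1).
  have -> : hf c' c' = hf c c' by rewrite {1}/c' hfDl hf_rsl bc' mulr0 addr0.
  by rewrite hfDr hf_rsr hc (hfC b c) qmulVq qofRD qofRN addrC.
have A'0 : 0 < n1 - 1.
  have [h h0] := neg_perp nb ba'; rewrite lt_def subr_ge0 ab1 andbT.
  by apply: contra_neqN a'n0 => /eqP e; apply: h0; rewrite ea' e.
set r := hf a' c'; pose P := hf a b * hf b c.
have acE : hf a c = r - P.
  have -> : r = hf a c' by rewrite /r {1}/a' hfDl hf_rsl bc' mulr0 addr0.
  by rewrite /c' hfDr hf_rsr addrK.
have nP : qnorm2 P = n1 * n2 by rewrite /P qnorm2M.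
have cs w : hf b w = 0 -> 0 <= qre (hf w w) /\ (qre (hf w w) = 0 -> w = 0) by exact: neg_perp.
pose k := qofR (n1 - 1)^-1 * r.
pose w := c' - rs a' k.
have bw : hf b w = 0 by rewrite hfDr hfNr hf_rsr bc' ba' mul0r subrr.
have ww : qre (hf w w) = (n2 - 1) - qnorm2 r / (n1 - 1).
  have a'w : hf a' w = 0.
    by rewrite hfDr hfNr hf_rsr ea' mulrA -qofRM mulfV ?gt_eqF // qofR1 mul1r subrr.
  have -> : hf w w = hf c' w by rewrite {1}/w hfDl hfNl hf_rsl a'w mulr0 oppr0 addr0.
  rewrite hfDr hfNr hf_rsr ec' (hfC a' c') -/r /k mulrA -qofRC -mulrA qmulVq -qofRM.
  by rewrite qreD qreN !qre_ofR mulrC.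
have [w0 w00] := cs _ bw.
have rle : qnorm2 r <= (n1 - 1) * (n2 - 1).
  by move: w0; rewrite ww subr_ge0 ler_pdivrMr // mulrC.
pose m := - qre (qconj P * r).
have m2 : m ^+ 2 <= qnorm2 P * qnorm2 r.
  by rewrite sqrrN -(qnorm2_conj P) -qnorm2M; exact: qre_sqr_le.
have mainE : n1 * n2 + qnorm2 r + 2 * m = n1 * n2 + (n1 - 1) * (n2 - 1) + 2 * (X1 * X2 * Y1 * Y2).
  have -> : n1 * n2 + qnorm2 r + 2 * m = qnorm2 (hf a c).
    rewrite acE (addrC r) qnorm2D qnorm2N nP /m qconjN mulNr qreN; ring.
  by rewrite main -Y1s -Y2s -X1s -X2s; ring.
set T := X1 * X2 * Y1 * Y2 in mainE.
have T0 : 0 <= T by rewrite !mulr_ge0.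
have T2 : T ^+ 2 = n1 * n2 * ((n1 - 1) * (n2 - 1)).
  by rewrite /T !exprMn X1s X2s Y1s Y2s; ring.
have n12 : 0 < n1 * n2 by rewrite mulr_gt0 // (lt_le_trans ltr01).
have mT : m <= T.
  have : m ^+ 2 <= T ^+ 2.
    by apply: le_trans m2 _; rewrite T2 nP; apply: ler_wpM2l => //; exact: ltW.
  by move=> h; have [m0|m0] := leP 0 m; [rewrite -(ler_pXn2r (ltn0Sn 1)) | lra].
(* [mainE] is the sum of the inequalities [rle] and (twice) [mT] with equality, so each of them is
   an equality. *)
have rE : qnorm2 r = (n1 - 1) * (n2 - 1) by lra.
have mE : m = T by lra.
have we : w = 0.
  by apply: w00; rewrite ww rE mulrAC mulfV ?gt_eqF // mul1r subrr.
pose t0 := T / (n1 * n2).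
have rP : r = - (qofR t0 * P).
  apply/eqP; rewrite -subr_eq0 opprK addrC -qnorm2_eq0 qnorm2D qnorm2M qnorm2_ofR nP rE.
  rewrite qconjM qconj_ofR -qofRC -mulrA qre_ofRM.
  have -> : qre (qconj P * r) = - T by rewrite -mE /m opprK.
  apply/eqP; rewrite /t0 expr_div_n T2.
  have h : n1 * n2 != 0 by rewrite gt_eqF.
  have -> : n1 * n2 * ((n1 - 1) * (n2 - 1)) / (n1 * n2) ^+ 2 * (n1 * n2) = (n1 - 1) * (n2 - 1).
    by move: (n1 * n2) (_ * _) h => N K h; field.
  have -> : T / (n1 * n2) * - T = - ((n1 - 1) * (n2 - 1)).
    by rewrite mulrN mulrAC -expr2 T2 mulrAC mulfV // mul1r.
  by ring.
pose t := t0 / (n1 - 1); exists t, (- hf b c); split.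
- by apply: divr_ge0; [apply: divr_ge0 => //; exact: ltW | exact: ltW].
- by rewrite oppr_eq0 -qnorm2_eq0 gt_eqF // (lt_le_trans ltr01).
have cE : c = rs a' k - rs b (hf b c).
  have e1 : c' = rs a' k by apply/eqP; rewrite -subr_eq0 -/w we.
  by rewrite -e1 /c' addrK.
have kE : k = - (qofR t * P) by rewrite /k rP mulrN mulrA -qofRM (mulrC _ t0).
have bk : hf b a * k = - (qofR (t * n1) * hf b c).
  rewrite kE mulrN /P (hfC a b); congr (- _).
  by rewrite (mulrA (qconj _)) -qofRC -mulrA (mulrA (qconj _)) qmulVq mulrA -qofRM.
rewrite {1}cE /a' rsDl rsA bk -addrA addrC -rsN -rsDr; congr (rs b _ + rs a _).
  by rewrite qofRD qofR1 mulrDl mul1r mulrN addrC.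
by rewrite kE /P mulrN mulrA qofRC.
Qed.

Section Collinear.
Variables x y u : V3.
Hypotheses (hx : hf x x = -1) (hy : hf y y = -1) (hu : hf u u = -1).
Definition coshd (v w : V3) : R := Num.sqrt (qnorm2 (hf v w)).
Definition dist_additive (a b c : V3) : Prop :=
  coshd a c = coshd a b * coshd b c +
    Num.sqrt (coshd a b ^+ 2 - 1) * Num.sqrt (coshd b c ^+ 2 - 1).
(** The factor [hf b a] aligns [b] with [a]: the pairing of [a] with [rs b (hf b a)] is real, and
    real combinations of these two vectors project to the geodesic through both points. *)
Definition on_line (a b c : V3) : Prop :=
  exists (s t : R) q, q != 0 /\ c = rs (rs a (qofR s) + rs b (hf b a * qofR t)) q.

Lemma hf_norm_neq0 a b : hf a a = -1 -> hf b b = -1 -> hf a b != 0.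
Proof.
move=> ha hb; rewrite -qnorm2_eq0 gt_eqF //.
exact: lt_le_trans ltr01 (reverse_cauchy ha hb).
Qed.

Lemma on_line_sym a b c : hf a a = -1 -> hf b b = -1 -> on_line a b c -> on_line b a c.
Proof.
move=> ha hb [s [t [q [q0 ->]]]].
have n0 := hf_norm_neq0 hb ha.
have n0' : qnorm2 (hf b a) != 0 by rewrite qnorm2_eq0.
exists t, (s / qnorm2 (hf b a)), (hf b a * q); rewrite qmulf_eq0 negb_or n0 q0; split=> //.
rewrite !rsDl !rsA addrC (hfC b a); congr (rs b _ + rs a _).
  by rewrite mulrA qofRC.
rewrite -qofRC -!mulrA (mulrA (qconj _)) qmulVq mulrA -qofRM.
by rewrite divfK.
Qed.

Lemma additive_same a b : hf a a = -1 -> hf b b = -1 -> a + rs b (hf b a) = 0 ->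
  exists2 q, q != 0 & a = rs b q.
Proof.
move=> ha hb e; exists (- hf b a); first by rewrite oppr_eq0 hf_norm_neq0.
by rewrite rsN; apply/eqP; rewrite -subr_eq0 opprK e.
Qed.

Lemma additive_on_line_end : dist_additive y x u -> (forall q, y <> rs x q) -> on_line x y u.
Proof.
move=> ad yx; have n : y + rs x (hf x y) != 0.
  by apply/eqP => /(additive_same hy hx) [q _ /yx].
have [t [q [t0 q0 ->]]] := triangle_equality hy hx hu n ad.
by exists (1 + t * qnorm2 (hf y x)), t, q; rewrite rsDl !rsA.
Qed.
End Collinear.

Lemma additive_on_line_mid x y u : hf x x = -1 -> hf y y = -1 -> hf u u = -1 ->
  dist_additive x u y -> on_line x y u.
Proof.
move=> hx hy hu ad.
have [e|n] := eqVneq (x + rs u (hf u x)) 0.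
  have [q q0 ->] := additive_same hx hu e.
  exists 1, 0, q^-1; rewrite invr_eq0; split=> //.
  by rewrite qofR0 mulr0 rs0 addr0 qofR1 rs1 rsK.
have [t [q [t0 q0 yE]]] := triangle_equality hx hu hy n ad.
apply: on_line_sym => //.
set h := hf x u in yE; pose N := qnorm2 h; rewrite -/N in yE.
have N1 : 1 <= N by exact: reverse_cauchy.
have xyE : hf x y = h * qofR (1 + t * N - t) * q.
  rewrite yE hfDr !hf_rsr hx mulN1r -/h mulrA -mulrBl -mulrBr -qofRN -qofRD.
  by [].
(* Pairing with [x] gives [hf x y = h * m * q], and [m] is positive as [N >= 1], so the [x] term of
   [y] can be expressed by [hf x y] and the relation solved for [u]. *)
pose m := 1 + t * N - t; rewrite -/m in xyE.
have m0 : 0 < m by rewrite /m; nra.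
pose r := 1 + t * N.
have r0 : 0 < r by rewrite /r; nra.
have rq : qofR r * q != 0 by rewrite qmulf_eq0 negb_or q0 -qnorm2_eq0 qnorm2_ofR sqrf_eq0 gt_eqF.
exists 1, (- (t / m)), (qofR r * q)^-1; rewrite invr_eq0; split => //.
have -> : rs y (qofR 1) + rs x (hf x y * qofR (- (t / m))) = rs u (qofR r * q).
  rewrite qofR1 rs1 qofRN mulrN rsN {1}yE -/r.
  have -> : hf x y * qofR (t / m) = h * qofR t * q.
    by rewrite xyE -mulrA -(qofRC _ q) mulrA -(mulrA h) -qofRM (mulrC m) divfK ?gt_eqF.
  by rewrite addrK.
by rewrite rsK.
Qed.
End Geometry.

(** * Geodesics and totally geodesic slices *)

Section TotallyGeodesic.
Variable R : realType.
Notation Q := (quat R).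
Notation M3 := 'M[quat R]_3.
Notation V3 := 'cV[quat R]_3.
Implicit Types (p q : Q) (a b c u v w x y : V3) (X Y : M3) (z : pt R).

Definition nscale z : R := (Num.sqrt (- qre (hf (lv z) (lv z))))^-1.
Definition nlv z : V3 := rs (lv z) (qofR (nscale z)).

Lemma nscale_neq0 z : inball z -> nscale z != 0.
Proof.
by move=> /inball_neg nz; rewrite invr_eq0 gt_eqF // sqrtr_gt0 oppr_gt0.
Qed.

Lemma qofR_neq0 (k : R) : k != 0 -> qofR k != 0 :> Q.
Proof. by move=> k0; rewrite -qnorm2_eq0 qnorm2_ofR sqrf_eq0. Qed.

Lemma nlv_unit z : inball z -> hf (nlv z) (nlv z) = -1.
Proof.
move=> bz; have /inball_neg nz := bz.
rewrite hfxx qre_hf_rs qnorm2_ofR exprVn sqr_sqrtr; last by rewrite oppr_ge0 ltW.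
by rewrite invrN mulNr mulVf ?lt_eqF // qofRN qofR1.
Qed.

Lemma sqrt_bcosh2 z z' : inball z -> inball z' -> Num.sqrt (bcosh2 z z') = coshd (nlv z) (nlv z').
Proof.
move=> bz bz'; rewrite bcosh2E /coshd; congr Num.sqrt.
rewrite -(bc_rs _ _ (qofR_neq0 (nscale_neq0 bz)) (qofR_neq0 (nscale_neq0 bz'))).
by rewrite /bc -/(nlv z) -/(nlv z') !nlv_unit // qreN qre1 mulrNN mulr1 divr1.
Qed.

(** The exponential of half the distance is [X + Y], with inverse [X - Y]. Both are multiplicative,
    and their sum gives the addition formula for [X]. *)
Lemma hdist_additive z1 z2 z3 : inball z1 -> inball z2 -> inball z3 ->
  hdist z1 z3 = hdist z1 z2 + hdist z2 z3 -> dist_additive (nlv z1) (nlv z2) (nlv z3).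
Proof.
move=> b1 b2 b3; rewrite /hdist !sqrt_bcosh2 // /dist_additive /acoshR.
have ge1 z z' : inball z -> inball z' -> 1 <= coshd (nlv z) (nlv z').
  move=> bz bz'; rewrite /coshd -[leLHS]sqrtr1; apply: ler_wsqrtr.
  exact: reverse_cauchy (nlv_unit bz) (nlv_unit bz').
have := ge1 _ _ b1 b2; have := ge1 _ _ b2 b3; have := ge1 _ _ b1 b3.
set X3 := coshd (nlv z1) (nlv z3); set X1 := coshd (nlv z1) (nlv z2).
set X2 := coshd (nlv z2) (nlv z3); move=> h3 h2 h1.
have sq (X : R) : 1 <= X -> Num.sqrt (X ^+ 2 - 1) ^+ 2 = X ^+ 2 - 1.
  by move=> hX; rewrite sqr_sqrtr // subr_ge0 exprn_ege1.
have := sq _ h1; have := sq _ h2; have := sq _ h3.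
have := sqrtr_ge0 (X1 ^+ 2 - 1); have := sqrtr_ge0 (X2 ^+ 2 - 1); have := sqrtr_ge0 (X3 ^+ 2 - 1).
set Y3 := Num.sqrt (X3 ^+ 2 - 1); set Y2 := Num.sqrt (X2 ^+ 2 - 1).
set Y1 := Num.sqrt (X1 ^+ 2 - 1); move=> y3 y2 y1 e3 e2 e1 main.
clearbody Y1 Y2 Y3 X1 X2 X3.
have E1 : 0 < X1 + Y1 by lra.
have E2 : 0 < X2 + Y2 by lra.
have E3 : 0 < X3 + Y3 by lra.
have EE : X3 + Y3 = (X1 + Y1) * (X2 + Y2).
  apply: ln_inj; rewrite ?posrE ?mulr_gt0 //.
  by rewrite lnM ?posrE //; lra.
have i3 : (X3 - Y3) * (X3 + Y3) = 1 by rewrite -subr_sqr e3; ring.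
have i12 : (X1 - Y1) * (X2 - Y2) * (X3 + Y3) = 1.
  rewrite EE mulrACA -!subr_sqr e1 e2; ring.
have FF : X3 - Y3 = (X1 - Y1) * (X2 - Y2).
  by apply: (mulIf (x := X3 + Y3)); [rewrite gt_eqF | rewrite i3 i12].
have : 2 * X3 = 2 * (X1 * X2 + Y1 * Y2).
  by rewrite -[2 * X3](_ : X3 + Y3 + (X3 - Y3) = _); [rewrite EE FF; ring | ring].
by move=> h; apply: (mulfI _ h); rewrite pnatr_eq0.
Qed.

Lemma between3 (s t r : R) : [\/ `|s - t| = `|s - r| + `|r - t|,
  `|t - r| = `|t - s| + `|s - r| | `|s - r| = `|s - t| + `|t - r|].
Proof.
rewrite (distrC t r) (distrC t s).
case: (ler0P (s - t)) => h1; case: (ler0P (s - r)) => h2; case: (ler0P (r - t)) => h3;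
  first [apply: Or31; lra | apply: Or32; lra | apply: Or33; lra].
Qed.

Lemma Sp_mul X Y : Sp X -> Sp Y -> Sp (X *m Y).
Proof.
move=> sX sY; transitivity (star Y *m (star X *m JJ R *m X) *m Y).
  by rewrite starM !mulmxA.
by rewrite sX.
Qed.

Section Closed.
Variable P : V3 -> Prop.
Hypotheses (P_scale : forall v (k : R), P v -> P (rs v (qofR k)))
  (P_comb : forall v w (s t : R), P v -> P w ->
     P (rs v (qofR s) + rs w (hf w v * qofR t)))
  (P_div : forall v, P v -> v i2 0 != 0 -> P (rs v (v i2 0)^-1))
  (P_origin : P (lv (origin R))).

(** The real and complex cases are treated at once: [P_comb] has the shape of [on_line], and [P_div]
    returns to a lift with last entry 1. *)
Definition slice : set (pt R) := fun z => inball z /\ P (lv z).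

Lemma origin_inball : inball (origin R).
Proof. by rewrite /inball /= !qnorm2_0 addr0 ltr01. Qed.

(** For any third parameter, one of the three points lies between the others, and equality in the
    triangle inequality puts the lift of the third point on the line of the first two. *)
Lemma slice_geodesic : totally_geodesic slice.
Proof.
split; first by move=> z [].
split; first by exists (origin R); split; [exact: origin_inball|].
move=> z1 z2 [b1 p1] [b2 p2] z12 g [gb gd] [s gs] [t gt] r.
have br := gb r; split => //; set z := g r in br *.
have d12 : hdist z1 z2 = `|s - t| by rewrite -gs -gt gd.
have d21 : hdist z2 z1 = `|t - s| by rewrite -gs -gt gd.
have d1z : hdist z1 z = `|s - r| by rewrite -gs gd.
have dz2 : hdist z z2 = `|r - t| by rewrite -gt gd.
have d2z : hdist z2 z = `|t - r| by rewrite -gt gd.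
have h1 := nlv_unit b1; have h2 := nlv_unit b2; have hz := nlv_unit br.
have dist_neq zz zz' : inball zz -> inball zz' -> zz <> zz' -> forall q, nlv zz <> rs (nlv zz') q.
  move=> bb bb' ne q e; apply: ne.
  have k0 := qofR_neq0 (nscale_neq0 bb); have k0' := qofR_neq0 (nscale_neq0 bb').
  have eq : lv zz = rs (lv zz') (qofR (nscale zz') * q * (qofR (nscale zz))^-1).
    by rewrite -rsA -rsA -/(nlv zz') -e /nlv rsK.
  have : lv zz i2 0 = lv zz' i2 0 * (qofR (nscale zz') * q * (qofR (nscale zz))^-1).
    by rewrite {1}eq rsE.
  by rewrite !lvE2 mul1r => e1; rewrite -(cv_lv zz) eq -e1 rs1 cv_lv.
have [k [l [q [q0 e]]]] : on_line (nlv z1) (nlv z2) (nlv z).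
  have [m|m|m] := between3 s t r.
  - by apply: additive_on_line_mid => //; apply: hdist_additive => //; rewrite d12 d1z dz2.
  - apply: additive_on_line_end => //; last by apply: dist_neq => // e; apply: z12.
    by apply: hdist_additive => //; rewrite d2z d21 d1z.
  - apply: on_line_sym => //; apply: additive_on_line_end => //; last exact: dist_neq.
    by apply: hdist_additive => //; rewrite d1z d12 d2z.
set v := rs _ _ + rs _ _ in e.
have Pv : P v by apply: P_comb; apply: P_scale.
have lz : lv z = rs v (q * (qofR (nscale z))^-1).
  by rewrite -rsA -e /nlv rsK ?qofR_neq0 ?nscale_neq0.
have : lv z i2 0 = v i2 0 * (q * (qofR (nscale z))^-1) by rewrite {1}lz rsE.
rewrite lvE2 => e1.
have v2 : v i2 0 != 0.
  by apply: contra_eq_neq e1 => ->; rewrite mul0r oner_eq0.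
have -> : lv z = rs v (v i2 0)^-1.
  rewrite lz; congr rs; apply: (mulrI (x := v i2 0)); first by rewrite qunitE.
  by rewrite -e1 mulrV ?qunitE.
exact: P_div.
Qed.

Lemma slice_actM X z : Sp X -> (forall v, P v -> P (X *m v)) -> slice z -> slice (actM X z).
Proof.
move=> sX PX [bz Pz]; split; first exact: actM_inball.
have n2 := neg_neq0 (actM_neg sX bz).
by rewrite /actM lv_cv //; apply: P_div => //; exact: PX.
Qed.

Variables (G : set M3) (M : M3).
Hypotheses (GG : Sp_group G) (dM : dag M *m M = 1%:M) (Md : M *m dag M = 1%:M).
Hypothesis PG : forall A, G A -> forall v, P v -> P (dag M *m A *m M *m v).

(** The image of [slice] under [M], written as a preimage under its inverse [dag M]. *)
Definition moved_slice : set (pt R) := fun z => inball z /\ slice (actM (dag M) z).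

Lemma SpM : Sp M. Proof. exact: dag_inv_Sp. Qed.
Lemma SpdM : Sp (dag M). Proof. by apply: dag_inv_Sp; rewrite dagK. Qed.

Lemma actM_MdM z : inball z -> actM M (actM (dag M) z) = z.
Proof. by move=> bz; rewrite actMM ?Md ?actM1 //; [exact: SpM | exact: SpdM]. Qed.
Lemma actM_dMM z : inball z -> actM (dag M) (actM M z) = z.
Proof. by move=> bz; rewrite actMM ?dM ?actM1 //; [exact: SpdM | exact: SpM]. Qed.

Lemma moved_slice_geodesic : totally_geodesic moved_slice.
Proof.
have [sb [[z0 [bz0 Pz0]] sg]] := slice_geodesic.
split; first by move=> z [].
split.
  exists (actM M z0); split; first by apply: actM_inball => //; exact: SpM.
  by rewrite actM_dMM.
move=> z1 z2 [b1 p1] [b2 p2] z12 g [gb gd] [s gs] [t gt] r.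
split; first exact: gb.
apply: (sg _ _ p1 p2 _ (fun r => actM (dag M) (g r))).
- by move=> e; apply: z12; rewrite -(actM_MdM b1) -(actM_MdM b2) e.
- split=> [r'|r' r'']; first by apply: actM_inball => //; exact: SpdM.
  by rewrite actM_hdist //; exact: SpdM.
- by exists s; rewrite gs.
- by exists t; rewrite gt.
Qed.

Lemma moved_slice_stable A z : G A -> inball z -> moved_slice z <-> moved_slice (actM A z).
Proof.
have fwd B z' : G B -> moved_slice z' -> moved_slice (actM B z').
  move=> GB [bz' sz']; have sB := G_sp GG GB.
  split; first exact: actM_inball.
  have e : actM (dag M) (actM B z') = actM (dag M *m B *m M) (actM (dag M) z').
    have bd : inball (actM (dag M) z') by apply: actM_inball => //; exact: SpdM.
    have e1 : actM B z' = actM (B *m M) (actM (dag M) z').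
      by rewrite -{1}(actM_MdM bz') (actMM sB SpM bd).
    by rewrite e1 (actMM SpdM (Sp_mul sB SpM) bd) mulmxA.
  rewrite e; exact: (slice_actM (Sp_mul (Sp_mul SpdM sB) SpM) (PG GB) sz').
move=> GA bz; split; first exact: fwd.
move=> h; have := fwd _ _ (G_dag GG GA) h.
by rewrite actMM ?(G_dagl GG GA) ?actM1 //; [exact: (G_sp GG (G_dag GG GA)) | exact: (G_sp GG GA)].
Qed.

Lemma moved_slice_isometric : isometric moved_slice slice.
Proof.
exists (actM (dag M)); split; first by move=> z [].
split=> [z sz|z z' [bz _] [bz' _]].
  have [bz _] := sz; exists (actM M z); rewrite /moved_slice actM_dMM //.
  by split => //; split => //; apply: actM_inball => //; exact: SpM.
by apply: actM_hdist => //; exact: SpdM.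
Qed.
End Closed.
End TotallyGeodesic.

(** * The standard real and complex slices *)

Section Slices.
Variable R : realType.
Notation Q := (quat R).
Notation V3 := 'cV[quat R]_3.
Implicit Types (p q : Q) (v w : V3).

Lemma qrealP q : qreal q <-> q = qofR (qre q).
Proof.
split=> [[a [b c]]|->]; last by [].
by apply: quat_ext.
Qed.
Lemma qrealD p q : qreal p -> qreal q -> qreal (p + q).
Proof. by move=> /qrealP -> /qrealP ->; rewrite -qofRD. Qed.
Lemma qrealN q : qreal q -> qreal (- q).
Proof. by move=> /qrealP ->; rewrite -qofRN. Qed.
Lemma qrealM p q : qreal p -> qreal q -> qreal (p * q).
Proof. by move=> /qrealP -> /qrealP ->; rewrite -qofRM. Qed.
Lemma qreal_conj q : qreal q -> qreal (qconj q).
Proof. by move=> /qrealP ->; rewrite qconj_ofR. Qed.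
Lemma qrealV q : qreal q -> qreal q^-1.
Proof.
move=> /qrealP ->; have -> : (qofR (qre q))^-1 = qinv (qofR (qre q)) by [].
by rewrite qinvE qconj_ofR -qofRM.
Qed.

Lemma qcomplexD p q : qcomplex p -> qcomplex q -> qcomplex (p + q).
Proof. by move=> [a b] [c d]; rewrite /qcomplex !qE a b c d !addr0. Qed.
Lemma qcomplexN q : qcomplex q -> qcomplex (- q).
Proof. by move=> [a b]; rewrite /qcomplex !qE a b oppr0. Qed.
Lemma qcomplexM p q : qcomplex p -> qcomplex q -> qcomplex (p * q).
Proof. by move=> [a b] [c d]; rewrite /qcomplex !qE a b c d; split; ring. Qed.
Lemma qcomplex_conj q : qcomplex q -> qcomplex (qconj q).
Proof. by move=> [a b]; rewrite /qcomplex /= a b oppr0. Qed.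
Lemma qcomplexV q : qcomplex q -> qcomplex q^-1.
Proof.
move=> [a b]; have -> : q^-1 = qinv q by [].
by rewrite /qcomplex /= a b oppr0 mulr0.
Qed.

Definition real_vec v : Prop := forall i, qreal (v i 0).
Definition complex_vec v : Prop := [/\ qcomplex (v i0 0), v i1 0 = 0 & qcomplex (v i2 0)].

Lemma real_vec_hf v w : real_vec v -> real_vec w -> qreal (hf v w).
Proof.
move=> hv hw; rewrite hfE; apply: qrealD; [apply: qrealD|apply: qrealN];
  by apply: qrealM => //; exact: qreal_conj.
Qed.
Lemma complex_vec_hf v w : complex_vec v -> complex_vec w -> qcomplex (hf v w).
Proof.
move=> [v0 v1 v2] [w0 w1 w2]; rewrite hfE v1 w1 mulr0 addr0.
by apply: qcomplexD; [|apply: qcomplexN]; apply: qcomplexM => //; exact: qcomplex_conj.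
Qed.
Lemma real_vec_rs v q : real_vec v -> qreal q -> real_vec (rs v q).
Proof. by move=> hv hq i; rewrite rsE; exact: qrealM. Qed.
Lemma complex_vec_rs v q : complex_vec v -> qcomplex q -> complex_vec (rs v q).
Proof. by move=> [v0 v1 v2] hq; split; rewrite rsE ?v1 ?mul0r //; exact: qcomplexM. Qed.
Lemma real_vecD v w : real_vec v -> real_vec w -> real_vec (v + w).
Proof. by move=> hv hw i; rewrite mxE; exact: qrealD. Qed.
Lemma complex_vecD v w : complex_vec v -> complex_vec w -> complex_vec (v + w).
Proof.
by move=> [? e ?] [? e' ?]; split; rewrite mxE ?e ?e' ?addr0 //; exact: qcomplexD.
Qed.

Lemma real_vec_comb v w (s t : R) : real_vec v -> real_vec w ->
  real_vec (rs v (qofR s) + rs w (hf w v * qofR t)).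
Proof.
move=> hv hw; apply: real_vecD; apply: real_vec_rs => //.
by apply: qrealM => //; exact: real_vec_hf.
Qed.
Lemma complex_vec_comb v w (s t : R) : complex_vec v -> complex_vec w ->
  complex_vec (rs v (qofR s) + rs w (hf w v * qofR t)).
Proof.
move=> hv hw; apply: complex_vecD; apply: complex_vec_rs => //.
by apply: qcomplexM => //; exact: complex_vec_hf.
Qed.

Lemma real_slice : slice real_vec = @H2R_std R.
Proof.
apply/seteqP; split=> z [bz h]; split => //.
  by have := h i0; have := h i1; rewrite lvE0 lvE1.
by case: h => h0 h1; apply: ord3P; rewrite ?lvE0 ?lvE1 ?lvE2.
Qed.

Lemma complex_slice : slice complex_vec = @H1C_std R.
Proof.
apply/seteqP; split=> z [bz h]; split => //.
  by case: h; rewrite lvE0 lvE1.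
by case: h => h0 h1; split; rewrite ?lvE0 ?lvE1 ?lvE2.
Qed.

Lemma real_vec_mul (B : 'M[quat R]_3) v : (forall i j, qreal (B i j)) -> real_vec v ->
  real_vec (B *m v).
Proof.
move=> hB hv i; rewrite mxE sum3.
by apply: qrealD; [apply: qrealD|]; exact: qrealM.
Qed.

Lemma complex_vec_mul (B : 'M[quat R]_3) v : B i1 i0 = 0 /\ B i1 i2 = 0 ->
  qcomplex (B i0 i0) -> qcomplex (B i0 i2) -> qcomplex (B i2 i0) -> qcomplex (B i2 i2) ->
  complex_vec v -> complex_vec (B *m v).
Proof.
move=> [h1 h2] h00 h02 h20 h22 [v0 v1 v2].
split; rewrite mxE sum3 v1 mulr0 addr0; last first.
- by apply: qcomplexD; exact: qcomplexM.
- by rewrite h1 h2 !mul0r addr0.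
- by apply: qcomplexD; exact: qcomplexM.
Qed.
End Slices.

(** * From functions to matrices *)

Section Bridge.
Variable R : realType.
Notation Q := (quat R).
Notation M3 := 'M[quat R]_3.
Notation V3 := 'cV[quat R]_3.

Definition mx (A : qmat R) : M3 := \matrix_(i, j) A i j.
Definition mxset (G : set (qmat R)) : set M3 := fun X => G (fun i j => X i j).

Lemma mx_fun (A : qmat R) : (fun i j => mx A i j) = A.
Proof. by apply/funext => i; apply/funext => j; rewrite mxE. Qed.

Lemma mxset_mx G (A : qmat R) : mxset G (mx A) <-> G A.
Proof. by rewrite /mxset mx_fun. Qed.

Lemma mx_mmul (A B : qmat R) : mx (mmul A B) = mx A *m mx B.
Proof. by apply/matrixP => i j; rewrite !mxE; apply: eq_bigr => k _; rewrite !mxE. Qed.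

Lemma mmulE (X Y : M3) : mmul (fun i j => X i j) (fun i j => Y i j) = fun i j => (X *m Y) i j.
Proof. by apply/funext => i; apply/funext => j; rewrite mxE. Qed.

Lemma mx_Sp21 (A : qmat R) : Sp21 A -> Sp (mx A).
Proof.
move=> h; have e : mx (madj A) = star (mx A) by apply/matrixP => i j; rewrite !mxE.
have eJ : mx (Jmat R) = JJ R by apply/matrixP => i j; rewrite !mxE.
by rewrite /Sp -e -eJ -mulmxA -!mx_mmul h.
Qed.

Lemma mx_fun_id (X : M3) : mx (fun i j => X i j) = X.
Proof. by apply/matrixP => i j; rewrite mxE. Qed.

Lemma mx_Imat : mx (Imat R) = 1%:M.
Proof. by apply/matrixP => i j; rewrite !mxE /Imat; case: eqP. Qed.

Lemma mxset_group G : is_subgroup_Sp21 G -> Sp_group (mxset G).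
Proof.
move=> [sp [one [mul inv]]]; split.
- by move=> X /sp /mx_Sp21; rewrite mx_fun_id.
- by rewrite -mx_Imat; apply/mxset_mx.
- by move=> X Y gX gY; have := mul _ _ gX gY; rewrite mmulE.
- move=> X gX; have /mx_Sp21 := sp _ gX; rewrite mx_fun_id => sX.
  have [B [gB [XB BX]]] := inv _ gX.
  have eXB : X *m mx B = 1%:M by rewrite -mx_Imat -XB mx_mmul mx_fun_id.
  have eB : mx B = dag X.
    by rewrite -[LHS]mul1mx -(Sp_dag sX) -mulmxA eXB mulmx1.
  by rewrite -eB; split => //; apply/mxset_mx.
Qed.

Lemma mxset_discrete G : is_subgroup_Sp21 G -> discrete_subgroup G ->
  exists2 e : R, 0 < e & forall B, mxset G B ->
    (forall i j, qnorm2 (B i j - (1%:M : M3) i j) < e) -> B = 1%:M.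
Proof.
(* [mdist2] adds up nine entries. *)
move=> [_ [one _]] /(_ _ one) [e [e0 he]]; exists (e / 9).
  by rewrite divr_gt0.
move=> B gB hB; have /he h := gB; rewrite -(mx_fun_id B) h ?mx_Imat //.
have hB' i j : qnorm2 (qsub (Imat R i j) (B i j)) < e / 9.
  have := hB i j; rewrite -mx_Imat mxE -qnorm2N opprB; exact.
rewrite /mdist2 !sum3.
have := hB' i0 i0; have := hB' i0 i1; have := hB' i0 i2.
have := hB' i1 i0; have := hB' i1 i1; have := hB' i1 i2.
have := hB' i2 i0; have := hB' i2 i1; have := hB' i2 i2.
by move=> *; lra.
Qed.

Lemma mxset_trace G : (forall q, trace_field G q -> qreal q) ->
  forall A, mxset G A -> qreal (\tr A).
Proof.
move=> h A gA; have -> : \tr A = qtrace (fun i j => A i j) by [].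
by apply: h => S _; apply.
Qed.

Lemma act_actM (A : qmat R) z : act A z = actM (mx A) z.
Proof.
rewrite /act /actM /cv /chart.
have e i : mvec A (Defs.lift z) i = (mx A *m lv z) i 0.
  by rewrite mxE; apply: eq_bigr => k _; rewrite !mxE.
by rewrite !e.
Qed.

Lemma limit_set_vec G x : limit_set G x -> limit_vec (mxset G) (lv x).
Proof.
move=> [sx hx]; split; first exact: lvE2.
  rewrite /null hfxx qre_hfxx lvE0 lvE1 lvE2 qnorm2_1.
  by move: sx; rewrite /onsphere => ->; rewrite subrr.
move=> e /hx [A [gA h]]; exists (mx A); first exact/mxset_mx.
have eA i : (mx A *m lv (origin R)) i 0 = A i i2.
  by rewrite mxE sum3 lvE0 lvE1 lvE2 !mulr0 !add0r mulr1 mxE.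
by move: h; rewrite act_actM /edist2 /actM /cv /= !eA lvE0 lvE1 !mxE.
Qed.

Lemma lv_inj : injective (@lv R).
Proof. by move=> x y e; rewrite -(cv_lv x) e cv_lv. Qed.
End Bridge.

Theorem theorem4p8 (R : realType) (G : set (qmat R)) :
  is_subgroup_Sp21 G -> discrete_subgroup G -> nonelementary G ->
  (forall q, trace_field G q -> qreal q) ->
  exists S : set (pt R),
    totally_geodesic S /\ stabilizes G S /\
    (isometric S (@H2R_std R) \/ isometric S (@H1C_std R)).
Proof.
move=> Gsub Gdisc [p1 [p2 [p3 [l1 [l2 [l3 [p12 [p23 p13]]]]]]]] Gtrace.
have GG := mxset_group Gsub; have Gd := mxset_discrete Gsub Gdisc.
have Gtr := mxset_trace Gtrace.
have lx1 := limit_set_vec l1; have lx2 := limit_set_vec l2; have lx3 := limit_set_vec l3.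
set x1 := lv p1 in lx1; set x2 := lv p2 in lx2; set x3 := lv p3 in lx3.
have x12 : x1 <> x2 by move=> /lv_inj.
have x23 : x2 <> x3 by move=> /lv_inj.
have x13 : x1 <> x3 by move=> /lv_inj.
have nofix (p : 'cV[quat R]_3) : null p -> p i2 0 = 1 ->
    (forall A, mxset G A -> fixes A p) -> False.
  by move=> np pp fp; exact: (no_fixed_null GG Gd np pp fp lx1 lx2 lx3).
have nz i j := @coef_nonzero _ _ GG i j nofix.
have [e1 n1 _] := lx1; have [e2 n2 _] := lx2; have [e3 n3 _] := lx3.
have h12 := null_hf_neq0 n1 n2 e1 e2 x12.
have h13 := null_hf_neq0 n1 n3 e1 e3 x13.
have h23 := null_hf_neq0 n2 n3 e2 e3 x23.
(* Scaling for [hf x1 z = -1]. It costs [z] its last entry 1, which is why [K_real] also receives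
   [x2] and [s]. *)
pose s := - (hf x1 x2)^-1.
have s0 : s != 0 by rewrite oppr_eq0 invr_eq0.
pose z := rs x2 s.
have nz' : null z by rewrite /null hf_rsr hf_rsl n2 mulr0 mul0r.
have xz : hf x1 z = -1 by rewrite hf_rsr mulrN mulrV ?qunitE.
have cs0 : qconj s != 0 by rewrite qconj_eq0.
have Dxz : exists2 q, q != 0 & coef (mxset G) x1 z q.
  have [q q0 hq] := nz _ _ lx1 lx2; exists (q * (qconj s)^-1).
    by apply: qmulf_neq0; rewrite ?invr_eq0.
  by apply/coef_rsr; rewrite mulrVK ?qunitE.
have Dzz : exists2 q, q != 0 & coef (mxset G) z z q.
  have [q q0 hq] := nz _ _ lx2 lx2; exists (s^-1 * q * (qconj s)^-1).
    by apply: qmulf_neq0; [apply: qmulf_neq0|]; rewrite ?invr_eq0.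
  by apply/coef_rsr/coef_rsl; rewrite mulrVK ?qunitE // mulrA mulrV ?qunitE // mul1r.
have Dxx := nz _ _ lx1 lx1.
have Kr := K_real GG Gtr n1 nz' xz Dxz Dxx Dzz (erefl z) s0 n2 e2 e1.
have D1 := K1 GG xz Dxz.
have [[D11 D22 Dr]|[d [rd dd hx hz Dxr]]] := pair_class GG xz Dxz Dxx Dzz Kr.
  have [q q0 hq] := nz _ _ lx1 lx3.
  (* Rescaling by an element of D(x1, x3) brings 1 into D(x1, z3), as [real_frame] requires. *)
  pose z3 := rs x3 (qconj q).
  have nz3 : null z3 by rewrite /null hf_rsr hf_rsl n3 mulr0 mul0r.
  have hxz3 : hf x1 z3 != 0 by rewrite hf_rsr; apply: qmulf_neq0 => //; rewrite qconj_eq0.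
  have hzz3 : hf z z3 != 0.
    by rewrite hf_rsr hf_rsl; apply: qmulf_neq0; [apply: qmulf_neq0|]; rewrite ?qconj_eq0.
  have Dxz3 : coef (mxset G) x1 z3 1 by apply/coef_rsr; rewrite qconjK mul1r.
  have [M [dM Md hM]] := real_frame GG n1 nz' xz D11 D22 Dr D1 nz3 hxz3 hzz3 Dxz3.
  have div (v : 'cV[quat R]_3) : real_vec v -> v i2 0 != 0 -> real_vec (rs v (v i2 0)^-1).
    by move=> hv _; apply: real_vec_rs => //; exact: qrealV.
  have scal (v : 'cV[quat R]_3) (k : R) : real_vec v -> real_vec (rs v (qofR k)).
    by move=> hv; exact: real_vec_rs.
  have org : real_vec (lv (origin R)).
    by apply: ord3P; rewrite ?lvE0 ?lvE1 ?lvE2.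
  exists (moved_slice (@real_vec R) M); split.
    exact: (moved_slice_geodesic (P := @real_vec R) scal (@real_vec_comb R) div org dM Md).
  split; last by left; rewrite -real_slice; exact: moved_slice_isometric dM Md.
  move=> A GA w bw; rewrite act_actM.
  apply: (moved_slice_stable (P := @real_vec R) div GG dM Md) => //; last exact/mxset_mx.
  by move=> B gB v hv; apply: real_vec_mul => //; exact: hM.
have [M [dM Md hM]] := complex_frame GG n1 nz' xz rd dd hx hz D1 Dxr Kr.
have div (v : 'cV[quat R]_3) : complex_vec v -> v i2 0 != 0 -> complex_vec (rs v (v i2 0)^-1).
  by move=> hv _; apply: complex_vec_rs => //; case: hv => _ _ /qcomplexV.
have scal (v : 'cV[quat R]_3) (k : R) : complex_vec v -> complex_vec (rs v (qofR k)).
  by move=> hv; exact: complex_vec_rs.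
have org : complex_vec (lv (origin R)).
  by split; rewrite ?lvE0 ?lvE1 ?lvE2.
exists (moved_slice (@complex_vec R) M); split.
  exact: (moved_slice_geodesic (P := @complex_vec R) scal (@complex_vec_comb R) div org dM Md).
split; last by right; rewrite -complex_slice; exact: moved_slice_isometric dM Md.
move=> A GA w bw; rewrite act_actM.
apply: (moved_slice_stable (P := @complex_vec R) div GG dM Md) => //; last exact/mxset_mx.
move=> B gB v hv; have [b1 b2 b3 b4 b5] := hM _ gB.
exact: complex_vec_mul.
Qed.
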